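(* Let $T^+=(T^+(s))_{s\in[0,t]}$ be a telegraph meander with parameters $\lambda>0$, $c>0$, $t>0$. Then, for $|\gamma|<\lambda/c$, $$\mathsf{E}\big[e^{i\gamma T^+(t)}\big]=1+c\gamma(c\gamma+i\lambda)\,\frac{\sinh\!\big(t\sqrt{\lambda^2-c^2\gamma^2}\big)+ic\gamma\int_0^t\sinh\!\big(s\sqrt{\lambda^2-c^2\gamma^2}\big)I_0(\lambda(t-s))\,ds}{\lambda\sqrt{\lambda^2-c^2\gamma^2}\,\big(I_0(\lambda t)+I_1(\lambda t)\big)}$$ $$\qquad+\,ic\gamma\,\frac{\cosh\!\big(t\sqrt{\lambda^2-c^2\gamma^2}\big)-I_0(\lambda t)+ic\gamma\int_0^t\cosh\!\big(s\sqrt{\lambda^2-c^2\gamma^2}\big)I_0(\lambda(t-s))\,ds}{\lambda\big(I_0(\lambda t)+I_1(\lambda t)\big)}.$$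
   Context: Let $N$ be a homogeneous Poisson process of rate $\lambda>0$, and let $V(0)$ be independent of $N$ and uniformly distributed on $\{-c,c\}$, $c>0$. Set $V(s)=V(0)(-1)^{N(s)}$ and $T(s)=\int_0^sV(u)\,du$ (telegraph process). The telegraph meander $T^+$ on $[0,t]$ is the random continuous function on $[0,t]$ whose law is that of $(T(s))_{0\le s\le t}$ conditioned on $\{\min_{0\le s\le t}T(s)\ge0\}$; in particular the law of $T^+(t)$ is the conditional law of $T(t)$ given $\min_{0\le s\le t}T(s)\ge0$. $I_\nu(x)=\sum_{k\ge0}(x/2)^{2k+\nu}\frac{1}{k!\,\Gamma(\nu+k+1)}$ is the modified Bessel function of the first kind. Here $\gamma\in\mathbb{R}$. *)

(* Defs.v *)
From mathcomp Require Export all_boot all_order all_algebra.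
From mathcomp Require Export all_classical all_reals all_analysis.
From mathcomp Require Export complex.
#[export] Set Implicit Arguments.
#[export] Unset Strict Implicit.
#[export] Unset Printing Implicit Defensive.
Export Order.TTheory GRing.Theory Num.Theory.
Export numFieldNormedType.Exports.

Local Open Scope classical_set_scope.
Local Open Scope ring_scope.
Local Open Scope complex_scope.

Section special_functions.
Context {R : realType}.
Implicit Types x a nu : R.

Definition sinh x : R := (expR x - expR (- x)) / 2.

Definition cosh x : R := (expR x + expR (- x)) / 2.

(* Euler's integral; meaningful for 0 < a. *)
Definition Gamma a : R :=
  \int[lebesgue_measure]_(x in `]0, +oo[) (x `^ (a - 1) * expR (- x)).

(* Meaningful for 0 <= x and nu > -1; 0 `^ 0 = 1, so besselI 0 0 = 1. *)
Definition besselI nu x : R :=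
  limn (series (fun k : nat =>
    (x / 2) `^ (2 * k%:R + nu) / ((k`!)%:R * Gamma (nu + k%:R + 1)))).

Definition cexp (z : R[i]) : R[i] :=
  (expR (complex.Re z))%:C * (cos (complex.Im z) +i* sin (complex.Im z)).

Definition cexpectation d (T : measurableType d) (P : probability T R)
    (Z : T -> R[i]) : R[i] :=
  fine ('E_P[fun w => complex.Re (Z w)])%E +i* fine ('E_P[fun w => complex.Im (Z w)])%E.

End special_functions.

(* The sigma-algebra generated by the maps X i for i in D. *)
Definition generated_sigma_algebra (I T : Type) d (E : measurableType d)
    (D : set I) (X : I -> T -> E) : set (set T) :=
  <<s [set A | exists i B, [/\ D i, measurable B & A = X i @^-1` B]] >>.

Section independence.
Context {R : realType} d (T : measurableType d) (P : probability T R).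

Definition independent_set_systems (F G : set (set T)) : Prop :=
  forall A B, F A -> G B -> P (A `&` B) = (P A * P B)%E.

Definition mutually_independent (I : finType) d' (E : measurableType d')
    (X : I -> T -> E) : Prop :=
  forall (J : {set I}) (U : I -> set E), (forall i, measurable (U i)) ->
    P (\bigcap_(i in [set` J]) (X i @^-1` U i)) =
    (\prod_(i in J) P (X i @^-1` U i))%E.

Definition conditional_probability (E A : set T) : R :=
  fine (P (A `&` E)) / fine (P E).

End independence.

Section telegraph.
Context {R : realType}.

(* Only times s >= 0 matter; since the paths are nondecreasing, the truncated *)
(* differences in nat are the genuine increments.                             *)
Record poisson_process d (T : measurableType d) (P : probability T R)
    (lambda : R) (N : R -> T -> nat) : Prop := PoissonProcess {
  poisson_measurable : forall s, 0 <= s -> measurable_fun setT (N s) ;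
  poisson_start : forall w, N 0 w = 0%N ;
  poisson_nondecreasing : forall w s u, 0 <= s -> s <= u ->
    (N s w <= N u w)%N ;
  poisson_right_continuous : forall w s, 0 <= s ->
    \forall u \near s^'+, N u w = N s w ;
  poisson_increments_law : forall s u (k : nat), 0 <= s -> s < u ->
    P [set w | (N u w - N s w)%N = k] = (poisson_pmf (lambda * (u - s)) k)%:E ;
  poisson_increments_independent : forall (n : nat) (tau : nat -> R),
    0 <= tau 0%N -> {homo tau : i j / (i <= j)%N >-> i <= j} ->
    mutually_independent P
      (fun (i : 'I_n) w => (N (tau i.+1) w - N (tau i) w)%N) }.

Definition uniform_on_pm d (T : measurableType d) (P : probability T R)
    (c : R) (V0 : {RV P >-> R}) : Prop :=
  forall U : set R, measurable U ->
    distribution P V0 U = ((2^-1)%R%:E * (\d_((- c)%R) U + \d_c U))%E.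

Definition independent_of_process d (T : measurableType d)
    (P : probability T R) (V0 : {RV P >-> R}) (N : R -> T -> nat) : Prop :=
  independent_set_systems P
    [set V0 @^-1` B | B in measurable]
    (generated_sigma_algebra [set s : R | 0 <= s] N).

Definition velocity (T : Type) (N : R -> T -> nat) (V0 : T -> R)
    (s : R) (w : T) : R :=
  V0 w * (-1) ^+ N s w.

Definition telegraph (T : Type) (N : R -> T -> nat) (V0 : T -> R)
    (s : R) (w : T) : R :=
  \int[lebesgue_measure]_(u in `[0, s]) velocity N V0 u w.

(* The infimum is a minimum, as the paths of X are continuous on [0, t] in    *)
(* all uses below.                                                            *)
Definition nonneg_min (T : Type) (t : R) (X : R -> T -> R) : set T :=
  [set w | 0 <= inf [set X s w | s in `[0, t]]].

(* Tp is a random element of C[0, t] (only its values at times in [0, t]      *)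
(* matter). The sigma-algebra generated by the evaluations at times in [0, t] *)
(* is the Borel one on C[0, t], so the last clause is equality of laws there. *)
Record telegraph_meander d (T : measurableType d) (P : probability T R)
    (N : R -> T -> nat) (V0 : T -> R) (t : R)
    d' (T' : measurableType d') (P' : probability T' R)
    (Tp : R -> T' -> R) : Prop := TelegraphMeander {
  meander_measurable : forall s, s \in `[0, t] ->
    measurable_fun setT (Tp s) ;
  meander_continuous : forall w, {within `[0, t], continuous (Tp ^~ w)} ;
  meander_law : forall A : set (R -> R),
    generated_sigma_algebra `[0, t] (fun s (f : R -> R) => f s) A ->
    P' [set w | A (Tp ^~ w)] =
    (conditional_probability P
       (nonneg_min t (telegraph N V0))
       [set w | A (telegraph N V0 ^~ w)])%:E }.

End telegraph.

(* Main.v *)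
(* Write T = V(0) Y, where Y moves with velocity (-1)^N. On {V(0) = -c} the path
   gets negative at once, so only Y and the event that it stays nonnegative
   ("alive") matter. Let D be the death time, the last time up to which Y is nonnegative.

   If phi solves the backward Kolmogorov equations of (Y, velocity), then
   Dynkin's formula phi_+(0,0) = E[phi(t, Y(t)); alive] + E[phi_-(D, 0); dead]
   holds; it is proved by discretising time, killing the discretised path below
   a barrier that tends to 0 more slowly than the mesh.

   For phi = e^(-zs - theta x) it determines the Laplace transform of
   P(D >= .) on [0, t] up to O(e^(-zt)). The function e^(-lambda s) (I_0 + I_1)(lambda s)
   has the same transform up to O(e^(-zt)), because the truncated transforms of
   the I_n are a bounded solution of a linear recurrence. A lemma of Mikusinski
   then identifies the two functions.

   For phi built from e^(i gamma x) the formula expresses E[e^(i gamma T(t)); alive]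
   by an integral against P(D >= .), and I_0' = I_1 and an integration by parts
   give the stated form. *)

(* Trigonometric solutions need not vanish at [x = 0], so Dynkin's formula for them involves the law
   of the death time; this law has to be found first, and the exponential solutions supply it. One
   number governs that step: the root [xi] in ]0, 1[ of [lambda * (xi + xi^-1) / 2 = z + lambda]. It
   is the quotient of the two components of the bounded exponential solution, and also the decaying
   characteristic root of the Bessel recurrence; both transforms are therefore close to
   [(1 - xi) / z], and no transform is inverted. Dynkin's formula stops at the horizon [t], where
   surviving paths leave a term of order e^(-zt); this is harmless, since such a term carries no
   information about times before [t]. The uniqueness lemma, sampled at integers [z], yields equal
   integrals only; the survival function is monotone and the Bessel side continuous, which gives
   equality at every time. The condition on [gamma] makes [r] positive. Complex numbers enter only
   at the end: a phase [theta] in cos(gamma x + theta), taken as 0 and - pi / 2, carries the real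
   and imaginary parts. *)
Require Import Defs.
From mathcomp Require Import measurable_realfun ring lra.

Local Open Scope classical_set_scope.
Local Open Scope ring_scope.

Ltac by_derivative := move=> ?; apply: differentiable_continuous;
  apply/derivable1_diffP; exact: ex_derive.

(** * Bounded functions on sets of finite measure *)

Section bounded_integrals.
Context {R : realType} d (T : measurableType d) (mu : {measure set T -> \bar R}).
Implicit Types (D : set T) (f : T -> R).

Lemma integrable_bounded D f M : measurable D -> (mu D < +oo)%E ->
  measurable_fun D f -> (forall x, D x -> `|f x| <= M) ->
  mu.-integrable D (EFin \o f).
Proof.
move=> mD Dfin mf fM; apply: measurable_bounded_integrable => //.
by exists M; split; [exact: num_real|move=> x Mx y Dy; exact: le_trans (fM _ Dy) (ltW Mx)].
Qed.

Lemma normr_Rintegral_le D f M : measurable D -> (mu D < +oo)%E ->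
  measurable_fun D f -> (forall x, D x -> `|f x| <= M) ->
  `|\int[mu]_(x in D) f x| <= M * fine (mu D).
Proof.
move=> mD Dfin mf fM.
have fi := integrable_bounded mD Dfin mf fM.
apply: le_trans (le_normr_Rintegral mD fi) _.
rewrite -Rintegral_cst//; apply: le_Rintegral => //.
- by apply: (@integrable_bounded _ _ M) => // [|x Dx]; [exact: measurableT_comp|rewrite normr_id fM].
- by apply: (@integrable_bounded _ _ `|M|).
Qed.

Lemma bounded_convergence D (f_ : nat -> T -> R) f M : measurable D ->
  (mu D < +oo)%E -> (forall n, measurable_fun D (f_ n)) ->
  (forall n x, D x -> `|f_ n x| <= M) ->
  (forall x, D x -> f_ ^~ x @ \oo --> f x) ->
  measurable_fun D f /\
  (fun n => \int[mu]_(x in D) f_ n x) @ \oo --> \int[mu]_(x in D) f x.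
Proof.
move=> mD Dfin mf_ fM ff.
have mf : measurable_fun D f by exact: measurable_fun_cvg ff.
split=> //.
have [|||||fi _ cvg] := @dominated_convergence _ _ _ mu D mD
  (fun n x => (f_ n x)%:E) (fun x => (f x)%:E) (cst `|M|%:E).
- by move=> n; exact/measurable_EFinP.
- exact/measurable_EFinP.
- by apply: aeW => x Dx; apply: cvg_EFin; [exact: nearW|exact: ff].
- by apply: (@integrable_bounded D (cst `|M|) `|M|) => // x _; rewrite normr_id.
- apply: aeW => x n Dx; rewrite lee_fin.
  exact: le_trans (fM _ _ Dx) (ler_norm _).
apply: (@fine_cvg _ _ _ _ (fun n => \int[mu]_(x in D) (f_ n x)%:E)%E).
by rewrite fineK//; exact: integrable_fin_num.
Qed.

End bounded_integrals.

Lemma lebesgue_itv_lty {R : realType} (a b : R) :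
  (lebesgue_measure `[a, b]%classic < +oo)%E.
Proof. by rewrite lebesgue_measure_itv; case: ifP => _; rewrite ltry. Qed.

Lemma fine_lebesgue_itv {R : realType} (a b : R) : a <= b ->
  fine (lebesgue_measure `[a, b]%classic) = b - a.
Proof.
move=> ab; rewrite lebesgue_measure_itv/= lte_fin; case: ltP => //= ba.
by rewrite (@le_anti _ _ a b) ?ab ?ba// subrr.
Qed.

(** * Calculus on segments *)

Section calculus.
Context {R : realType}.
Notation mu := (@lebesgue_measure R).
Implicit Types (f g F G : R -> R).

Lemma FTC2 F f (a b : R) : a <= b -> (forall x : R, is_derive x 1 F (f x)) ->
  continuous f -> \int[mu]_(x in `[a, b]) f x = F b - F a.
Proof.
move=> ab dF cf; move: ab; rewrite le_eqVlt => /predU1P[->|ab].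
  by rewrite set_itv1 Rintegral_set1 subrr.
rewrite /Rintegral (@continuous_FTC2 _ f F)//.
- exact: continuous_subspaceT.
- split; first by move=> x _; exact: ex_derive.
  + apply: cvg_at_right_filter; apply: differentiable_continuous.
    by apply/derivable1_diffP; exact: ex_derive.
  + apply: cvg_at_left_filter; apply: differentiable_continuous.
    by apply/derivable1_diffP; exact: ex_derive.
- by move=> x _; rewrite derive1E derive_val.
Qed.

Lemma continuous_integrable f (a b : R) : continuous f ->
  mu.-integrable `[a, b] (EFin \o f).
Proof.
move=> cf; apply: continuous_compact_integrable; first exact: segment_compact.
exact: continuous_subspaceT.
Qed.

Lemma is_derive_continuous F f : (forall x : R, is_derive x 1 F (f x)) -> continuous F.
Proof.
move=> dF x; apply: differentiable_continuous.
by apply/derivable1_diffP; exact: ex_derive.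
Qed.

Lemma parts_integral F G f g (a b : R) : a <= b ->
  (forall x : R, is_derive x 1 F (f x)) -> continuous f ->
  (forall x : R, is_derive x 1 G (g x)) -> continuous g ->
  \int[mu]_(x in `[a, b]) (F x * g x) =
  F b * G b - F a * G a - \int[mu]_(x in `[a, b]) (f x * G x).
Proof.
move=> ab dF cf dG cg.
have cF := is_derive_continuous dF; have cG := is_derive_continuous dG.
have dFG (x : R) : is_derive x 1 (F * G) (F x * g x + f x * G x).
  apply: is_derive_eq (is_deriveM (dF x) (dG x)) _.
  by rewrite /GRing.scale/= [G x * _]mulrC.
have cFg : continuous (fun x => F x * g x) by move=> x; exact: (cvgM (cF x) (cg x)).
have cfG : continuous (fun x => f x * G x) by move=> x; exact: (cvgM (cf x) (cG x)).
apply/eqP; rewrite -subr_eq opprK -RintegralD//; last 2 first.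
- exact: continuous_integrable.
- exact: continuous_integrable.
rewrite (FTC2 ab dFG)// => x; exact: (cvgD (cFg x) (cfG x)).
Qed.

Lemma reverse_integral f (t : R) : 0 <= t -> continuous f ->
  \int[mu]_(s in `[0, t]) f (t - s) = \int[mu]_(s in `[0, t]) f s.
Proof.
move=> t0 cf; rewrite /Rintegral.
have dB (x : R) : is_derive x 1 (fun y : R => t - y) (-1).
  by apply: is_derive_eq; rewrite add0r mul1r.
have d1 : derive1 (fun y : R => t - y) = cst (-1).
  by apply/funext => x; rewrite derive1E derive_val.
have := @integration_by_substitution_decreasing R (fun y => t - y) f 0 t t0.
rewrite subrr subr0 => ->//.
- by congr fine; apply: eq_integral => x _; rewrite /= !fctE d1/= opprK mulr1.
- by move=> x y _ _ xy; rewrite ltrD2l ltrN2.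
- by rewrite d1 => x _; exact: cvg_cst.
- by rewrite d1; exact: is_cvg_cst.
- by rewrite d1; exact: is_cvg_cst.
- split; first by move=> x _; exact: ex_derive.
  + by apply: cvg_at_right_filter; exact: (is_derive_continuous dB).
  + by apply: cvg_at_left_filter; exact: (is_derive_continuous dB).
- exact: continuous_subspaceT.
Qed.

Lemma lipschitz_derive f f' M (a b : R) : a <= b ->
  (forall x : R, is_derive x 1 f (f' x)) -> (forall x, a <= x <= b -> `|f' x| <= M) ->
  `|f b - f a| <= M * (b - a).
Proof.
move=> ab df fM.
have [x xab ->] := @MVT_segment _ f f' a b ab (fun x _ => df x)
  (continuous_subspaceT (is_derive_continuous df)).
rewrite normrM (ger0_norm (_ : 0 <= b - a)) ?subr_ge0// ler_wpM2r ?subr_ge0//.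
by apply: fM; move: xab; rewrite in_itv.
Qed.

End calculus.

(** * Uniqueness for truncated Laplace transforms *)

Section mikusinski.
Context {R : realType}.
Notation mu := (@lebesgue_measure R).

Lemma series_exp_coeff_le (y : R) n : 0 <= y -> series (exp_coeff y) n <= expR y.
Proof.
move=> y0; apply: nondecreasing_cvgn_le; last exact: is_cvg_series_exp_coeff.
by apply/nondecreasing_seqP => k; rewrite seriesSr lerDl exp_coeff_ge0.
Qed.

(** Needed at negative [y], where the partial sums alternate; their moduli are dominated by the
    partial sums at [a], uniformly in [n]. *)
Lemma normr_series_exp_coeff (y a : R) n : `|y| <= a ->
  `|series (exp_coeff y) n| <= expR a.
Proof.
move=> ya; apply: le_trans (series_exp_coeff_le n (le_trans (normr_ge0 _) ya)).
rewrite /series/=; apply: le_trans (ler_norm_sum _ _ _) _.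
apply: ler_sum => k _; rewrite /exp_coeff/= normrM normfV normrX.
by rewrite (ger0_norm (ler0n _ _)) ler_wpM2r ?invr_ge0// lerXn2r ?nnegrE// (le_trans _ ya).
Qed.

Lemma continuous_series_exp_coeff (h : R -> R) n : continuous h ->
  continuous (fun s => series (exp_coeff (h s)) n).
Proof.
move=> ch; elim: n => [|n IHn].
  by rewrite (_ : (fun _ => _) = cst 0); [move=> s; exact: cvg_cst|apply/funext => s; rewrite seriesEnat/= big_geq].
have -> : (fun s => series (exp_coeff (h s)) n.+1) =
  (fun s => series (exp_coeff (h s)) n + h s ^+ n * (n`!%:R)^-1).
  by apply/funext => s; rewrite seriesSr.
move=> s; apply: cvgD; first exact: IHn.
by apply: cvgMl; 
  exact: (@continuous_comp _ _ _ h (fun x => x ^+ n) s (ch s) (@exprn_continuous _ _ _)).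
Qed.

(* The sum of [(-1)^k / k! e^(nks0) e^(-nks)] over [k >= 1] is
   [exp (- e^(n(s0 - s))) - 1], which tends to [- 1_(s < s0)] as [n] grows,
   while the hypothesis bounds its integral against [f] by [C (exp (e^(n(s0 - t))) - 1)]. *)
Lemma laplace_unique (f : R -> R) (M C t : R) :
  measurable_fun `[0, t] f -> (forall s, `[0, t]%classic s -> `|f s| <= M) ->
  (forall n, (0 < n)%N ->
     `|\int[mu]_(s in `[0, t]) (expR (- (n%:R * s)) * f s)| <= C * expR (- (n%:R * t))) ->
  forall s0, 0 < s0 < t -> \int[mu]_(s in `[0, s0]) f s = 0.
Proof.
move=> mf fM H s0 /andP[s00 s0t].
have t0 : 0 < t by exact: lt_trans s0t.
have M0 : 0 <= M by apply: le_trans (fM 0 _); rewrite //= in_itv/= lexx ltW.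
have C0 : 0 <= C.
  have := le_trans (normr_ge0 _) (H 1%N isT).
  by rewrite pmulr_lge0// expR_gt0.
pose a n := expR (n%:R * s0); pose b n := expR (- (n%:R * (t - s0))).
pose h n s := - a n * expR (- (n%:R * s)).
have ch n : continuous (h n).
  by_derivative.
have ha n s : 0 <= s -> `|h n s| <= a n.
  move=> s_ge0; rewrite /h normrM normrN (ger0_norm (expR_ge0 _)).
  rewrite (ger0_norm (expR_ge0 _)) ler_piMr ?expR_ge0// -expR0 ler_expR oppr_le0.
  by rewrite mulr_ge0.
pose G n K s := (series (exp_coeff (h n s)) K.+1 - 1) * f s.
have mG n K : measurable_fun `[0, t] (G n K).
  apply: measurable_funM => //; apply: measurable_funB => //.
  apply: measurable_funTS; apply: continuous_measurable_fun.
  exact: continuous_series_exp_coeff.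
(* This bound depends on [n] and only serves to let [K] tend to infinity for fixed [n]. The limit
   [F n] obeys the bound [M], uniform in [n], which the second passage to the limit uses. *)
have GM n K s : `[0, t]%classic s -> `|G n K s| <= (expR (a n) + 1) * M.
  move=> s0t'; rewrite normrM ler_pM// ?fM//.
  apply: le_trans (ler_normB _ _) _; rewrite normr1 lerD2r.
  by apply: normr_series_exp_coeff; apply: ha; move: s0t'; rewrite /= in_itv/= => /andP[].
have Gint n K : mu.-integrable `[0, t] (EFin \o G n K).
  exact: integrable_bounded (lebesgue_itv_lty _ _) (mG n K) (GM n K).
(* The term of index [k] is a multiple of the transform at the integer [n * k], and a^k e^(-nkt) =
   b^k, so the bounds add up to a partial sum of exp (b n). *)
have IG n K : (0 < n)%N -> `|\int[mu]_(s in `[0, t]) G n K s| <= C * (series (exp_coeff (b n)) K.+1 - 1).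
  move=> n0; elim: K => [|K IHK].
    rewrite (_ : G n 0%N = cst 0) ?Rintegral_cst//.
      by rewrite mul0r normr0 mulr_ge0// seriesEnat/= big_nat1/exp_coeff/= expr0 fact0 divr1 subrr.
    by apply/funext => s; rewrite /G seriesEnat/= big_nat1/exp_coeff/= expr0 fact0 divr1 subrr mul0r.
  set k := K.+1.
  pose g s := expR (- ((n * k)%:R * s)) * f s.
  have GE s : G n k s = G n K s + (- a n) ^+ k / k`!%:R * g s.
    rewrite /G seriesSr -/k /exp_coeff/= /h /g exprMn -expRM_natl.
    rewrite mulrN mulrA -natrM mulnC; ring.
  have gint : mu.-integrable `[0, t] (EFin \o g).
    apply: (@integrable_bounded _ _ _ _ _ _ M) => //; first exact: lebesgue_itv_lty.
      apply: measurable_funM => //; apply: measurable_funTS.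
      apply: continuous_measurable_fun; by_derivative.
    move=> s s0t'; rewrite /g normrM -[leRHS]mul1r ler_pM// ?fM//.
    rewrite (ger0_norm (expR_ge0 _)) -expR0 ler_expR oppr_le0 mulr_ge0//.
    by move: s0t'; rewrite /= in_itv/= => /andP[].
  under eq_Rintegral do rewrite GE.
  rewrite RintegralD//; last by apply: (integrableZl _ _ gint) => //.
  rewrite RintegralZl//; apply: le_trans (ler_normD _ _) _.
  rewrite seriesSr -/k [_ + exp_coeff _ _]addrC -addrA [_ + (_ - 1)]addrC mulrDr lerD//.
  rewrite normrM normrM normrX normrN normfV (ger0_norm (expR_ge0 _)) (ger0_norm (ler0n _ _)).
  apply: le_trans (ler_wpM2l _ (H (n * k)%N _)) _.
  - by rewrite divr_ge0// exprn_ge0// expR_ge0.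
  - by rewrite muln_gt0 n0.
  rewrite /exp_coeff/= mulrCA ler_wpM2l// mulrAC ler_wpM2r ?invr_ge0//.
  rewrite /a /b -!expRM_natl -expRD ler_expR natrM.
  by rewrite le_eqVlt; apply/orP; left; apply/eqP; ring.
pose F n s := (expR (h n s) - 1) * f s.
have FM n s : `[0, t]%classic s -> `|F n s| <= M.
  move=> s0t'; rewrite /F normrM -[leRHS]mul1r ler_pM// ?fM//.
  have : 0 < expR (h n s) <= 1.
    rewrite expR_gt0/= -expR0 ler_expR /h mulNr oppr_le0 mulr_ge0 ?expR_ge0//.
  move=> /andP[e0 e1]; rewrite ler_norml; lra.
have cvg_ser n : (fun K => series (exp_coeff (n : R)) K.+1) @ \oo --> expR n.
  by rewrite -[X in X @ _]/(series (exp_coeff n) \o S) cvg_shiftS; exact: is_cvg_series_exp_coeff.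
have IF n : (0 < n)%N -> `|\int[mu]_(s in `[0, t]) F n s| <= C * (expR (b n) - 1).
  move=> n0.
  have [|_ cF] := @bounded_convergence _ _ _ mu `[0, t] (G n) (F n) _
    (measurable_itv _) (lebesgue_itv_lty _ _) (mG n) (GM n).
    move=> s _; apply: cvgMr_tmp; apply: cvgB; last exact: cvg_cst.
    exact: cvg_ser.
  have cB : (fun K => C * (series (exp_coeff (b n)) K.+1 - 1)) @ \oo --> C * (expR (b n) - 1).
    by apply: cvgMl_tmp; apply: cvgB; [exact: cvg_ser|exact: cvg_cst].
  apply: (ler_cvg_to (cvg_norm cF) cB).
  by apply: nearW => K; exact: IG.
have mF n : measurable_fun `[0, t] (F n).
  apply: measurable_funM => //; apply: measurable_funB => //.
  apply: measurable_funTS; apply: continuous_measurable_fun => s.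
  exact: (continuous_comp (ch n s) (@continuous_expR _ _)).
have Fint n : mu.-integrable `[0, t] (EFin \o F n).
  exact: integrable_bounded (lebesgue_itv_lty _ _) (mF n) (FM n).
have expR_decay r : 0 < r -> (fun n => expR (- (n%:R * r))) @ \oo --> (0 : R).
  move=> r0.
  have -> : (fun n => expR (- (n%:R * r))) = (fun n => expR (- r) ^+ n).
    by apply/funext => n; rewrite -expRM_natl mulrN.
  by apply: cvg_expr; rewrite ger0_norm ?expR_ge0// -expR0 ltr_expR oppr_lt0.
have expR_dec_exp r : 0 < r -> (fun n => expR (- expR (n%:R * r))) @ \oo --> (0 : R).
  move=> r0; apply: (@squeeze_cvgr _ _ _ _ (cst 0) (fun n => expR (- (n%:R * r)))).
  - apply: nearW => n; rewrite expR_ge0/= ler_expR lerN2.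
    by apply: le_trans (expR_ge1Dx _); rewrite lerDr.
  - exact: cvg_cst.
  - exact: expR_decay.
have FE n s : F n s = (expR (- expR (n%:R * (s0 - s))) - 1) * f s.
  by rewrite /F /h /a mulNr -expRD; congr ((expR (- expR _) - 1) * _); ring.
have sub_lo : `[0, s0[ `<=` `[0, t]%classic.
  by apply: subset_itvl; rewrite bnd_simp ltW.
have sub_hi : `]s0, t] `<=` `[0, t]%classic.
  by apply: subset_itvr; rewrite bnd_simp ltW.
have fin_sub (A : set R) : measurable A -> A `<=` `[0, t]%classic -> (mu A < +oo)%E.
  move=> mA At; apply: le_lt_trans (lebesgue_itv_lty 0 t).
  by apply: le_measure; rewrite ?inE//; exact: measurable_itv.
have lo : (fun n => \int[mu]_(s in `[0, s0[) F n s) @ \oo --> \int[mu]_(s in `[0, s0[) (- f s).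
  apply: (@bounded_convergence _ _ _ mu `[0, s0[ _ (fun s => - f s) M _ _ _ _ _).2 => //.
  - exact: fin_sub.
  - by move=> n; apply: measurable_funS (mF n).
  - by move=> n s s0t'; apply: FM; exact: sub_lo.
  - move=> s; rewrite /= in_itv/= => /andP[_ ss0].
    rewrite (_ : F ^~ s = fun n => (expR (- expR (n%:R * (s0 - s))) - 1) * f s);
      last by apply/funext => n; rewrite FE.
    rewrite -[X in _ --> X]mulN1r; apply: cvgMr_tmp; rewrite -[X in _ --> X]sub0r.
    by apply: cvgB; [apply: expR_dec_exp; rewrite subr_gt0|exact: cvg_cst].
have hi : (fun n => \int[mu]_(s in `]s0, t]) F n s) @ \oo --> \int[mu]_(s in `]s0, t]) (0 : R).
  apply: (@bounded_convergence _ _ _ mu `]s0, t] _ (fun s => 0) M _ _ _ _ _).2 => //.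
  - exact: fin_sub.
  - by move=> n; apply: measurable_funS (mF n).
  - by move=> n s s0t'; apply: FM; exact: sub_hi.
  - move=> s; rewrite /= in_itv/= => /andP[ss0 _].
    rewrite (_ : F ^~ s = fun n => (expR (- expR (n%:R * (s0 - s))) - 1) * f s);
      last by apply/funext => n; rewrite FE.
    rewrite -[X in _ --> X](mul0r (f s)); apply: cvgMr_tmp.
    rewrite -[X in _ --> X](subrr 1) -[X in _ --> X - _]expR0 -[X in expR X]oppr0.
    apply: cvgB; last exact: cvg_cst.
    apply: continuous_cvg; first exact: continuous_expR.
    apply: cvgN; rewrite (_ : (fun n : nat => _) = fun n : nat => expR (- (n%:R * (s - s0)))).
      by apply: expR_decay; rewrite subr_gt0.
    by apply/funext => n; rewrite -mulrN opprB.
have tot n : \int[mu]_(s in `[0, t]) F n s =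
    \int[mu]_(s in `[0, s0[) F n s + \int[mu]_(s in `]s0, t]) F n s.
  rewrite -(@Rintegral_itvB _ _ (BLeft 0) (BRight t) s0)//; last 2 first.
  - by rewrite bnd_simp ltW.
  - by rewrite bnd_simp ltW.
  rewrite Rintegral_itv_bndo_bndc; first by rewrite addrC subrK.
  by apply: integrableS (Fint n).
(* As [s0 < t], [b n] tends to 0, and so does the bound [C * (expR (b n) - 1)]. *)
have c0 : (fun n => \int[mu]_(s in `[0, t]) F n s) @ \oo --> (0 : R).
  apply/norm_cvg0P.
  apply: (@squeeze_cvgr _ _ _ _ (cst 0) (fun n => C * (expR (b n) - 1))).
  - by near=> n; rewrite normr_ge0/=; apply: IF; near: n; exact: nbhs_infty_gt.
  - exact: cvg_cst.
  - rewrite -[X in _ --> X](mulr0 C); apply: cvgMl_tmp.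
    rewrite -[X in _ --> X](subrr 1) -[X in _ --> X - _]expR0.
    apply: cvgB; last exact: cvg_cst.
    apply: continuous_cvg; first exact: continuous_expR.
    by apply: expR_decay; rewrite subr_gt0.
have : (fun n => \int[mu]_(s in `[0, t]) F n s) @ \oo -->
    \int[mu]_(s in `[0, s0[) (- f s) + \int[mu]_(s in `]s0, t]) 0.
  rewrite (_ : (fun n : nat => _) = (fun n => \int[mu]_(s in `[0, s0[) F n s) \+
    (fun n => \int[mu]_(s in `]s0, t]) F n s)); last by apply/funext => n; rewrite tot.
  exact: cvgD lo hi.
move=> /(cvg_unique (@Rhausdorff R) c0).
rewrite Rintegral_cst ?mul0r ?addr0//.
have fint : mu.-integrable `[0, s0[ (EFin \o f).
  apply: (@integrable_bounded _ _ _ _ _ _ M) => //; first exact: fin_sub.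
    exact: measurable_funS mf.
  by move=> s /sub_lo/fM.
under eq_Rintegral do rewrite -mulN1r.
rewrite RintegralZl// mulN1r => /esym/eqP; rewrite oppr_eq0 => /eqP.
by rewrite Rintegral_itv_bndo_bndc.
Unshelve. all: by end_near. Qed.

End mikusinski.

(** * Modified Bessel functions *)

(* [walks j n] counts the walks of [j] unit steps on Z from 0 that end at [n];
   then [I_n(x) = \sum_j walks j n (x / 2)^j / j!], which makes the differential
   recurrences of the Bessel functions immediate. *)
Fixpoint walks (j n : nat) : nat :=
  match j, n with
  | 0, _ => n == 0
  | j'.+1, 0 => 2 * walks j' 1
  | j'.+1, n'.+1 => walks j' n' + walks j' n'.+2
  end.

Lemma walks_le j n : (walks j n <= 2 ^ j)%N.
Proof.
elim: j n => [|j IHj] [|n] //=; rewrite expnS; first by rewrite leq_mul2l IHj.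
by rewrite mul2n -addnn leq_add.
Qed.

Lemma walks_lt j n : (j < n)%N -> walks j n = 0%N.
Proof.
elim: j n => [|j IHj] [|n] //=; rewrite ltnS => jn.
by rewrite !IHj//; exact: ltn_trans (ltnSn _) (ltnW _).
Qed.

Lemma walks_odd j n : odd (j + n) -> walks j n = 0%N.
Proof.
elim: j n => [|j IHj] [|n] //=; rewrite ?addn0.
- by move=> oj; rewrite IHj ?muln0// addn1.
- by rewrite addnS/= negbK => ojn; rewrite !IHj// !addnS/= negbK.
Qed.

(** A walk of 2k + n steps ending at [n] is the choice of its [k] downward steps, and the recurrence
    of [walks] becomes Pascal's rule. At the origin both neighbours contribute equally, and twice a
    central entry of an odd row is the middle entry of the next row. *)
Lemma walks_bin k n : walks (k.*2 + n) n = 'C(k.*2 + n, k).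
Proof.
(* Induction on the length of the walk, because the recurrence changes [k] and [n] together. *)
have [m] := ubnP (k.*2 + n); elim: m k n => // m IHm [|k] [|n].
- by [].
- rewrite add0n bin0 ltnS => nm; rewrite /= (IHm 0%N)// bin0.
  by rewrite walks_lt// addn0.
- rewrite addn0 doubleS => km; rewrite -[LHS]/(2 * walks k.*2.+1 1)%N.
  have := IHm k 1%N; rewrite addn1 => ->//.
  rewrite binS mul2n -addnn; congr addn; rewrite -[LHS]bin_sub; last by rewrite ltnW// ltnS -addnn leq_addr.
  by rewrite -addnn -addSn addnK.
- rewrite doubleS => km; rewrite addSn addnS -[LHS]/(walks (k.*2 + n).+2 n + walks (k.*2 + n).+2 n.+2)%N.
  have := IHm k.+1 n; rewrite doubleS !addSn => ->; last by move: km; rewrite !addSn addnS ltnS.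
  have := IHm k n.+2; rewrite !addnS => ->; last by move: km; rewrite !addSn addnS ltnS.
  by rewrite binS.
Qed.

(** * Bessel functions of integer order as power series *)

Section bessel.
Context {R : realType}.
Notation mu := (@lebesgue_measure R).

Definition bessel_coeff n j : R := (walks j n)%:R / (2 ^+ j * j`!%:R).

Definition bessel n (x : R) : R := limn (pseries (bessel_coeff n) x).

Lemma bessel_coeff_ge0 n j : 0 <= bessel_coeff n j.
Proof. by rewrite divr_ge0// mulr_ge0// exprn_ge0. Qed.

Lemma bessel_coeff_le n j : bessel_coeff n j <= (j`!%:R)^-1.
Proof.
rewrite /bessel_coeff ler_pdivrMr ?mulr_gt0 ?exprn_gt0 ?ltr0n ?fact_gt0//.
rewrite mulrCA mulVf ?pnatr_eq0 -?lt0n ?fact_gt0// mulr1.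
by rewrite -natrX ler_nat walks_le.
Qed.

Lemma bessel_term_le n j x : `|bessel_coeff n j * x ^+ j| <= exp_coeff `|x| j.
Proof.
rewrite normrM normrX ger0_norm ?bessel_coeff_ge0// /exp_coeff/= mulrC.
by rewrite ler_wpM2l ?exprn_ge0// bessel_coeff_le.
Qed.

Lemma is_cvg_pseries_bessel n x : cvgn (pseries (bessel_coeff n) x).
Proof.
apply: normed_cvg; apply: (@series_le_cvg _ _ (exp_coeff `|x|)); first by move=> j; exact: normr_ge0.
- by move=> j; rewrite exp_coeff_ge0 ?normr_ge0.
- by move=> j; exact: bessel_term_le.
- exact: is_cvg_series_exp_coeff.
Qed.

Lemma bessel_diffs0 : pseries_diffs (bessel_coeff 0) = bessel_coeff 1.
Proof.
apply/funext => j; rewrite /pseries_diffs /bessel_coeff [walks _.+1 _]/=.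
have f0 : j`!%:R != 0 :> R by rewrite pnatr_eq0 -lt0n fact_gt0.
have j0 : j%:R + 1 != 0 :> R by rewrite natr1 pnatr_eq0.
have e0 : 2 ^+ j != 0 :> R by rewrite expf_neq0.
by rewrite factS !natrM exprS -natr1; field; rewrite ?f0 ?e0 ?j0.
Qed.

Lemma bessel_diffsS n : pseries_diffs (bessel_coeff n.+1) =
  fun j => (bessel_coeff n j + bessel_coeff n.+2 j) / 2.
Proof.
apply/funext => j; rewrite /pseries_diffs /bessel_coeff [walks _.+1 _]/=.
have f0 : j`!%:R != 0 :> R by rewrite pnatr_eq0 -lt0n fact_gt0.
have j0 : j%:R + 1 != 0 :> R by rewrite natr1 pnatr_eq0.
have e0 : 2 ^+ j != 0 :> R by rewrite expf_neq0.
by rewrite factS !natrM natrD exprS -natr1; field; rewrite ?f0 ?e0 ?j0.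
Qed.

Lemma pseries_half_sum (f g : nat -> R) x :
  pseries (fun j => (f j + g j) / 2) x =
  fun n => 2^-1 * (pseries f x n + pseries g x n).
Proof.
apply/funext => n; rewrite /pseries /series/= -big_split/= mulr_sumr.
by apply: eq_bigr => i _; ring.
Qed.

Lemma cvg_half_sum n x : pseries (fun j => (bessel_coeff n j + bessel_coeff n.+2 j) / 2) x @ \oo -->
  (bessel n x + bessel n.+2 x) / 2.
Proof.
rewrite pseries_half_sum mulrC; apply: cvgMl_tmp.
by apply: cvgD; exact: is_cvg_pseries_bessel.
Qed.

Lemma is_cvg_pseries_diffs_bessel n x : cvgn (pseries (pseries_diffs (bessel_coeff n)) x).
Proof.
case: n => [|n]; first by rewrite bessel_diffs0; exact: is_cvg_pseries_bessel.
by rewrite bessel_diffsS; apply/cvg_ex; eexists; exact: cvg_half_sum.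
Qed.

(** Termwise differentiation requires the series differentiated once and twice to converge; by the
    recurrences of the coefficients both are combinations of Bessel series, which converge
    everywhere. *)
Lemma is_derive_bessel_pseries n (x : R) :
  is_derive x 1 (bessel n) (limn (pseries (pseries_diffs (bessel_coeff n)) x)).
Proof.
apply: (@pseries_snd_diffs _ _ (`|x| + 1)).
- exact: is_cvg_pseries_bessel.
- exact: is_cvg_pseries_diffs_bessel.
- case: n => [|n]; first by rewrite bessel_diffs0; exact: is_cvg_pseries_diffs_bessel.
  rewrite bessel_diffsS.
  have -> : pseries_diffs (fun j => (bessel_coeff n j + bessel_coeff n.+2 j) / 2) =
    fun j => (pseries_diffs (bessel_coeff n) j + pseries_diffs (bessel_coeff n.+2) j) / 2.
    by apply/funext => j; rewrite /pseries_diffs; ring.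
  rewrite pseries_half_sum; apply: is_cvgMl_tmp.
  by apply: is_cvgD; exact: is_cvg_pseries_diffs_bessel.
- by rewrite [ltRHS]ger0_norm ?addr_ge0// ltrDl.
Qed.

Lemma is_derive_bessel0 (x : R) : is_derive x 1 (bessel 0) (bessel 1 x).
Proof. by have := is_derive_bessel_pseries 0 x; rewrite bessel_diffs0. Qed.

Lemma is_derive_besselS n (x : R) :
  is_derive x 1 (bessel n.+1) ((bessel n x + bessel n.+2 x) / 2).
Proof.
have := is_derive_bessel_pseries n.+1 x; rewrite bessel_diffsS.
by rewrite (cvg_lim (@Rhausdorff R) (@cvg_half_sum n x)).
Qed.

Lemma continuous_bessel n : continuous (bessel n).
Proof.
exact: is_derive_continuous (@is_derive_bessel_pseries n).
Qed.

Lemma normr_bessel n x : `|bessel n x| <= expR `|x|.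
Proof.
have c1 : (fun m => `|pseries (bessel_coeff n) x m|) @ \oo --> `|bessel n x|.
  by apply: cvg_norm; exact: is_cvg_pseries_bessel.
have c2 : series (exp_coeff `|x|) @ \oo --> expR `|x| by exact: is_cvg_series_exp_coeff.
apply: ler_cvg_to c1 c2 _.
apply: nearW => m; rewrite /pseries /series/=; apply: le_trans (ler_norm_sum _ _ _) _.
by apply: ler_sum => k _; exact: bessel_term_le.
Qed.

Lemma bessel_ge0 n x : 0 <= x -> 0 <= bessel n x.
Proof.
move=> x0; apply: limr_ge; first exact: is_cvg_pseries_bessel.
by apply: nearW => m; apply: sumr_ge0 => k _; rewrite mulr_ge0 ?bessel_coeff_ge0 ?exprn_ge0.
Qed.

Lemma bessel_ge_coeff0 n x : 0 <= x -> bessel_coeff n 0 <= bessel n x.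
Proof.
move=> x0.
have -> : bessel_coeff n 0 = pseries (bessel_coeff n) x 1.
  by rewrite /pseries seriesEnat/= big_nat1 expr0 mulr1.
apply: nondecreasing_cvgn_le; last exact: is_cvg_pseries_bessel.
apply/nondecreasing_seqP => k; rewrite /pseries seriesSr lerDl.
by rewrite mulr_ge0 ?bessel_coeff_ge0 ?exprn_ge0.
Qed.

Lemma bessel0_gt0 x : 0 <= x -> 0 < bessel 0 x.
Proof.
move=> x0; apply: lt_le_trans (bessel_ge_coeff0 0 x0).
by rewrite /bessel_coeff/= expr0 fact0 mulr1 divr1.
Qed.

Lemma bessel_at0 n : bessel n 0 = (n == 0)%N%:R.
Proof.
apply/cvg_lim; first exact: Rhausdorff.
rewrite -cvg_shiftS (_ : (fun k => _) = cst (n == 0)%N%:R); first exact: cvg_cst.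
apply/funext => k; rewrite /pseries seriesEnat/= big_nat_recl//= expr0 mulr1.
rewrite /bessel_coeff/= expr0 fact0 mulr1 divr1 big1 ?addr0// => i _.
by rewrite expr0n/= mulr0.
Qed.

(** Coefficients vanish below [n] and where the parity differs from that of [n]; the remaining ones
    are binomials, so two terms of the walk series make one term of the classical series. *)
Lemma bessel_sub_series n x K :
  pseries (bessel_coeff n) x (K.*2 + n)%N =
  series (fun k => (x / 2) ^+ (k.*2 + n)%N / (k`!%:R * (k + n)%N`!%:R)) K.
Proof.
elim: K => [|K IHK].
  rewrite add0n /pseries seriesEnat/= [RHS]big_geq// big_nat big1// => j /andP[_ jn].
  by rewrite /bessel_coeff walks_lt// mul0r mul0r.
rewrite seriesSr -IHK doubleS !addSn /pseries !seriesSr -addrA; congr (_ + _).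
rewrite [X in _ + X](_ : _ = 0) ?addr0; last first.
  by rewrite /= /bessel_coeff walks_odd ?mul0r// addSn/= -addnA oddD odd_double addnn odd_double.
rewrite /= /bessel_coeff walks_bin expr_div_n.
have := @bin_fact (K.*2 + n)%N K; rewrite -addnn -addnA leq_addr addKn => /(_ isT) <-.
rewrite !natrM.
have f1 : K`!%:R != 0 :> R by rewrite pnatr_eq0 -lt0n fact_gt0.
have f2 : (K + n)%N`!%:R != 0 :> R by rewrite pnatr_eq0 -lt0n fact_gt0.
have f3 : 'C(K + (K + n), K)%N%:R != 0 :> R by rewrite pnatr_eq0 -lt0n bin_gt0 leq_addr.
have e0 : 2 ^+ (K + (K + n))%N != 0 :> R by rewrite expf_neq0.
by field; rewrite ?f1 ?f2 ?f3 ?e0.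
Qed.

(** The primitive [F] of x^n e^(-x) is explicit: the derivative of a partial sum of the exponential
    is the preceding partial sum, so in the derivative of [F] everything but the top term
    cancels. *)
Lemma Gamma_fact n : Gamma n.+1%:R = n`!%:R :> R.
Proof.
pose F (x : R) := - (expR (- x) * (n`!%:R * series (exp_coeff x) n.+1)).
have dS m (x : R) : is_derive x 1 (fun x : R => series (exp_coeff x) m.+1) (series (exp_coeff x) m).
  elim: m => [|m IHm].
    rewrite (_ : (fun x : R => _) = cst 1).
      by rewrite seriesEnat/= big_geq//; exact: is_derive_cst.
    by apply/funext => y; rewrite seriesEnat/= big_nat1 /exp_coeff/= expr0 fact0 divr1.
  rewrite (_ : (fun x : R => _) = (fun x => series (exp_coeff x) m.+1) +
      (fun x => x ^+ m.+1 * (m.+1`!%:R)^-1)); last first.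
    by apply/funext => y; rewrite seriesSr.
  rewrite seriesSr; apply: is_deriveD.
  rewrite (_ : (fun x : R => _) = (m.+1`!%:R)^-1 \*: (id ^+ m.+1)); last first.
    by apply/funext => y; rewrite !fctE mulrC.
  apply: is_derive_eq (is_deriveZ _ (is_deriveX m.+1 (is_derive_id x 1))) _.
  rewrite /exp_coeff/= factS natrM /GRing.scale/=.
  by rewrite mulr1 invfM mulrACA mulVf ?pnatr_eq0// mul1r mulrC.
have dF (x : R) : is_derive x 1 F (expR (- x) * x ^+ n).
  have -> : F = - ((expR \o -%R) * (n`!%:R \*: (fun x => series (exp_coeff x) n.+1))).
    by [].
  have dE : is_derive x 1 (expR \o -%R) (- expR (- x)).
    by apply: is_derive_eq; rewrite mulrN1.
  apply: is_derive_eq (is_deriveN (is_deriveM dE (is_deriveZ _ (dS n x)))) _.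
  rewrite /GRing.scale/= seriesSr /exp_coeff/= /GRing.scale/=.
  have f0 : n`!%:R != 0 :> R by rewrite pnatr_eq0 -lt0n fact_gt0.
  by field.
have Fy : F x @[x --> +oo] --> 0.
  apply/norm_cvg0P.
  have c0 : n`!%:R * 2 ^+ n * expR (- (x * 2^-1)) @[x --> +oo] --> (0 : R).
    rewrite -[X in _ --> X](mulr0 (n`!%:R * 2 ^+ n)); apply: cvgMl_tmp.
    apply: (@cvg_comp _ _ _ (fun x : R => x * 2^-1) (fun x => expR (- x)) _ +oo); last exact: cvgr_expR.
    by apply: gt0_cvgMly => //; exact: cvg_id.
  apply: squeeze_cvgr (cvg_cst 0) c0.
  near=> x; rewrite normr_ge0/= /F normrN normrM ger0_norm ?expR_ge0//.
  have x0 : 0 <= x by near: x; exact: nbhs_pinfty_ge.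
  rewrite normrM ger0_norm// mulrCA -mulrA ler_wpM2l//.
  (* From x^k = 2^k (x / 2)^k with k <= n; half of the exponential decay is kept. *)
  have : series (exp_coeff x) n.+1 <= 2 ^+ n * expR (x * 2^-1).
    apply: (@le_trans _ _ (2 ^+ n * series (exp_coeff (x * 2^-1)) n.+1)); last first.
      by rewrite ler_wpM2l ?exprn_ge0// series_exp_coeff_le// mulr_ge0.
    rewrite /series/= mulr_sumr; apply: ler_sum_nat => k /andP[_]; rewrite ltnS => kn.
    rewrite /exp_coeff/= mulrA ler_wpM2r ?invr_ge0// exprMn mulrCA ler_peMr ?exprn_ge0//.
    by rewrite -(subnK kn) exprD -mulrA -exprMn mulfV// expr1n mulr1 exprn_ege1// ler1n.
  move=> le_ser; rewrite [X in _ * X]ger0_norm; last first.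
    by apply: sumr_ge0 => k _; exact: exp_coeff_ge0.
  apply: le_trans (ler_wpM2l (expR_ge0 _) le_ser) _.
  rewrite mulrCA ler_wpM2l ?exprn_ge0// -expRD ler_expR le_eqVlt; apply/orP; left.
  by apply/eqP; field.
have F0 : F 0 = - n`!%:R.
  rewrite /F oppr0 expR0 mul1r seriesEnat/= big_nat_recl//= /exp_coeff/= expr0 fact0 divr1.
  by rewrite big1 ?addr0 ?mulr1// => i _; rewrite expr0n/= mul0r.
have n1 : n.+1%:R - 1 = n%:R :> R by rewrite -natr1 addrK.
have cf : continuous (fun x : R => expR (- x) * x ^+ n).
  have cE : continuous (fun x : R => expR (- x)) by by_derivative.
  by move=> x; apply: cvgM (cE x) _; exact: exprn_continuous.
rewrite /Gamma n1.
have -> : \int[mu]_(x in `]0, +oo[) (x `^ n%:R * expR (- x)) =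
    \int[mu]_(x in `[0, +oo[) (expR (- x) * x ^+ n).
  rewrite /Rintegral -integral_itv_obnd_cbnd.
    congr fine; apply: eq_integral => x; rewrite inE/= in_itv/= andbT => x0.
    by rewrite powR_mulrn 1?ltW// mulrC.
  apply: measurable_funTS; apply/measurable_EFinP; exact: continuous_measurable_fun.
rewrite (@Rintegral_ge0_continuous_FTC2y _ _ F _ 0)//.
- by rewrite F0 sub0r opprK.
- by move=> x x0; rewrite mulr_ge0 ?expR_ge0 ?exprn_ge0.
- exact: continuous_subspaceT.
- by apply: cvg_at_right_filter; exact: (is_derive_continuous dF).
- by move=> x _; rewrite derive1E (@derive_val _ _ _ _ _ _ _ (dF x)).
Unshelve. all: by end_near. Qed.

(** The partial sums of the classical series are the subsequence of lengths 2K + n of those of the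
    walk series, which converge. *)
Lemma besselIE n x : 0 <= x -> besselI n%:R x = bessel n x.
Proof.
move=> x0; rewrite /besselI.
have -> : (fun k => (x / 2) `^ (2 * k%:R + n%:R) / (k`!%:R * Gamma (n%:R + k%:R + 1))) =
    (fun k => (x / 2) ^+ (k.*2 + n)%N / (k`!%:R * (k + n)%N`!%:R)).
  apply/funext => k; rewrite -natrD natr1 Gamma_fact [(n + k)%N]addnC.
  by rewrite -natrM -natrD powR_mulrn ?divr_ge0// mul2n.
apply/cvg_lim; first exact: Rhausdorff.
have -> : series (fun k => (x / 2) ^+ (k.*2 + n)%N / (k`!%:R * (k + n)%N`!%:R)) =
   pseries (bessel_coeff n) x \o (fun K => K.*2 + n)%N.
  by apply/funext => K; rewrite /= bessel_sub_series.
apply: (@cvg_comp _ _ _ (fun K => K.*2 + n)%N (pseries (bessel_coeff n) x) \oo \oo);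
  last exact: is_cvg_pseries_bessel.
move=> A [m _ mA]; exists m => // K /= mK; apply: mA => /=.
by rewrite (leq_trans mK)// -addnn -addnA leq_addr.
Qed.

End bessel.

(** * Truncated Laplace transforms of the Bessel functions *)

Section bessel_laplace.
Context {R : realType}.
Notation mu := (@lebesgue_measure R).
Variables (lambda xi z T : R).
Hypotheses (lambda_gt0 : 0 < lambda) (xi01 : 0 < xi < 1) (z1 : 1 <= z).
Hypothesis xiE : lambda * (xi + xi^-1) / 2 = z + lambda.
Hypothesis T0 : 0 < T.
Let A n (s : R) := expR (- ((z + lambda) * s)) * bessel n (lambda * s).
Let a n := \int[mu]_(s in `[0, T]) A n s.
Let e := expR (- (z * T)).

(** Here [1 <= z] enters: 1 / xi = 2z / lambda + 2 - xi, and [xi < 1]. The inequality is what lets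
    the bound on [a n.+1 - xi * a n] reproduce itself. *)
Let xi_le : xi * (1 + 2 / lambda) <= 1.
Proof.
case/andP: xi01 => x0 x1.
have : (1 + 2 / lambda) <= xi^-1.
  have -> : xi^-1 = 2 / lambda * (z + lambda) - xi.
    by rewrite -xiE; field; rewrite ?gt_eqF.
  have -> : 2 / lambda * (z + lambda) - xi = 2 / lambda * z + 2 - xi.
    by field; rewrite ?gt_eqF.
  have : 2 / lambda <= 2 / lambda * z by rewrite ler_peMr// divr_ge0// ltW.
  lra.
by rewrite -(ler_pM2l x0) mulfV// gt_eqF.
Qed.

Let integrand_derive n (b : R -> R) (s : R) : (forall x : R, is_derive x 1 (bessel n) (b x)) ->
  is_derive s 1 (A n)
   (- (z + lambda) * A n s +
    lambda * (expR (- ((z + lambda) * s)) * b (lambda * s))).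
Proof.
move=> db.
have dE : is_derive s 1 (fun s => expR (- ((z + lambda) * s))) (- (z + lambda) * expR (- ((z + lambda) * s))).
  by apply: is_derive_eq; rewrite /GRing.scale/=; ring.
have dL : is_derive s 1 (fun s => lambda * s) lambda.
  by apply: is_derive_eq; rewrite /GRing.scale/=; ring.
apply: is_derive_eq (is_deriveM dE (is_derive1_comp (db _) dL)) _.
by rewrite /A /GRing.scale/=; ring.
Qed.

Let cont n : continuous (A n).
Proof. exact: is_derive_continuous (fun s => integrand_derive s (@is_derive_bessel_pseries _ n)). Qed.

Let int n : mu.-integrable `[0, T] (EFin \o A n).
Proof. exact: continuous_integrable. Qed.

(** Since I_n(x) <= e^x for x >= 0, the boundary terms at [T] are no larger than the error
    allowed. *)
Let ae n : A n T <= e /\ 0 <= A n T.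
Proof.
have l0 : 0 <= lambda * T by rewrite mulr_ge0 ?ltW.
split; last by rewrite mulr_ge0 ?expR_ge0 ?bessel_ge0.
apply: (@le_trans _ _ (expR (- ((z + lambda) * T)) * expR (lambda * T))).
  rewrite ler_wpM2l ?expR_ge0//; apply: le_trans (ler_norm _) _.
  by rewrite -[X in expR X](ger0_norm l0); exact: normr_bessel.
by rewrite -expRD ler_expR le_eqVlt; apply/orP; left; apply/eqP; ring.
Qed.

(** Integration of the derivative of [A 0]; the 1 is its value at time 0. For the higher orders the
    value at 0 vanishes, so their recurrence is homogeneous up to the boundary term at [T]. *)
Let a0 : A 0 T - 1 =
  - (z + lambda) * a 0 + lambda * a 1.
Proof.
rewrite /a -!RintegralZl// -RintegralD//; last 2 first.
- exact: (integrableZl _ _ (int 0)).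
- exact: (integrableZl _ _ (int 1)).
rewrite (FTC2 (ltW T0) (fun s => integrand_derive s is_derive_bessel0)).
  by rewrite /A !mulr0 oppr0 expR0 bessel_at0 mulr1.
by move=> s; apply: cvgD; apply: cvgMl_tmp; exact: cont.
Qed.

Let aS n : A n.+1 T = - (z + lambda) * a n.+1 + lambda / 2 * (a n + a n.+2).
Proof.
have c2 : continuous (fun s => A n s + A n.+2 s).
  by move=> s; apply: cvgD; exact: cont.
rewrite /a -RintegralD// -!RintegralZl//; last exact: continuous_integrable.
rewrite -RintegralD//; last 2 first.
- exact: (integrableZl _ _ (int n.+1)).
- exact: (integrableZl _ _ (continuous_integrable _ _ c2)).
have dA (s : R) : is_derive s 1 (A n.+1) (- (z + lambda) * A n.+1 s + lambda / 2 * (A n s + A n.+2 s)).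
  by apply: is_derive_eq (integrand_derive s (@is_derive_besselS _ n)) _; rewrite /A; ring.
rewrite (FTC2 (ltW T0) dA); first by rewrite /A !mulr0 oppr0 expR0 bessel_at0 mulr0 subr0.
by move=> s; apply: cvgD; apply: cvgMl_tmp; [exact: cont|exact: c2].
Qed.

Let a_le n : `|a n| <= T * expR (lambda * T).
Proof.
rewrite mulrC -[X in _ * X]subr0 -(fine_lebesgue_itv (ltW T0)).
apply: normr_Rintegral_le => //; first exact: lebesgue_itv_lty.
  by apply: measurable_funTS; exact: continuous_measurable_fun.
move=> s; rewrite /= in_itv/= => /andP[s0 sT].
rewrite /A normrM ger0_norm ?expR_ge0// -[leRHS]mul1r ler_pM ?expR_ge0//.
  rewrite -expR0 ler_expR oppr_le0 mulr_ge0// addr_ge0 ?(ltW lambda_gt0)//.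
  exact: le_trans z1.
apply: le_trans (normr_bessel _ _) _.
by rewrite ler_expR ger0_norm ?mulr_ge0 ?ler_wpM2l// ltW.
Qed.

(* The characteristic roots of the recurrence [aS] are [xi] and [1 / xi];
   boundedness of [a] rules out the second one. *)
Let d_le n : `|a n.+1 - xi * a n| <= e.
Proof.
case/andP: (xi01) => x0 x1.
pose B := 2 * (T * expR (lambda * T)).
(* Each use of the recurrence passes from an index to the next one and gains a factor [xi] on the
   crude bound [B]; [M] counts the uses. The boundary terms accumulated stay below [e] by
   [xi_le]. *)
suff dB M : forall n, `|a n.+1 - xi * a n| <= e + xi ^+ M * B.
  have c : (fun M => e + xi ^+ M * B) @ \oo --> e.
    rewrite -[X in _ --> X]addr0 -[X in _ --> _ + X](mul0r B).
    apply: cvgD; first exact: cvg_cst.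
    by apply: cvgMr_tmp; apply: cvg_expr; rewrite ger0_norm// ltW.
  by apply: (ler_cvg_to (cvg_cst _) c); apply: nearW => M; exact: dB.
elim: M => [|M IHM] k.
  rewrite expr0 mul1r; apply: (@le_trans _ _ B); last by rewrite lerDr expR_ge0.
  apply: le_trans (ler_normB _ _) _; rewrite normrM (gtr0_norm x0) /B mulrDl mul1r lerD//.
  by rewrite -[leRHS]mul1r ler_pM// ltW.
have -> : a k.+1 - xi * a k = xi * (a k.+2 - xi * a k.+1) - xi * (2 / lambda * A k.+1 T).
  rewrite aS; have -> : z + lambda = lambda * (xi + xi^-1) / 2 by [].
  by field; rewrite ?gt_eqF.
apply: le_trans (ler_normB _ _) _; rewrite normrM (gtr0_norm x0).
have [Ae A0] := ae k.+1.
have l2 : 0 <= 2 / lambda by rewrite divr_ge0// ltW.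
rewrite [X in _ + X]ger0_norm; last by rewrite mulr_ge0 ?(ltW x0)// mulr_ge0.
have h1 : xi * `|a k.+2 - xi * a k.+1| <= xi * (e + xi ^+ M * B) by rewrite ler_pM2l.
have h2 : xi * (2 / lambda * A k.+1 T) <= xi * (2 / lambda * e).
  by rewrite ler_pM2l// ler_wpM2l// divr_ge0// ltW.
have h3 : xi * (1 + 2 / lambda) * e <= 1 * e by rewrite ler_wpM2r ?expR_ge0.
rewrite exprS; move: h1 h2 h3; rewrite !mulrDr !mulrDl !mulr1 !mul1r !mulrA; lra.
Qed.

(** With [a 1] within [e] of [xi * a 0], the equation [a0] gives [a 0] as 1 / q up to (1 + lambda)
    e, and (1 + xi) / q = (1 - xi) / z. As 1 + xi <= 2, the constant is 2 (1 + lambda) + 1. *)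
Lemma bessel_laplace :
  `|\int[mu]_(s in `[0, T]) (expR (- (z * s)) *
      (expR (- (lambda * s)) * (bessel 0 (lambda * s) + bessel 1 (lambda * s)))) -
    (1 - xi) / z| <= (3 + 2 * lambda) * expR (- (z * T)).
Proof.
case/andP: (xi01) => x0 x1.
have -> : \int[mu]_(s in `[0, T]) (expR (- (z * s)) *
      (expR (- (lambda * s)) * (bessel 0 (lambda * s) + bessel 1 (lambda * s)))) = a 0 + a 1.
  rewrite -RintegralD//; apply: eq_Rintegral => s _.
  by rewrite /A mulrA -expRD -mulrDr; congr (expR _ * _); ring.
have z0 : 0 < z by exact: lt_le_trans z1.
(* This is lambda (1 / xi - xi) / 2, which is at least 1 by [xi_le]. *)
pose q := z + lambda - lambda * xi.
have q1 : 1 <= q.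
  rewrite /q -xiE; have -> : lambda * (xi + xi^-1) / 2 - lambda * xi = lambda * (xi^-1 - xi) / 2.
    by field; rewrite gt_eqF.
  have : 1 + 2 / lambda <= xi^-1 by rewrite -(ler_pM2l x0) mulfV// gt_eqF.
  move=> h; have : 2 / lambda <= xi^-1 - xi by lra.
  by rewrite ler_pdivrMr// => h2; rewrite ler_pdivlMr// mul1r mulrC.
have q0 : 0 < q by exact: lt_le_trans q1.
have E : a 0 + a 1 - (1 - xi) / z =
   (1 + xi) * ((1 - A 0 T + lambda * (a 1 - xi * a 0)) / q - q^-1) + (a 1 - xi * a 0).
  have -> : (1 - A 0 T + lambda * (a 1 - xi * a 0)) / q = a 0.
    have := a0; rewrite /q => /eqP; rewrite subr_eq => /eqP ->.
    by field; rewrite -/q gt_eqF.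
  have -> : (1 - xi) / z = (1 + xi) / q.
    apply/eqP; rewrite eqr_div ?(gt_eqF z0) ?(gt_eqF q0)// /q.
    have h : lambda * (xi ^+ 2 + 1) / 2 = (z + lambda) * xi.
      by rewrite -xiE; field; rewrite gt_eqF.
    rewrite -subr_eq0; apply/eqP.
    transitivity (2 * (lambda * (xi ^+ 2 + 1) / 2 - (z + lambda) * xi)); first by field.
    by rewrite h subrr mulr0.
  by ring.
rewrite E; apply: le_trans (ler_normD _ _) _.
have [Ae A0] := ae 0.
have dle := d_le 0.
have q_le1 : q^-1 <= 1 by rewrite invf_le1.
have H : `|(1 - A 0 T + lambda * (a 1 - xi * a 0)) / q - q^-1| <= (1 + lambda) * e.
  have -> : (1 - A 0 T + lambda * (a 1 - xi * a 0)) / q - q^-1 =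
     (lambda * (a 1 - xi * a 0) - A 0 T) / q by ring.
  rewrite normrM (ger0_norm (_ : 0 <= q^-1)) ?invr_ge0 ?(ltW q0)//.
  rewrite -[leRHS]mulr1 ler_pM// ?invr_ge0 ?(ltW q0)//.
  apply: le_trans (ler_normB _ _) _; rewrite normrM (gtr0_norm lambda_gt0) (ger0_norm A0).
  by rewrite mulrDl mul1r addrC lerD// ler_pM2l.
have e0 : 0 <= e by exact: expR_ge0.
rewrite normrM (ger0_norm (_ : 0 <= 1 + xi)) ?addr_ge0 ?(ltW x0)//.
have : (1 + xi) * `|(1 - A 0 T + lambda * (a 1 - xi * a 0)) / q - q^-1| <= 2 * ((1 + lambda) * e).
  by rewrite ler_pM// ?addr_ge0 ?(ltW x0)// -[2]/(1 + 1) lerD2l ltW.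
rewrite -/e; move: dle; lra.
Qed.

End bessel_laplace.

(** * Paths and their discretisation *)

Section path.
Context {R : realType}.
Notation mu := (@lebesgue_measure R).
Variable N : R -> nat.
Hypothesis N_mono : forall s u, 0 <= s -> s <= u -> (N s <= N u)%N.

Definition displacement (s : R) : R := \int[mu]_(u in `[0, s]) (-1) ^+ N u.
Local Notation Y := displacement.

Lemma measurable_parity (s : R) : measurable_fun `[0, s] (fun u => (-1) ^+ N u : R).
Proof.
pose f (k : nat) : R := (-1) ^+ k.
apply: (@measurable_comp _ _ _ _ _ _ setT f) => //.
move=> mI B _.
(* The level sets of a monotone function are intervals, and there are countably many of them. *)
rewrite (_ : _ `&` _ = \bigcup_(k in B) (`[0, s] `&` N @^-1` [set k])); last first.
  apply/seteqP; split => [u [us Bu]|u [k Bk [us /= Nuk]]]; first by exists (N u).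
  by split => //=; rewrite Nuk.
apply: bigcup_measurable => k _; apply: is_interval_measurable.
move=> x y [/= xs xk] [ys yk] u xuy; move: xs ys.
rewrite /= !in_itv/= => /andP[x0 xs] /andP[y0 ys]; case/andP: xuy => xu uy; split.
  by rewrite /= ?in_itv/= (le_trans x0 xu) (le_trans uy ys).
have u0 := le_trans x0 xu.
have := N_mono x0 xu; have := N_mono u0 uy; rewrite xk yk => h1 h2.
by apply/eqP; rewrite eqn_leq h1 h2.
Qed.

Lemma integrable_parity (s : R) : mu.-integrable `[0, s] (EFin \o (fun u => (-1) ^+ N u : R)).
Proof.
apply: (@integrable_bounded _ _ _ _ _ _ 1) => //; first exact: lebesgue_itv_lty.
  exact: measurable_parity.
by move=> u _; rewrite normrX normrN1 expr1n.
Qed.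

Lemma displacement0 : Y 0 = 0.
Proof. by rewrite /Y set_itv1 Rintegral_set1. Qed.

Lemma displacement_itv (s u : R) : 0 <= s -> s <= u ->
  Y u - Y s = \int[mu]_(v in `]s, u]) (-1) ^+ N v.
Proof.
move=> s0 su; apply: (@Rintegral_itvB _ _ (BLeft 0) (BRight u) s).
- exact: integrable_parity.
- by rewrite bnd_simp.
- by rewrite bnd_simp.
Qed.

Lemma itvoc_measure (s u : R) : s <= u -> (mu `]s, u]%classic < +oo)%E /\ fine (mu `]s, u]%classic) = u - s.
Proof.
move=> su; rewrite lebesgue_measure_itv/= lte_fin; case: (ltP s u) => us; split => //=; rewrite ?ltry//.
by have -> : s = u; [apply/le_anti; rewrite su us|rewrite subrr].
Qed.

Lemma subitv_parity (s u : R) : 0 <= s -> measurable_fun `]s, u] (fun v => (-1) ^+ N v : R).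
Proof.
move=> s0; apply: (@measurable_funS _ _ _ _ `[0, u]%classic) => //.
  by apply: subset_itvr; rewrite bnd_simp.
exact: measurable_parity.
Qed.

Lemma displacement_lip (s u : R) : 0 <= s -> s <= u -> `|Y u - Y s| <= u - s.
Proof.
move=> s0 su; rewrite displacement_itv//.
have [fin <-] := itvoc_measure su; rewrite -[leRHS]mul1r.
apply: normr_Rintegral_le => //; first exact: subitv_parity.
by move=> v _; rewrite normrX normrN1 expr1n.
Qed.

(** Where [N] keeps its value the integrand is exact; elsewhere it errs by at most 2, and then the
    increment of [N] is at least 1. *)
Lemma displacement_cst (s u : R) : 0 <= s -> s <= u ->
  `|Y u - Y s - (u - s) * (-1) ^+ N s| <= 2 * (u - s) * ((N u)%:R - (N s)%:R).
Proof.
move=> s0 su; rewrite displacement_itv//.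
have [fin E] := itvoc_measure su.
rewrite -{1}E mulrC -Rintegral_cst// -RintegralB//; last 2 first.
- apply: integrableS (integrable_parity u) => //.
  by apply: subset_itvr; rewrite bnd_simp.
- by apply: (@integrable_bounded _ _ _ _ _ _ 1) => // v _; rewrite normrX normrN1 expr1n.
rewrite -E [leRHS]mulrAC; apply: normr_Rintegral_le => //.
  by apply: measurable_funB => //; exact: subitv_parity.
move=> v; rewrite /= in_itv/= => /andP[/ltW sv vu].
have Nsv := N_mono s0 sv; have Nvu := N_mono (le_trans s0 sv) vu.
have [->|NE] := eqVneq (N v) (N s).
  by rewrite subrr normr0 mulr_ge0// subr_ge0 ler_nat; exact: leq_trans Nvu.
apply: (@le_trans _ _ 2).
  by rewrite (le_trans (ler_normB _ _))// !normrX normrN1 !expr1n.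
have : 1 <= (N u)%:R - (N s)%:R :> R.
  rewrite lerBrDr nat1r ler_nat; apply: leq_trans Nvu.
  by rewrite ltn_neqAle eq_sym NE.
lra.
Qed.

(** The errors of the cells are proportional to the increments of [N], whose sum telescopes: the
    error is of order [h] on every single path. *)
Lemma riemann_displacement (h : R) k : 0 <= h ->
  `|h * \sum_(j < k) (-1) ^+ N (j%:R * h) - Y (k%:R * h)| <= 2 * h * (N (k%:R * h))%:R.
Proof.
move=> h0; elim: k => [|k IHk].
  by rewrite big_ord0 mulr0 mul0r displacement0 subrr normr0 !mulr_ge0.
have k0 : 0 <= k%:R * h by rewrite mulr_ge0.
have kk : k%:R * h <= k.+1%:R * h by rewrite ler_wpM2r// ler_nat.
have := displacement_cst k0 kk.
have -> : k.+1%:R * h - k%:R * h = h by rewrite -natr1; ring.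
rewrite big_ord_recr/= [X in _ -> `|X - _| <= _]mulrDr; set a := h * (-1) ^+ _; move: IHk.
move: (h * bigop _ _ _) => S.
move: (Y (k%:R * h)) (Y (k.+1%:R * h)) (N (k%:R * h)) (N (k.+1%:R * h)) => y y' n n'.
move=> H1 H2; have -> : S + a - y' = (S - y) - (y' - y - a) by ring.
apply: le_trans (ler_normB _ _) _.
have -> : 2 * h * n'%:R = 2 * h * n%:R + 2 * h * (n'%:R - n%:R) by ring.
exact: lerD.
Qed.

Definition alive (s : R) : Prop := forall u, 0 <= u <= s -> 0 <= Y u.

Lemma alive0 : alive 0.
Proof. by move=> u u0; rewrite (_ : u = 0) ?displacement0//; lra. Qed.

Lemma alive_le (s u : R) : s <= u -> alive u -> alive s.
Proof. by move=> su au v /andP[v0 vs]; apply: au; rewrite v0 (le_trans vs). Qed.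

Definition death_time (t : R) : R := sup [set s | 0 <= s <= t /\ alive s].

Section death.
Variable t : R.
Hypothesis t0 : 0 <= t.
Local Notation D := (death_time t).

Let hs : has_sup [set s | 0 <= s <= t /\ alive s].
Proof.
split; first by exists 0; split; [rewrite lexx|exact: alive0].
by exists t => s [/andP[]].
Qed.

Lemma death_time_itv : 0 <= D <= t.
Proof.
apply/andP; split.
  by apply: sup_upper_bound hs _ _; split; [rewrite lexx|exact: alive0].
by apply: ge_sup; [case: hs|move=> s [/andP[]]].
Qed.

(** The supremum is attained because the displacement is continuous. *)
Lemma alive_death_time : alive D.
Proof.
have /andP[D0 Dt] := death_time_itv.
move=> u /andP[u0 uD]; have [uE|uD'] := leP D u; last first.
  have Du : 0 < D - u by rewrite subr_gt0.
  have [s [_ as_]] := sup_adherent Du hs; rewrite subKr => /ltW us.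
  by apply: as_; rewrite u0.
have -> : u = D by apply/le_anti; rewrite uD uE.
apply/ler_addgt0Pr => e e0.
have [s [/andP[s0 st] as_] /ltW Ds] := sup_adherent e0 hs.
have sD : s <= D by apply: (sup_upper_bound hs); split; rewrite ?s0.
have := displacement_lip s0 sD; rewrite ler_norml => /andP[h _].
have : 0 <= Y s by apply: as_; rewrite s0 lexx.
move: Ds; rewrite -/D; lra.
Qed.

(** Turns the tail of the death time into a survival event; its measurability and its law both rest
    on this. *)
Lemma le_death_time s : 0 <= s <= t -> (s <= D) <-> alive s.
Proof.
move=> st; split; first by move=> sD; exact: alive_le sD alive_death_time.
by move=> as_; apply: (sup_upper_bound hs).
Qed.

Lemma death_time_alive : alive t -> D = t.
Proof.
move=> at_; apply/le_anti; have /andP[_ ->] := death_time_itv.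
by apply/le_death_time; rewrite ?t0 ?lexx.
Qed.

Lemma death_time_lt : ~ alive t -> D < t.
Proof.
move=> nat_; have /andP[D0] := death_time_itv; rewrite le_eqVlt => /predU1P[Dt|//].
by exfalso; apply: nat_; rewrite -Dt; exact: alive_death_time.
Qed.

Lemma exists_negative_after s : D < s <= t -> exists2 u, D < u <= s & Y u < 0.
Proof.
have /andP[D0 _] := death_time_itv.
move=> /andP[Ds st]; apply: contrapT => H.
have : alive s.
  move=> u /andP[u0 us]; rewrite leNgt; apply/negP => Yu; apply: H; exists u => //.
  rewrite us andbT ltNge; apply/negP => uD.
  by have := alive_death_time; move=> /(_ u); rewrite u0 uD leNgt Yu => /(_ isT).
by move/le_death_time; rewrite st (le_trans D0 (ltW Ds)) leNgt Ds => /(_ isT).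
Qed.

End death.

End path.

(** * The killed discretised path *)

Section reward.
Context {R : realType}.
Variables (h delta : R) (phi : bool -> R -> R -> R).
Implicit Types (sigma : nat -> bool).

Definition position sigma k : R := delta + h * \sum_(j < k) (-1) ^+ sigma j.

(* The discretised path is stopped when its position gets negative; [true]
   stands for the negative velocity. *)
Fixpoint reward sigma m k : R :=
  if m is m'.+1 then
    if 0 <= position sigma k.+1 then reward sigma m' k.+1 else phi true (k%:R * h) 0
  else phi (sigma k) (k%:R * h) (position sigma k).

Lemma reward_alive sigma m k :
  (forall j, (k < j <= k + m)%N -> 0 <= position sigma j) ->
  reward sigma m k = phi (sigma (k + m)%N) ((k + m)%:R * h) (position sigma (k + m)).
Proof.
elim: m k => [|m IHm] k H /=; first by rewrite addn0.
rewrite H ?addnS ?ltnS ?leqnn ?leq_addr//.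
rewrite IHm ?addSn// => j /andP[kj jm]; apply: H.
by rewrite (ltn_trans (ltnSn k) kj)/= addnS -addSn.
Qed.

Lemma reward_dead sigma m k :
  (exists2 j, (k < j <= k + m)%N & position sigma j < 0) ->
  exists i, [/\ (k <= i < k + m)%N, position sigma i.+1 < 0,
    (forall j, (k < j <= i)%N -> 0 <= position sigma j) &
    reward sigma m k = phi true (i%:R * h) 0].
Proof.
elim: m k => [|m IHm] k /=.
  by move=> [j]; rewrite addn0 => /andP[kj jk]; have := leq_trans kj jk; rewrite ltnn.
move=> [j /andP[kj jm] pj]; case: ifPn => [p1|].
  have [|i [/andP[ki im] pi Hi ->]] := IHm k.+1.
    exists j => //; rewrite addSn -addnS jm andbT ltn_neqAle kj andbT.
    by apply/eqP => kE; move: p1; rewrite kE leNgt pj.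
  exists i; split => //.
  - by rewrite (ltnW ki)/= addnS -addSn.
  - move=> l /andP[kl li]; have [->//|lk] := eqVneq l k.+1.
    by apply: Hi; rewrite li andbT ltn_neqAle eq_sym lk.
rewrite -ltNge => p1; exists k; split => //.
- by rewrite leqnn/= addnS ltnS leq_addr.
- by move=> l /andP[kl lk]; have := leq_trans kl lk; rewrite ltnn.
Qed.

End reward.

(** * Pathwise convergence of the reward *)

Section reward_limit.
Context {R : realType}.
Variable N : R -> nat.
Hypothesis N_mono : forall s u, 0 <= s -> s <= u -> (N s <= N u)%N.
Variables (t L : R) (phi : bool -> R -> R -> R).
Hypotheses (t0 : 0 < t) (L0 : 0 <= L).
Hypothesis phi_lip_x : forall e s x y, 0 <= s <= t -> 0 <= x -> 0 <= y ->
  `|phi e s x - phi e s y| <= L * `|x - y|.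
Hypothesis phi_lip_s : forall e s u x, 0 <= s <= t -> 0 <= u <= t -> 0 <= x ->
  `|phi e s x - phi e u x| <= L * `|s - u|.
Local Notation Y := (displacement N).
Local Notation D := (death_time N t).

(* The barrier dominates the discretisation error, of order [mesh], and still
   tends to 0: survival of the discretised path thus converges on every path. *)
Definition mesh m : R := t / (m.+1 ^ 2)%:R.
Definition barrier m : R := t / m.+1%:R.
Definition parities (h : R) j := odd (N (j%:R * h)).
Local Notation h := mesh.
Local Notation delta := barrier.
Local Notation sigma m := (parities (h m)).
Local Notation pos m := (position (h m) (delta m) (sigma m)).

(** A path dies at level 0 while moving downwards, whence the state [true] and the position 0. *)
Definition limit_reward : R :=
  if `[< alive N t >] then phi (odd (N t)) t (Y t) else phi true D 0.

Lemma mesh_gt0 m : 0 < h m.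
Proof. by rewrite divr_gt0// ltr0n. Qed.

Lemma barrier_gt0 m : 0 < delta m.
Proof. by rewrite divr_gt0// ltr0n. Qed.

Lemma mesh_total m : (m.+1 ^ 2)%:R * h m = t.
Proof. by rewrite /mesh mulrC divfK// pnatr_eq0. Qed.

Lemma barrierE m : delta m = m.+1%:R * h m.
Proof. by rewrite /mesh /barrier natrX; field; rewrite addrC natr1 pnatr_eq0. Qed.

Lemma mesh_le_barrier m : h m <= delta m.
Proof. by rewrite barrierE ler_peMl ?ler1n// ltW// mesh_gt0. Qed.

Lemma barrier_cvg0 : delta @ \oo --> (0 : R).
Proof.
rewrite /barrier -[X in _ --> X](mulr0 t); apply: cvgMl_tmp; exact: cvg_harmonic.
Qed.

Lemma grid_itv m k : (k <= m.+1 ^ 2)%N -> 0 <= k%:R * h m <= t.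
Proof.
move=> kn; have h0 := ltW (mesh_gt0 m); rewrite mulr_ge0//=.
by rewrite -[leRHS](mesh_total m) ler_wpM2r// ler_nat.
Qed.

Lemma position_close m k : (k <= m.+1 ^ 2)%N ->
  `|pos m k - delta m - Y (k%:R * h m)| <= 2 * h m * (N t)%:R.
Proof.
move=> kn; have /andP[kh0 kht] := grid_itv kn; have h0 := ltW (mesh_gt0 m).
have := riemann_displacement N_mono k h0; rewrite /position /parities.
under [in X in _ -> X]eq_bigr do rewrite signr_odd.
rewrite [delta m + _]addrC addrK => /le_trans; apply.
by apply: ler_wpM2l; [exact: mulr_ge0|rewrite ler_nat N_mono].
Qed.

Lemma error_le_barrier : \forall m \near \oo, 2 * h m * (N t)%:R <= delta m.
Proof.
near=> m; rewrite barrierE mulrAC ler_wpM2r//; first by rewrite ltW// mesh_gt0.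
rewrite -natrM ler_nat; apply: leqW; near: m; exact: nbhs_infty_ge.
Unshelve. all: by end_near. Qed.

Lemma position_ge0 m k : 2 * h m * (N t)%:R <= delta m -> (k <= m.+1 ^ 2)%N ->
  0 <= Y (k%:R * h m) -> 0 <= pos m k.
Proof. by move=> hm /position_close; rewrite ler_norml => /andP[H _] HY; lra. Qed.

(** For a surviving path the barrier covers the discretisation error, so the discretised path
    survives too. A dying path takes a strictly negative value right after [D], and a small enough
    barrier no longer hides it. *)
Lemma reward_cvg : (fun m => reward (h m) (delta m) phi (sigma m) (m.+1 ^ 2) 0) @ \oo -->
  limit_reward.
Proof.
have /andP[D0 Dt] := death_time_itv N (ltW t0).
apply/cvgrPdist_le => e e0; rewrite /limit_reward.
(* In either case the argument of [phi] is off by at most [2 * e'], and [2 * L * e' <= e] holds even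
   when [L = 0]. *)
pose e' := e / (2 * L + 1).
have L1 : 0 < 2 * L + 1 by rewrite ltr_wpDl ?mulr_ge0.
have e'0 : 0 < e' by rewrite divr_gt0.
have LE : 2 * L * e' <= e.
  have -> : 2 * L * e' = e - e' by rewrite /e'; field; rewrite gt_eqF.
  lra.
have delta_small : \forall m \near \oo, delta m <= e'.
  have /cvgrPdist_le/(_ _ e'0) := barrier_cvg0.
  apply: filterS => m; rewrite sub0r normrN ger0_norm// ltW// barrier_gt0//.
case: asboolP => [at_|nat_].
  near=> m.
  have em : 2 * h m * (N t)%:R <= delta m by near: m; exact: error_le_barrier.
  have dm : delta m <= e' by near: m.
  rewrite reward_alive; last first.
    move=> j /andP[_ jn]; apply: position_ge0 => //.
    by apply: at_; apply: grid_itv.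
  rewrite add0n mesh_total /parities mesh_total.
  have Yt0 : 0 <= Y t by apply: at_; rewrite ltW/=.
  apply: le_trans LE; apply: le_trans (phi_lip_x _ _ _ _) _ => //.
  - by rewrite ltW/=.
  - by apply: position_ge0 => //; rewrite mesh_total.
  rewrite [2 * L]mulrC -mulrA ler_wpM2l//.
  have := position_close (leqnn (m.+1 ^ 2)); rewrite mesh_total distrC !ler_norml.
  move=> /andP[H1 H2]; apply/andP; split; lra.
have Dlt := death_time_lt N_mono (ltW t0) nat_.
pose s := Num.min (D + e') t.
have [u /andP[Du us] Yu] : exists2 u, D < u <= s & Y u < 0.
  apply: (exists_negative_after N_mono (ltW t0)).
  by rewrite /s lt_min ltrDl e'0 Dlt/= ge_min lexx orbT.
have uDe : u <= D + e' by apply: le_trans us _; rewrite /s ge_min lexx.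
have ut : u <= t by apply: le_trans us _; rewrite /s ge_min lexx orbT.
have u0 : 0 <= u by apply: ltW; exact: le_lt_trans Du.
have Yu3 : 0 < - Y u / 3 by rewrite divr_gt0// oppr_gt0.
(* At the grid point just before [u] the discretised position exceeds [Y u] by at most the barrier,
   the discretisation error and the mesh; each of the three is at most [delta m]. *)
have delta_small2 : \forall m \near \oo, delta m < - Y u / 3.
  have /cvgrPdist_lt/(_ _ Yu3) := barrier_cvg0.
  apply: filterS => m; rewrite sub0r normrN ger0_norm// ltW// barrier_gt0//.
near=> m.
have em : 2 * h m * (N t)%:R <= delta m by near: m; exact: error_le_barrier.
have dm : delta m <= e' by near: m.
have dm2 : delta m < - Y u / 3 by near: m.
have h0 := mesh_gt0 m.
have hd := mesh_le_barrier m.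
pose j := Num.truncn (u / h m).
have uh0 : 0 <= u / h m by rewrite divr_ge0// ltW.
have /andP[ju uj] := truncn_itv uh0.
have ju' : j%:R * h m <= u by rewrite -ler_pdivlMr.
have uj' : u <= (j%:R + 1) * h m by rewrite natr1 -ler_pdivrMr// ltW.
have jn : (j <= m.+1 ^ 2)%N.
  by rewrite -(ler_nat R) -(ler_pM2r h0) mesh_total (le_trans ju').
have pj : pos m j < 0.
  have /andP[jh0 _] := grid_itv jn.
  have := displacement_lip N_mono jh0 ju'; rewrite ler_norml => /andP[H1 _].
  have := position_close jn; rewrite ler_norml => /andP[_ H2].
  lra.
have j0 : (0 < j)%N.
  rewrite lt0n; apply/eqP => jE; move: pj; rewrite jE /position big_ord0 mulr0 addr0.
  by rewrite ltNge ltW// barrier_gt0.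
have [|i [/andP[_ im] pi Hi ->]] := @reward_dead _ (h m) (delta m) phi (sigma m) (m.+1 ^ 2) 0.
  by exists j; rewrite // j0 add0n.
have ij : (i < j)%N.
  by rewrite ltnNge; apply/negP => ji; have := Hi j; rewrite j0 ji leNgt pj => /(_ isT).
have ih_le : i%:R * h m <= D + e'.
  apply: le_trans uDe; apply: le_trans ju'.
  by rewrite ler_wpM2r ?(ltW h0)// ler_nat ltnW.
(* Up to time [D] the path is nonnegative, and there the barrier keeps the discretised path
   nonnegative as well. *)
have ih_ge : D <= i.+1%:R * h m.
  rewrite leNgt; apply/negP => iD; move: pi; rewrite ltNge => /negP; apply.
  apply: position_ge0 => //; apply: (alive_death_time N_mono (ltW t0)).
  by apply/andP; split; [exact: mulr_ge0 (ler0n _ _) (ltW h0)|exact: ltW].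
apply: le_trans LE; apply: le_trans (phi_lip_s _ _ _ _) _ => //.
- by rewrite D0.
- by apply: grid_itv; exact: ltnW.
rewrite [2 * L]mulrC -mulrA ler_wpM2l// ler_norml.
move: ih_ge; rewrite -natr1 mulrDl mul1r => ih_ge.
apply/andP; split; lra.
Unshelve. all: by end_near. Qed.

End reward_limit.

(** * Dynkin's formula *)

Section path_measurability.
Context {R : realType} d (T : measurableType d).
Variable N : R -> T -> nat.
Hypothesis N_meas : forall s, 0 <= s -> measurable_fun setT (N s).
Hypothesis N_mono : forall w s u, 0 <= s -> s <= u -> (N s w <= N u w)%N.

Lemma measurable_displacement s : 0 <= s ->
  measurable_fun setT (fun w => displacement (N ^~ w) s).
Proof.
move=> s0.
pose Z n w := s / n.+1%:R * \sum_(j < n.+1) (-1) ^+ N (j%:R * (s / n.+1%:R)) w.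
apply: (@measurable_fun_cvg _ _ _ _ Z) => [n|w _].
  apply: measurable_funM => //; apply: measurable_sum => j.
  apply: (measurableT_comp (f := fun k : nat => (-1) ^+ k : R)) => //.
  by apply: N_meas; rewrite mulr_ge0// divr_ge0.
have sE n : n.+1%:R * (s / n.+1%:R) = s by rewrite mulrC divfK// pnatr_eq0.
apply/cvgrPdist_le => e e0.
have c0 : (fun n => 2 * (N s w)%:R * s * n.+1%:R^-1) @ \oo --> (0 : R).
  by rewrite -[X in _ --> X](mulr0 (2 * (N s w)%:R * s)); apply: cvgMl_tmp; exact: cvg_harmonic.
move/cvgrPdist_le : c0 => /(_ _ e0); apply: filterS => n.
rewrite sub0r normrN distrC => H; apply: le_trans (H).
have h0 : 0 <= s / n.+1%:R by rewrite divr_ge0.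
have := @riemann_displacement _ (N ^~ w) (N_mono w) (s / n.+1%:R) n.+1 h0.
rewrite sE => /le_trans; apply; apply: le_trans (ler_norm _).
by rewrite le_eqVlt; apply/orP; left; apply/eqP; ring.
Qed.

Lemma aliveP w s : 0 <= s -> alive (N ^~ w) s <->
  (\bigcap_(q : rat) [set w | 0 <= (ratr q : R) <= s -> 0 <= displacement (N ^~ w) (ratr q)]) w.
Proof.
move=> s0; split=> [aw q _ /= qs|H u us]; first exact: aw.
rewrite leNgt; apply/negP => Yu; case/andP: us => u0 us.
have u_gt0 : 0 < u.
  by rewrite lt_neqAle u0 andbT; apply/eqP => uE; move: Yu; rewrite -uE displacement0 ltxx.
(* A 1-Lipschitz path negative at [u] is still negative at any earlier time closer to [u] than the
   depth reached there; a rational time is chosen in that range. *)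
have mu : Num.max 0 (u + displacement (N ^~ w) u) < u.
  by rewrite gt_max u_gt0/= gtrDl.
have [q] := rat_in_itvoo mu.
rewrite in_itv/= gt_max => /andP[/andP[q0 qY] qu].
have := H q I; rewrite /= (ltW q0) (le_trans (ltW qu) us) => /(_ isT).
have := displacement_lip (N_mono w) (ltW q0) (ltW qu); rewrite ler_norml => /andP[h _].
lra.
Qed.

Lemma measurable_alive s : 0 <= s -> measurable [set w | alive (N ^~ w) s].
Proof.
move=> s0; rewrite (_ : [set w | _] = \bigcap_(q : rat) [set w | 0 <= (ratr q : R) <= s -> 0 <= displacement (N ^~ w) (ratr q)]).
  rewrite -[X in measurable X]setCK setC_bigcap; apply: measurableC.
  apply: bigcupT_measurable_rat => q; apply: measurableC.
  have [/andP[q0 qs]|nq] := boolP (0 <= (ratr q : R) <= s).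
    rewrite (_ : [set w | _] = setT `&` (fun w => displacement (N ^~ w) (ratr q)) @^-1` `[0, +oo[).
      exact: measurable_displacement.
    apply/seteqP; split => w /=; rewrite in_itv/= andbT; first by move/(_ isT).
    by move=> [].
  by rewrite (_ : [set w | _] = setT)//; apply/seteqP; split.
by apply/seteqP; split => w /(aliveP w s0).
Qed.

Lemma measurable_death_time t : 0 <= t ->
  measurable_fun setT (fun w => death_time (N ^~ w) t).
Proof.
move=> t0; apply: (measurability (@RGenCInfty.G R)); first exact: RGenCInfty.measurableE.
move=> _ [_ [s ->] <-]; rewrite setTI.
have [s0|s0] := ltP s 0.
  rewrite (_ : _ @^-1` _ = setT)//; apply/seteqP; split => // w _.
  have /andP[D0 _] := death_time_itv (N ^~ w) t0.
  by rewrite /= in_itv/= andbT (le_trans (ltW s0)).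
have [ts|st] := ltP t s.
  rewrite (_ : _ @^-1` _ = set0)//; apply/seteqP; split => // w.
  have /andP[_ Dt] := death_time_itv (N ^~ w) t0.
  by rewrite /= in_itv/= andbT leNgt (le_lt_trans Dt ts).
rewrite (_ : _ @^-1` _ = [set w | alive (N ^~ w) s]); first exact: measurable_alive.
have st' : 0 <= s <= t by rewrite s0.
apply/seteqP; split => w; rewrite /= in_itv/= andbT.
  by move/(le_death_time (N_mono w) t0 st').
by move/(le_death_time (N_mono w) t0 st').
Qed.

End path_measurability.

(* The backward Kolmogorov equations
   d/ds phi_e + (-1)^e d/dx phi_e = lambda (phi_e - phi_(~~ e)),
   along the characteristic lines; the velocity is [(-1) ^+ e]. *)
Record backward_solution {R : realType} (lambda t : R) (phi : bool -> R -> R -> R)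
    (L M : R) : Prop := BackwardSolution {
  bs_bounded : forall e s x, 0 <= s <= t -> 0 <= x -> `|phi e s x| <= M ;
  bs_lip_x : forall e s x y, 0 <= s <= t -> 0 <= x -> 0 <= y ->
    `|phi e s x - phi e s y| <= L * `|x - y| ;
  bs_lip_s : forall e s u x, 0 <= s <= t -> 0 <= u <= t -> 0 <= x ->
    `|phi e s x - phi e u x| <= L * `|s - u| ;
  bs_deriv : forall e s x (r : R),
    is_derive r 1 (fun r => phi e (s + r) (x + (-1) ^+ e * r))
      (lambda * (phi e (s + r) (x + (-1) ^+ e * r) -
                 phi (~~ e) (s + r) (x + (-1) ^+ e * r))) }.

(** * Local error of the discretised dynamics *)

Section one_step.
Context {R : realType}.
Variables (lambda t L M : R) (phi : bool -> R -> R -> R).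
Hypotheses (lambda0 : 0 <= lambda) (L0 : 0 <= L).
Hypothesis phiP : backward_solution lambda t phi L M.

(** The first term comes from the variation of the right-hand side of the equation over one step,
    the second from the gap between the flip probability and [lambda * h]. *)
Definition step_error := 4 * lambda * L + 2 * M * lambda ^+ 2.

(** The velocity changes at the end of the step only, so the step runs along a characteristic line.
    There the mean value theorem turns the increment of [phi] into [lambda * h * g z], which
    [p * g h] cancels to second order. *)
Lemma one_step (h p s x : R) (e : bool) : 0 <= h -> 0 <= s -> s + h <= t ->
  0 <= x -> 0 <= x + (-1) ^+ e * h -> `|p - lambda * h| <= (lambda * h) ^+ 2 ->
  `|(1 - p) * phi e (s + h) (x + (-1) ^+ e * h) +
    p * phi (~~ e) (s + h) (x + (-1) ^+ e * h) - phi e s x| <= step_error * h ^+ 2.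
Proof.
move=> h0 s0 sht x0 xh0 ph.
pose f r := phi e (s + r) (x + (-1) ^+ e * r).
pose g r := phi e (s + r) (x + (-1) ^+ e * r) - phi (~~ e) (s + r) (x + (-1) ^+ e * r).
have df (r : R) : is_derive r 1 f (lambda * g r) by exact: (bs_deriv phiP).
have [z zI fE] := @MVT_segment _ f (fun r => lambda * g r) 0 h h0 (fun x _ => df x)
  (continuous_subspaceT (is_derive_continuous df)).
move: zI; rewrite in_itv/= => /andP[z0 zh].
have -> : (1 - p) * phi e (s + h) (x + (-1) ^+ e * h) +
    p * phi (~~ e) (s + h) (x + (-1) ^+ e * h) - phi e s x =
    lambda * h * (g z - g h) - (p - lambda * h) * g h.
  have f0 : f 0 = phi e s x by rewrite /f addr0 mulr0 addr0.
  have fh : f h = phi e (s + h) (x + (-1) ^+ e * h) by [].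
  rewrite -f0 -fh; have -> : phi (~~ e) (s + h) (x + (-1) ^+ e * h) = f h - g h.
    by rewrite /g /f; ring.
  move: fE; rewrite subr0 => fE.
  have -> : f 0 = f h - lambda * g z * h by rewrite -fE; ring.
  by ring.
have xz0 : 0 <= x + (-1) ^+ e * z.
  by move: xh0; case: (e); rewrite ?expr0 ?expr1; lra.
have shI : 0 <= s + h <= t by rewrite sht addr_ge0.
have szI : 0 <= s + z <= t by rewrite addr_ge0//= (le_trans _ sht)// lerD2l.
have philip e' : `|phi e' (s + z) (x + (-1) ^+ e * z) - phi e' (s + h) (x + (-1) ^+ e * h)| <= 2 * L * h.
  have -> : phi e' (s + z) (x + (-1) ^+ e * z) - phi e' (s + h) (x + (-1) ^+ e * h) =
    (phi e' (s + z) (x + (-1) ^+ e * z) - phi e' (s + h) (x + (-1) ^+ e * z)) +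
    (phi e' (s + h) (x + (-1) ^+ e * z) - phi e' (s + h) (x + (-1) ^+ e * h)) by ring.
  apply: le_trans (ler_normD _ _) _.
  have hz : `|z - h| <= h by rewrite ler_norml; apply/andP; split; lra.
  have H1 := bs_lip_s phiP e' szI shI xz0.
  have H2 := bs_lip_x phiP e' shI xz0 xh0.
  have E1 : s + z - (s + h) = z - h by ring.
  have E2 : `|x + (-1) ^+ e * z - (x + (-1) ^+ e * h)| = `|z - h|.
    have -> : x + (-1) ^+ e * z - (x + (-1) ^+ e * h) = (-1) ^+ e * (z - h) by ring.
    by rewrite normrM normrX normrN1 expr1n mul1r.
  rewrite E1 in H1; rewrite E2 in H2.
  have : L * `|z - h| <= L * h by rewrite ler_wpM2l.
  lra.
have gz : `|g z - g h| <= 4 * L * h.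
  have -> : g z - g h = (phi e (s + z) (x + (-1) ^+ e * z) - phi e (s + h) (x + (-1) ^+ e * h)) -
    (phi (~~ e) (s + z) (x + (-1) ^+ e * z) - phi (~~ e) (s + h) (x + (-1) ^+ e * h)).
    by rewrite /g; ring.
  apply: le_trans (ler_normB _ _) _; have := philip e; have := philip (~~ e); lra.
have gh : `|g h| <= 2 * M.
  apply: le_trans (ler_normB _ _) _.
  have := bs_bounded phiP e shI xh0; have := bs_bounded phiP (~~ e) shI xh0; lra.
apply: le_trans (ler_normB _ _) _; rewrite normrM [X in _ + X]normrM.
have lh0 : 0 <= lambda * h by rewrite mulr_ge0.
rewrite (ger0_norm lh0).
have A1 : lambda * h * `|g z - g h| <= lambda * h * (4 * L * h) by rewrite ler_wpM2l.
have A2 : `|p - lambda * h| * `|g h| <= (lambda * h) ^+ 2 * (2 * M) by rewrite ler_pM.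
apply: le_trans (lerD A1 A2) _.
by rewrite le_eqVlt; apply/orP; left; apply/eqP; rewrite /step_error; ring.
Qed.

End one_step.

(** * The Markov chain of parities on a grid *)

Section chain.
Context {R : realType} d (T : measurableType d) (P : probability T R).
Variables (lambda : R) (N : R -> T -> nat).
Hypothesis lambda0 : 0 < lambda.
Hypothesis HN : poisson_process P lambda N.
Variable h : R.
Hypothesis h0 : 0 < h.

Let sigma w := parities (N ^~ w) h.
Let grid_ge0 k : 0 <= k%:R * h.
Proof. by rewrite mulr_ge0// ltW. Qed.

Definition parity_jump j e : set T :=
  [set w | odd (N (j.+1%:R * h) w - N (j%:R * h) w) = e].

(** Cylinders of the chain; integrals over them take the place of conditional expectations given the
    first steps. *)
Definition parity_prefix k (b : nat -> bool) : set T :=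
  [set w | forall j, (j <= k)%N -> sigma w j = b j].

Lemma measurable_increment j (U : set nat) :
  measurable [set w | U (N (j.+1%:R * h) w - N (j%:R * h) w)%N].
Proof.
have m1 := poisson_measurable HN (grid_ge0 j.+1).
have m2 := poisson_measurable HN (grid_ge0 j).
rewrite (_ : [set w | _] = \bigcup_k (\bigcup_l
   [set w | [/\ N (j.+1%:R * h) w = k, N (j%:R * h) w = l & U (k - l)%N]])); last first.
  apply/seteqP; split => [w Uw|w [k _ [l _ [<- <-]]]]; last by [].
  by exists (N (j.+1%:R * h) w) => //; exists (N (j%:R * h) w).
apply: bigcup_measurable => k _; apply: bigcup_measurable => l _.
have [Ukl|nU] := pselect (U (k - l)%N); last first.
  by rewrite (_ : [set w | _] = set0)//; apply/seteqP; split => w // [].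
rewrite (_ : [set w | _] = (setT `&` N (j.+1%:R * h) @^-1` [set k]) `&`
  (setT `&` N (j%:R * h) @^-1` [set l])).
  by apply: measurableI; [exact: m1|exact: m2].
by apply/seteqP; split => [w [/= -> -> _]|w [[_ /= ->] [_ /= ->]]].
Qed.

Lemma measurable_parity_jump j e : measurable (parity_jump j e).
Proof. exact: (measurable_increment j [set k | odd k = e]). Qed.

Lemma measurable_sigma j e : measurable [set w | sigma w j = e].
Proof.
have := poisson_measurable HN (grid_ge0 j) measurableT (_ : measurable [set k | odd k = e]).
by rewrite setTI; apply.
Qed.

Lemma measurable_parity_prefix k b : measurable (parity_prefix k b).
Proof.
rewrite (_ : parity_prefix k b = \bigcap_(j in [set j | (j <= k)%N]) [set w | sigma w j = b j])//.
by apply: bigcap_measurable => [|j _]; [exists 0%N|exact: measurable_sigma].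
Qed.

Lemma odd_increment j w :
  odd (N (j.+1%:R * h) w - N (j%:R * h) w) = sigma w j.+1 (+) sigma w j.
Proof.
rewrite oddB//; apply: (poisson_nondecreasing HN) => //.
by rewrite ler_wpM2r ?(ltW h0)// ler_nat.
Qed.

(** As [N] starts at 0, the parities on the grid and the parities of the increments determine each
    other; independence is only known for the latter. *)
Lemma parity_prefix_jumps k b : b 0%N = false -> parity_prefix k b =
  \bigcap_(j in [set j | (j < k)%N]) parity_jump j (b j.+1 (+) b j).
Proof.
move=> b0; apply/seteqP; split => w H.
  move=> j /= jk; rewrite /parity_jump/= odd_increment.
  by rewrite !H// ltnW.
elim=> [_|j IHj jk].
  by rewrite b0 /sigma/parities mul0r (poisson_start HN).
have := H j jk; rewrite /parity_jump/= odd_increment IHj; last exact: ltnW.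
by move/(congr1 (addb^~ (b j))); rewrite !addbK.
Qed.

Lemma P_parity_prefix k b : b 0%N = false -> P (parity_prefix k b) =
  (\prod_(j < k) P (parity_jump j (b j.+1 (+) b j)))%E.
Proof.
move=> b0; rewrite parity_prefix_jumps//.
have tau_mono : {homo (fun j : nat => j%:R * h) : i j / (i <= j)%N >-> i <= j}.
  by move=> i j ij; rewrite ler_wpM2r ?(ltW h0)// ler_nat.
have ind := @poisson_increments_independent _ _ _ _ _ _ HN k (fun j => j%:R * h) (grid_ge0 0) tau_mono.
have := ind (finset.setT) (fun i : 'I_k => [set l | odd l = b i.+1 (+) b i]) (fun _ => Logic.I).
rewrite (_ : \bigcap_(i in [set` finset.setT]) _ =
  \bigcap_(j in [set j | (j < k)%N]) parity_jump j (b j.+1 (+) b j)); last first.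
  apply/seteqP; split => w H j /=.
    by move=> jk; apply: (H (Ordinal jk)); rewrite /= inE.
  by move=> _; apply: (H j (ltn_ord j)).
move=> -> //; apply: eq_bigl => i; by rewrite inE.
Qed.

Let pr (A : set T) : R := fine (P A).

Let pr_ge0 A : 0 <= pr A. Proof. exact: fine_ge0. Qed.

Lemma prE A : measurable A -> P A = (pr A)%:E.
Proof. by move=> mA; rewrite /pr fineK// fin_num_measure. Qed.

Lemma pr_prefixS k b : b 0%N = false ->
  pr (parity_prefix k.+1 b) = pr (parity_prefix k b) * pr (parity_jump k (b k.+1 (+) b k)).
Proof.
move=> b0; rewrite /pr P_parity_prefix// big_ord_recr/= -P_parity_prefix//.
rewrite fineM// fin_num_measure//; first exact: measurable_parity_prefix.
exact: measurable_parity_jump.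
Qed.

Lemma pr_jump_sum k : pr (parity_jump k false) = 1 - pr (parity_jump k true).
Proof.
have mt := measurable_parity_jump k true.
rewrite (_ : parity_jump k false = ~` parity_jump k true).
  by rewrite /pr probability_setC// prE.
by apply/seteqP; split => w; rewrite /parity_jump/=; case: odd.
Qed.

(* The probability of exactly one jump bounds that of an odd increment from
   below, and the probability of no jump bounds that of an even one. *)
Lemma pr_jump k : `|pr (parity_jump k true) - lambda * h| <= (lambda * h) ^+ 2.
Proof.
have kk : k%:R * h < k.+1%:R * h by rewrite ltr_pM2r// ltr_nat.
have dk : k.+1%:R * h - k%:R * h = h by rewrite -natr1; ring.
have lh0 : 0 < lambda * h by rewrite mulr_gt0.
have law l := poisson_increments_law HN l (grid_ge0 k) kk; rewrite dk in law.
have mI (l : nat) := measurable_increment k [set l].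
have lo : lambda * h * expR (- (lambda * h)) <= pr (parity_jump k true).
  have -> : lambda * h * expR (- (lambda * h)) = pr [set w | (N (k.+1%:R * h) w - N (k%:R * h) w)%N = 1%N].
    by rewrite /pr law /= /poisson_pmf lh0 expr1 factS fact0 muln1 invr1 mulr1.
  rewrite /pr fine_le ?fin_num_measure//.
  - exact: (mI 1%N).
  - exact: measurable_parity_jump.
  - apply: le_measure; rewrite ?inE.
    + exact: (mI 1%N).
    + exact: measurable_parity_jump.
    + by move=> w /= H; rewrite /parity_jump/= H.
have hi : expR (- (lambda * h)) <= pr (parity_jump k false).
  have -> : expR (- (lambda * h)) = pr [set w | (N (k.+1%:R * h) w - N (k%:R * h) w)%N = 0%N].
    by rewrite /pr law /= /poisson_pmf lh0 expr0 fact0 invr1 mulr1 mul1r.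
  rewrite /pr fine_le ?fin_num_measure//.
  - exact: (mI 0%N).
  - exact: measurable_parity_jump.
  - apply: le_measure; rewrite ?inE.
    + exact: (mI 0%N).
    + exact: measurable_parity_jump.
    + by move=> w /= H; rewrite /parity_jump/= H.
rewrite pr_jump_sum in hi.
have e1 := expR_ge1Dx (- (lambda * h)).
have : lambda * h * (1 - lambda * h) <= lambda * h * expR (- (lambda * h)).
  by rewrite ler_pM2l.
have := sqr_ge0 (lambda * h).
rewrite mulrBr mulr1 -expr2 ler_norml => s2 H; apply/andP; split; lra.
Qed.

Variables (t L M delta : R) (n : nat) (phi : bool -> R -> R -> R).
Hypotheses (L0 : 0 <= L) (delta0 : 0 <= delta) (nht : n%:R * h <= t).
Hypothesis phiP : backward_solution lambda t phi L M.
Let K := step_error lambda L M.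
Local Notation pos := (position h delta).

Let grid_itv' k : (k <= n)%N -> 0 <= k%:R * h <= t.
Proof. by move=> kn; rewrite grid_ge0 (le_trans _ nht)// ler_wpM2r ?(ltW h0)// ler_nat. Qed.

Lemma reward_bounded sg m k : (k + m <= n)%N -> 0 <= pos sg k ->
  `|reward h delta phi sg m k| <= M.
Proof.
elim: m k => [|m IHm] k kn pk /=.
  by apply: (bs_bounded phiP) => //; apply: grid_itv'; rewrite addn0 in kn.
case: ifPn => pk1; first by apply: IHm => //; rewrite addSn -addnS.
apply: (bs_bounded phiP) => //; apply: grid_itv'.
by apply: leq_trans kn; rewrite leq_addr.
Qed.

Lemma eq_position sg b k : (forall j, (j < k)%N -> sg j = b j) -> pos sg k = pos b k.
Proof.
move=> H; rewrite /position; congr (_ + h * _).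
by apply: eq_bigr => i _; rewrite H.
Qed.

Lemma positionS sg k : pos sg k.+1 = pos sg k + (-1) ^+ sg k * h.
Proof. by rewrite /position big_ord_recr/= mulrDr addrA [h * (-1) ^+ _]mulrC. Qed.

(** Backward induction: the cylinder is split along the next parity and [one_step] costs
    [K * h ^+ 2]. Killing happens from a position below [h], while the reward is read at 0; this
    costs [L * h], and at most once, so the term carries no factor [m]. *)
Lemma reward_estimate m k b : b 0%N = false -> (k + m <= n)%N -> 0 <= pos b k ->
  measurable_fun (parity_prefix k b) (fun w => reward h delta phi (sigma w) m k) /\
  `|\int[P]_(w in parity_prefix k b) reward h delta phi (sigma w) m k -
    pr (parity_prefix k b) * phi (b k) (k%:R * h) (pos b k)| <=
  pr (parity_prefix k b) * (m%:R * (K * h ^+ 2) + L * h).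
Proof.
have h_ge0 := ltW h0.
have K0 : 0 <= K * h ^+ 2.
  rewrite mulr_ge0 ?sqr_ge0// /K /step_error addr_ge0// ?mulr_ge0 ?(ltW lambda0)// ?sqr_ge0//.
  apply: le_trans (normr_ge0 _) (bs_bounded phiP false (s := 0) (x := 0) _ _) => //.
  by rewrite lexx (le_trans _ nht).
(* Serves the cylinders on which the reward is already determined: no step remains, or the next
   position is negative. *)
have cst_case (y : R) (f : T -> R) A r B : measurable A -> (forall w, A w -> f w = r) ->
    0 <= B -> `|r - y| <= B ->
    measurable_fun A f /\ `|\int[P]_(w in A) f w - pr A * y| <= pr A * B.
  move=> mA fr B0 H; split.
    apply: (eq_measurable_fun (cst r)); last exact: measurable_cst.
    by move=> w; rewrite inE => /fr.
  rewrite (@eq_Rintegral _ _ _ P A (cst r)); last by move=> w; rewrite inE => /fr.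
  rewrite Rintegral_cst// -/(pr A) [r * _]mulrC -mulrBr normrM ger0_norm//.
  by rewrite ler_wpM2l.
elim: m k b => [|m IHm] k b b0 kmn pk.
  rewrite mul0r add0r /=; apply: (cst_case _ _ _ (phi (b k) (k%:R * h) (pos b k))).
  - exact: measurable_parity_prefix.
  - by move=> w Cw; rewrite (Cw k (leqnn k)) (@eq_position _ b)// => j /ltnW/Cw.
  - by exact: mulr_ge0.
  - by rewrite subrr normr0; exact: mulr_ge0.
have posE w : parity_prefix k b w -> pos (sigma w) k.+1 = pos b k.+1.
  by move=> Cw; apply: eq_position => j; rewrite ltnS => /Cw.
have kn : (k < n)%N by apply: leq_trans kmn; rewrite addnS ltnS leq_addr.
have /andP[kh0 kht] := grid_itv' (ltnW kn).
have B0 : 0 <= m%:R * (K * h ^+ 2) + L * h by apply: addr_ge0; exact: mulr_ge0.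
have [pk1|pk1] := leP 0 (pos b k.+1); last first.
  apply: (cst_case _ _ _ (phi true (k%:R * h) 0)).
  - exact: measurable_parity_prefix.
  - by move=> w Cw /=; rewrite posE// leNgt pk1.
  - by apply: addr_ge0; exact: mulr_ge0.
  - have bk : b k = true.
      by move: pk1; rewrite positionS; case: (b k) => //; rewrite expr0; lra.
    move: pk1; rewrite positionS bk expr1 => pk1.
    apply: le_trans (bs_lip_x phiP true _ _ _) _ => //; first by rewrite kh0.
    apply: (@le_trans _ _ (L * h)); last by rewrite lerDr mulr_ge0.
    rewrite ler_wpM2l// sub0r normrN ger0_norm//; lra.
pose b_ e j := if j == k.+1 then e else b j.
have b_E e j : (j <= k)%N -> b_ e j = b j.
  by move=> jk; rewrite /b_ ltn_eqF.
have b_0 e : b_ e 0%N = false by rewrite b_E.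
have pos_ e : pos (b_ e) k.+1 = pos b k.+1.
  by apply: eq_position => j; rewrite ltnS => /b_E.
have mC e : measurable (parity_prefix k.+1 (b_ e)) by exact: measurable_parity_prefix.
have prefix_ e : parity_prefix k (b_ e) = parity_prefix k b.
  by apply/seteqP; split => w Cw j jk; rewrite Cw// b_E.
have CE : parity_prefix k b = parity_prefix k.+1 (b_ false) `|` parity_prefix k.+1 (b_ true).
  apply/seteqP; split => [w Cw|w [] Cw j jk]; last 2 first.
  - by rewrite Cw ?b_E// leqW.
  - by rewrite Cw ?b_E// leqW.
  have in_ e : sigma w k.+1 = e -> parity_prefix k.+1 (b_ e) w.
    move=> <- j; rewrite leq_eqVlt => /predU1P[->|]; first by rewrite /b_ eqxx.
    by rewrite ltnS => jk; rewrite b_E// Cw.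
  by case E : (sigma w k.+1); [right|left]; exact: in_.
have disj : [disjoint parity_prefix k.+1 (b_ false) & parity_prefix k.+1 (b_ true)].
  apply/disj_setPS => w [/(_ k.+1 (leqnn _)) + /(_ k.+1 (leqnn _))].
  by rewrite /b_ eqxx => ->.
have rewE w : parity_prefix k b w ->
    reward h delta phi (sigma w) m.+1 k = reward h delta phi (sigma w) m k.+1.
  by move=> Cw /=; rewrite posE// pk1.
have IHe e : measurable_fun (parity_prefix k.+1 (b_ e)) (fun w => reward h delta phi (sigma w) m k.+1) /\
  `|\int[P]_(w in parity_prefix k.+1 (b_ e)) reward h delta phi (sigma w) m k.+1 -
    pr (parity_prefix k.+1 (b_ e)) * phi e (k.+1%:R * h) (pos b k.+1)| <=
  pr (parity_prefix k.+1 (b_ e)) * (m%:R * (K * h ^+ 2) + L * h).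
  have := IHm k.+1 (b_ e) (b_0 e); rewrite addSn -addnS pos_ => /(_ kmn pk1).
  by rewrite (_ : b_ e k.+1 = e)// /b_ eqxx.
have mfC : measurable_fun (parity_prefix k b) (fun w => reward h delta phi (sigma w) m k.+1).
  by rewrite CE; apply/measurable_funU => //; split; [exact: (IHe false).1|exact: (IHe true).1].
split.
  by apply: eq_measurable_fun mfC => w; rewrite inE => /rewE ->.
rewrite (@eq_Rintegral _ _ _ P (parity_prefix k b) (fun w => reward h delta phi (sigma w) m k.+1)); last first.
  by move=> w; rewrite inE => /rewE.
have mCk := measurable_parity_prefix k b.
have intC : P.-integrable (parity_prefix k b) (EFin \o (fun w => reward h delta phi (sigma w) m k.+1)).
  apply: (@integrable_bounded _ _ _ _ _ _ M) => //.
    by rewrite ltey_eq fin_num_measure.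
  by move=> w Cw; apply: reward_bounded; rewrite ?posE// addSn -addnS.
rewrite {1}CE Rintegral_setU//; last by rewrite -CE.
have [_ If] := IHe false; have [_ It] := IHe true.
have prC e : pr (parity_prefix k.+1 (b_ e)) = pr (parity_prefix k b) * pr (parity_jump k (e (+) b k)).
  by rewrite pr_prefixS// prefix_ (b_E e k)// (_ : b_ e k.+1 = e)// /b_ eqxx.
rewrite !prC in If It.
set X := pr (parity_prefix k b) in If It *.
set q := pr (parity_jump k true).
have X0 : 0 <= X by exact: pr_ge0.
have q0 : 0 <= q by exact: pr_ge0.
have q1 : 0 <= 1 - q by rewrite -pr_jump_sum pr_ge0.
have := one_step (ltW lambda0) L0 phiP (ltW h0) kh0 _ pk (e := b k) (p := q) _ (pr_jump k).
rewrite -positionS => /(_ _ pk1).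
have -> : k%:R * h + h = k.+1%:R * h by rewrite -natr1; ring.
have /andP[_ kht1] := grid_itv' kn.
move=> /(_ kht1); rewrite -/K.
move: If It.
set If := \int[P]_(w in parity_prefix k.+1 (b_ false)) _.
set It := \int[P]_(w in parity_prefix k.+1 (b_ true)) _.
set B := m%:R * _ + _ in B0 *.
have -> : m.+1%:R * (K * h ^+ 2) + L * h = B + K * h ^+ 2 by rewrite /B -natr1; ring.
have combine (I J u v p0 : R) : `|I - X * (1 - q) * u| <= X * (1 - q) * B ->
  `|J - X * q * v| <= X * q * B -> `|(1 - q) * u + q * v - p0| <= K * h ^+ 2 ->
  `|I + J - X * p0| <= X * (B + K * h ^+ 2).
  move=> HI HJ Hs.
  have -> : I + J - X * p0 = (I - X * (1 - q) * u) + (J - X * q * v) + X * ((1 - q) * u + q * v - p0).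
    by ring.
  apply: le_trans (ler_normD _ _) _; rewrite normrM (ger0_norm X0).
  have H1 := le_trans (ler_normD _ _) (lerD HI HJ).
  have H2 : X * `|(1 - q) * u + q * v - p0| <= X * (K * h ^+ 2) by rewrite ler_wpM2l.
  apply: le_trans (lerD H1 H2) _.
  by rewrite le_eqVlt; apply/orP; left; apply/eqP; ring.
(* The sub-cylinder reached by a flip, of conditional weight [q], depends on the current parity. *)
case: (b k) => /=; rewrite -/q ?pr_jump_sum -/q => If' It' Hs.
  by rewrite [If + It]addrC; apply: combine It' If' Hs.
by apply: combine If' It' Hs.
Qed.

Lemma reward_expectation : n%:R * h = t ->
  measurable_fun setT (fun w => reward h delta phi (sigma w) n 0) /\
  `|\int[P]_w reward h delta phi (sigma w) n 0 - phi false 0 delta| <= (t * K + L) * h.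
Proof.
move=> nhE.
pose b (j : nat) := false.
have p0 : 0 <= pos b 0 by rewrite /position big_ord0 mulr0 addr0.
have [] := @reward_estimate n 0 b erefl (leqnn n) p0.
have -> : parity_prefix 0 b = setT.
  apply/seteqP; split => // w _ j; rewrite leqn0 => /eqP ->.
  by rewrite /sigma/parities mul0r (poisson_start HN).
rewrite {1}/pr probability_setT/= !mul1r /position big_ord0 mulr0 addr0 mul0r.
move=> mf H; split => //; apply: le_trans H _.
rewrite [pr _](_ : _ = 1) ?mul1r; last by rewrite /pr probability_setT.
by rewrite le_eqVlt; apply/orP; left; apply/eqP; rewrite -nhE; ring.
Qed.

End chain.

Section dynkin.
Context {R : realType} d (T : measurableType d) (P : probability T R).
Variables (lambda : R) (N : R -> T -> nat).
Hypothesis lambda0 : 0 < lambda.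
Hypothesis HN : poisson_process P lambda N.
Variables (t L M : R) (phi : bool -> R -> R -> R).
Hypotheses (t0 : 0 < t) (L0 : 0 <= L).
Hypothesis phiP : backward_solution lambda t phi L M.

Theorem dynkin :
  measurable_fun setT (fun w => limit_reward (N ^~ w) t phi) /\
  \int[P]_w limit_reward (N ^~ w) t phi = phi false 0 0.
Proof.
pose K := step_error lambda L M.
pose rew m w := reward (mesh t m) (barrier t m) phi (parities (N ^~ w) (mesh t m)) (m.+1 ^ 2) 0.
have Nmono := poisson_nondecreasing HN.
have est m := reward_expectation lambda0 HN (mesh_gt0 t0 m) L0 (ltW (barrier_gt0 t0 m)) _ phiP (mesh_total t m).
have bound m w : `|rew m w| <= M.
  apply: (reward_bounded (mesh_gt0 t0 m) (n := (m.+1 ^ 2)%N) _ phiP) => //.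
    by rewrite mesh_total.
  by rewrite /position big_ord0 mulr0 addr0 ltW// barrier_gt0.
have le_t m : (m.+1 ^ 2)%:R * mesh t m <= t by rewrite mesh_total.
have {}est := est le_t.
have [mf cvg1] := @bounded_convergence _ _ _ P setT rew
  (fun w => limit_reward (N ^~ w) t phi) M measurableT
  (eq_ind_r (fun x => x < +oo)%E (ltry 1) (probability_setT P))
  (fun m => (est m).1) (fun m w _ => bound m w)
  (fun w _ => reward_cvg (Nmono w) t0 L0 (bs_lip_x phiP) (bs_lip_s phiP)).
split => //.
have b0 : barrier t @ \oo --> (0 : R) by exact: barrier_cvg0.
(* The discretised path starts at the barrier, not at 0: this costs [L * barrier t m], and the mesh
   is at most the barrier, so one multiple of the barrier bounds everything. *)
have cvg2 : (fun m => \int[P]_w rew m w) @ \oo --> phi false 0 0.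
  have tK : 0 <= t * K + L.
    have M0 : 0 <= M.
      apply: le_trans (normr_ge0 _) (bs_bounded phiP false (s := 0) (x := 0) _ _) => //.
      by apply/andP; split; [exact: lexx|exact: ltW].
    have l0 := ltW lambda0.
    rewrite addr_ge0// mulr_ge0 ?(ltW t0)// /K /step_error addr_ge0// ?mulr_ge0// ?sqr_ge0//.
  apply/cvgrPdist_le => e e0.
  have c0 : (fun m => (t * K + 2 * L) * barrier t m) @ \oo --> (0 : R).
    by rewrite -[X in _ --> X](mulr0 (t * K + 2 * L)); apply: cvgMl_tmp.
  move/cvgrPdist_le : c0 => /(_ _ e0); apply: filterS => m; rewrite sub0r normrN => H.
  apply: le_trans H; apply: le_trans (ler_norm _).
  have [_] := est m; rewrite -/K -/(rew m) => H1.
  have bm := ltW (barrier_gt0 t0 m).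
  have t0' : 0 <= (0 : R) <= t by apply/andP; split; [exact: lexx|exact: ltW].
  have H2 := bs_lip_x phiP false t0' bm (lexx 0).
  rewrite subr0 (ger0_norm bm) in H2.
  have H3 : (t * K + L) * mesh t m <= (t * K + L) * barrier t m.
    by rewrite ler_wpM2l// mesh_le_barrier.
  rewrite distrC (_ : _ - _ = (\int[P]_w rew m w - phi false 0 (barrier t m)) +
    (phi false 0 (barrier t m) - phi false 0 0)); last by ring.
  apply: le_trans (ler_normD _ _) _; apply: le_trans (lerD (le_trans H1 H3) H2) _.
  by rewrite le_eqVlt; apply/orP; left; apply/eqP; ring.
have E := cvg_unique (@Rhausdorff R) cvg1 cvg2; exact: E.
Qed.

End dynkin.

(** * The law of the death time *)

Section death_law.
Context {R : realType} d (T : measurableType d) (P : probability T R).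
Notation mu := (@lebesgue_measure R).
Variable N : R -> T -> nat.
Hypothesis N_meas : forall s, 0 <= s -> measurable_fun setT (N s).
Hypothesis N_mono : forall w s u, 0 <= s -> s <= u -> (N s w <= N u w)%N.
Variable t : R.
Hypothesis t0 : 0 < t.

Definition survival s : R := fine (P [set w | alive (N ^~ w) s]).

Let D w := death_time (N ^~ w) t.

(** Write g(D) - g(0) as the integral of g'(s) over 0 <= s <= D and exchange the integrals; for
    fixed [s] the inner event is survival up to [s]. Measurability in [s] comes with Fubini's
    theorem. *)
Lemma expectation_death_time (g g' : R -> R) :
  (forall x : R, is_derive x 1 g (g' x)) -> continuous g' ->
  measurable_fun `[0, t] (fun s => g' s * survival s) /\
  \int[P]_w g (D w) = g 0 + \int[mu]_(s in `[0, t]) (g' s * survival s).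
Proof.
move=> dg cg'.
have D_meas : measurable_fun setT D by exact: measurable_death_time (ltW t0).
have D_itv w : 0 <= D w <= t by exact: death_time_itv (ltW t0).
pose A : set (T * R) := [set z | 0 <= z.2 <= D z.1].
have mA : measurable A.
  rewrite (_ : A = (setT `&` (fun z : T * R => z.2) @^-1` `[0, +oo[) `&`
    (setT `&` (fun z : T * R => D z.1 - z.2) @^-1` `[0, +oo[)).
    apply: measurableI; [exact: measurable_snd|].
    suff m : measurable_fun setT (fun z : T * R => D z.1 - z.2) by exact: m.
    apply: measurable_funB; last exact: measurable_snd.
    by apply: measurableT_comp => //; exact: measurable_fst.
  apply/seteqP; split => -[w s]; rewrite /A/= !in_itv/= !andbT subr_ge0.
    by move=> /andP[].
  by move=> [[_ s0] [_ sD]]; apply/andP.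
pose f z : R := g' z.2 * \1_A z.
have mf : measurable_fun setT f.
  apply: measurable_funM; last exact: measurable_indic.
  by apply: measurableT_comp; [exact: continuous_measurable_fun|exact: measurable_snd].
have mf' : measurable_fun setT (EFin \o f) by exact/measurable_EFinP.
have t0' := ltW t0.
have [M fM] : exists M, forall s, 0 <= s <= t -> `|g' s| <= M.
  have [c _ cmax] := EVT_max t0' (continuous_subspaceT (fun x => cvg_norm (cg' x))).
  by exists `|g' c| => s st; apply: cmax; rewrite in_itv.
have M0 : 0 <= M by apply: le_trans (normr_ge0 _) (fM 0 _); rewrite lexx.
have fE w s : f (w, s) = (g' \_ `[0, D w]) s.
  rewrite /f /restrict /patch/= indicE.
  have -> : ((w, s) \in A) = (s \in `[0, D w]%classic).
    by apply/idP/idP; rewrite !inE /A /= ?in_itv.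
  by case: ifP => _; rewrite ?mulr1 ?mulr0.
have inner_le w : (\int[mu]_s `|(f (w, s))%:E| <= (M * t)%:E)%E.
  have -> : ((M * t)%:E = \int[mu]_(s in `[0%R, t]) (cst M%:E) s)%E.
    rewrite integral_cst// [X in (_ = _ * X)%E]lebesgue_measure_itv/= lte_fin t0.
    by rewrite oppr0 addr0 EFinM.
  rewrite [leRHS]integral_mkcond; apply: ge0_le_integral => //.
  - by apply: measurableT_comp => //; exact: measurableT_comp mf' (measurable_pair1 w).
  - by apply/(measurable_restrictT _ _).1.
  move=> s _; rewrite /= fE /patch; have /andP[D0 Dt] := D_itv w.
  case: ifPn => [|_]; last by rewrite normr0; case: ifP; rewrite lee_fin.
  rewrite inE/= in_itv/= => /andP[s0 sD]; rewrite ifT.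
    by rewrite lee_fin fM// s0 (le_trans sD).
  by rewrite inE/= in_itv/= s0 (le_trans sD).
have intf : (P \x mu)%E.-integrable setT (EFin \o f).
  apply/integrable12ltyP => //.
  apply: (@le_lt_trans _ _ (\int[P]_w (M * t)%:E)%E); last first.
    by rewrite integral_cst// [X in (_ * X < _)%E]probability_setT mule1 ltry.
  apply: ge0_le_integral => //.
  - by move=> w _; exact: integral_ge0.
  - have mabs : measurable_fun setT (fun z => `|(f z)%:E|%E) by exact: measurableT_comp.
    exact: (@measurable_fun_fubini_tonelli_F _ _ _ _ _ mu _ mabs (fun _ => abse_ge0 _)).
  by move=> w _; exact: inner_le.
have in_s w : (\int[mu]_s (f (w, s))%:E = (g (D w) - g 0)%:E)%E.
  have /andP[D0 _] := D_itv w.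
  have -> : (\int[mu]_s (f (w, s))%:E = \int[mu]_(s in `[0%R, D w]) (g' s)%:E)%E.
    by rewrite [RHS]integral_mkcond; apply: eq_integral => s _; rewrite fE restrict_EFin.
  rewrite -(FTC2 D0 dg cg') /Rintegral fineK//.
  by apply: integrable_fin_num => //; exact: continuous_integrable.
have in_w s : (\int[P]_w (f (w, s))%:E = (((fun s => g' s * survival s) \_ `[0, t]) s)%:E)%E.
  rewrite /patch; case: ifPn => [|nst].
    rewrite inE/= in_itv/= => /andP[s0 st].
    have -> : (\int[P]_w (f (w, s))%:E = \int[P]_w ((g' s)%:E * (\1_[set w | alive (N ^~ w) s] w)%:E))%E.
      apply: eq_integral => w _; rewrite /f -EFinM; congr (_ * _)%:E; rewrite !indicE; congr ((nat_of_bool _)%:R).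
      have st' : 0 <= s <= t by rewrite s0.
      apply/idP/idP; rewrite !inE /A /=.
        by move=> /andP[_ /(le_death_time (N_mono w) t0' st')].
      by move=> /(le_death_time (N_mono w) t0' st') ->; rewrite s0.
    have mal := measurable_alive N_meas N_mono s0.
    rewrite integralZl//; last exact: integrable_indic.
    by rewrite integral_indic// setIT /survival EFinM fineK// fin_num_measure.
  rewrite integral0_eq// => w _; rewrite fE /patch ifF//.
  apply/negbTE; apply: contra nst; rewrite !inE/= !in_itv/= => /andP[-> sD].
  by have /andP[_ Dt] := D_itv w; rewrite (le_trans sD).
have mS : measurable_fun setT ((fun s => g' s * survival s) \_ `[0, t]).
  apply/measurable_EFinP.
  have := measurable_fubini_G intf; apply: eq_measurable_fun => s _.
  exact: in_w.
split; first exact/(measurable_restrictT _ _).2.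
have D_int : P.-integrable setT (EFin \o (fun w => g (D w) - g 0)).
  have := integrable_fubini_F intf; apply: eq_integrable => // w _.
  exact: in_s.
have -> : (fun w => g (D w)) = (fun w => (g (D w) - g 0) + g 0).
  by apply/funext => w; rewrite subrK.
rewrite RintegralD//; last first.
  by apply: (@integrable_bounded _ _ _ _ _ _ `|g 0|) => //; rewrite ltey_eq fin_num_measure.
rewrite Rintegral_cst// [X in _ * fine X]probability_setT mulr1 addrC; congr (_ + _).
rewrite [RHS]Rintegral_mkcond /Rintegral; congr fine.
transitivity (\int[P]_w \int[mu]_s (EFin \o f) (w, s))%E.
  by apply: eq_integral => w _; exact/esym/in_s.
by rewrite (Fubini intf); apply: eq_integral => s _; exact: in_w.
Qed.

End death_law.

(** Upgrades vanishing integrals to equality at every point without assuming the survival function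
    continuous. *)
Lemma integral0_nonincreasing {R : realType} (S S0 : R -> R) (t : R) :
  (forall s u, 0 <= s -> s <= u -> u <= t -> S u <= S s) ->
  continuous S0 ->
  (lebesgue_measure).-integrable `[0, t] (EFin \o (fun s => S s - S0 s)) ->
  (forall s, 0 < s < t -> \int[lebesgue_measure]_(u in `[0, s]) (S u - S0 u) = 0) ->
  forall s, 0 < s < t -> S s = S0 s.
Proof.
move=> S_le cS0 Sint I0 s /andP[s0 st].
have part a b : 0 < a -> a < b -> b < t ->
    \int[lebesgue_measure]_(u in `]a, b]) (S u - S0 u) = 0.
  move=> a0 ab bt.
  rewrite -(@Rintegral_itvB _ _ (BLeft 0) (BRight b) a).
  - by rewrite !I0 ?subrr// ?a0 ?(lt_trans ab)// (lt_trans a0).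
  - apply: integrableS Sint => //; apply: subset_itvl.
    by rewrite bnd_simp ltW.
  - by rewrite bnd_simp ltW.
  - by rewrite bnd_simp ltW.
(* A positive (negative) gap at [s] would persist on an interval to the left
   (right) of [s]. *)
have gap (a b e sg : R) : 0 < e -> 0 < a -> a < b -> b < t ->
    ~ (forall u, a < u <= b -> e <= sg * (S u - S0 u)).
  move=> e0 a0 ab bt H.
  have lab : lebesgue_measure `]a, b]%classic = (b - a)%:E.
    by rewrite lebesgue_measure_itv/= lte_fin ab.
  have int_ab : (lebesgue_measure).-integrable `]a, b] (EFin \o (fun u => S u - S0 u)).
    apply: integrableS Sint => // u; rewrite /= !in_itv/= => /andP[au ub].
    by rewrite (ltW (lt_trans a0 au)) (le_trans ub (ltW bt)).
  have : e * (b - a) <= sg * 0.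
    rewrite -(part a b)// -RintegralZl//.
    have -> : e * (b - a) = \int[lebesgue_measure]_(u in `]a, b]) e.
      by rewrite Rintegral_cst// [X in _ = e * fine X]lab.
    apply: le_Rintegral => //.
    + apply: (@integrable_bounded _ _ _ _ _ _ `|e|) => //.
      by rewrite [X in (X < _)%E]lab ltry.
    + exact: (integrableZl _ sg int_ab).
  by rewrite mulr0 leNgt mulr_gt0// subr_gt0.
have near_s (e : R) : 0 < e -> exists2 dl, 0 < dl & forall u, `|s - u| < dl -> `|S0 s - S0 u| < e.
  move=> e0; have /cvgrPdist_lt/(_ _ e0) := cS0 s.
  by move=> /nbhs_ballP[dl dl0 H]; exists dl => // u su; exact: H.
have [lt_s|gt_s|//] := ltrgtP (S s) (S0 s); exfalso.
- have e0 : 0 < (S0 s - S s) / 2 by rewrite divr_gt0// subr_gt0.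
  have [dl dl0 H] := near_s _ e0.
  pose b := Num.min (s + dl / 2) ((s + t) / 2).
  have sb : s < b by rewrite /b lt_min; apply/andP; split; lra.
  have bt : b < t by rewrite /b gt_min; apply/orP; right; lra.
  have bd : b <= s + dl / 2 by rewrite /b ge_min lexx.
  apply: (gap s b _ (-1) e0 s0 sb bt) => u /andP[su ub].
  have : `|s - u| < dl by rewrite ltr_norml; apply/andP; split; lra.
  move=> /H; rewrite ltr_norml => /andP[h1 h2].
  have := S_le s u (ltW s0) (ltW su) (le_trans ub (ltW bt)); lra.
- have e0 : 0 < (S s - S0 s) / 2 by rewrite divr_gt0// subr_gt0.
  have [dl dl0 H] := near_s _ e0.
  pose a := Num.max (s - dl / 2) (s / 2).
  have as_ : a < s by rewrite /a gt_max; apply/andP; split; lra.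
  have a0 : 0 < a by rewrite /a lt_max; apply/orP; right; lra.
  have da : s - dl / 2 <= a by rewrite /a le_max lexx.
  apply: (gap a s _ 1 e0 a0 as_ st) => u /andP[au us].
  have : `|s - u| < dl by rewrite ltr_norml; apply/andP; split; lra.
  move=> /H; rewrite ltr_norml => /andP[h1 h2].
  have := S_le u s (ltW (lt_trans a0 au)) us (ltW st); lra.
Qed.

(** * Exponential solutions of the backward equations *)

Section exponential_solution.
Context {R : realType} d (T : measurableType d) (P : probability T R).
Notation mu := (@lebesgue_measure R).
Variables (lambda : R) (N : R -> T -> nat).
Hypothesis lambda0 : 0 < lambda.
Hypothesis HN : poisson_process P lambda N.

(** A surviving path has death time [t], so subtracting [phi true t 0] there makes the second term a
    function of the death time on all paths, fit for [expectation_death_time]. *)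
Lemma limit_reward_split t phi (w : T) : 0 <= t -> limit_reward (N ^~ w) t phi =
  ((fun w => phi (odd (N t w)) t (displacement (N ^~ w) t) - phi true t 0) \_
     [set w | alive (N ^~ w) t]) w + phi true (death_time (N ^~ w) t) 0.
Proof.
move=> t0; rewrite /limit_reward /patch; case: asboolP => aw.
  rewrite mem_set// (death_time_alive _ t0 aw) ?subrK//.
  exact: poisson_nondecreasing HN w.
by rewrite memNset// add0r.
Qed.

(* Of the solutions that are exponential in [s] and [x], those with
   [theta >= 0] are bounded on the half-line. *)
Definition exp_solution (z theta xi : R) (e : bool) (s x : R) : R :=
  (if e then 1 else xi) * (expR (- (z * s)) * expR (- (theta * x))).

Lemma expR_lip (a x y : R) : 0 <= a -> 0 <= x -> 0 <= y ->
  `|expR (- (a * x)) - expR (- (a * y))| <= a * `|x - y|.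
Proof.
move=> a0; wlog xy : x y / x <= y.
  move=> H x0 y0; have [xy|/ltW yx] := leP x y; first exact: H.
  by rewrite distrC [`|x - y|]distrC; apply: H.
move=> x0 y0; rewrite distrC [`|x - y|]distrC.
rewrite [X in _ <= _ * X]ger0_norm ?subr_ge0//.
apply: (@lipschitz_derive _ (fun u => expR (- (a * u))) (fun u => - a * expR (- (a * u))) a x y xy).
  by move=> u; apply: is_derive_eq; rewrite /GRing.scale/=; ring.
move=> u /andP[xu _]; rewrite normrM normrN (ger0_norm a0) ger0_norm ?expR_ge0//.
by rewrite ler_piMr// -expR0 ler_expR oppr_le0 mulr_ge0// (le_trans x0).
Qed.

(** The two equations read z + lambda + theta = lambda / xi and z + lambda - theta = lambda xi; the
    last two hypotheses are their half sum and half difference. *)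
Lemma exp_solutionP (z theta xi t : R) : 0 <= z -> 0 <= theta -> 0 < xi <= 1 ->
  lambda * (xi + xi^-1) / 2 = z + lambda ->
  theta = lambda * (xi^-1 - xi) / 2 ->
  backward_solution lambda t (exp_solution z theta xi) (z + theta) 1.
Proof.
move=> z0 th0 /andP[xi0 xi1] zE thE.
have e1 (a x : R) : 0 <= a -> 0 <= x -> 0 <= expR (- (a * x)) <= 1.
  by move=> a0 x0; rewrite expR_ge0 -expR0 ler_expR oppr_le0 mulr_ge0.
have c1 (e : bool) : 0 <= (if e then 1 else xi) <= 1.
  by case: e; rewrite ?ler01 ?lexx// (ltW xi0).
split.
- move=> e s x /andP[s0 _] x0.
  have /andP[a0 a1] := e1 z s z0 s0; have /andP[b0 b1] := e1 theta x th0 x0.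
  have /andP[k0 k1] := c1 e.
  rewrite ger0_norm /exp_solution ?mulr_ge0//.
  by rewrite !mulr_ile1// mulr_ge0.
- move=> e s x y /andP[s0 _] x0 y0.
  have /andP[a0 a1] := e1 z s z0 s0; have /andP[k0 k1] := c1 e.
  rewrite /exp_solution -!mulrBr !normrM (ger0_norm k0) (ger0_norm a0).
  apply: (@le_trans _ _ (1 * (1 * (theta * `|x - y|)))).
    by rewrite ler_pM ?mulr_ge0// ler_pM// expR_lip.
  by rewrite !mul1r ler_wpM2r// lerDr.
- move=> e s u x /andP[s0 _] /andP[u0 _] x0.
  have /andP[b0 b1] := e1 theta x th0 x0; have /andP[k0 k1] := c1 e.
  rewrite /exp_solution -mulrBr -mulrBl !normrM (ger0_norm k0) (ger0_norm b0).
  apply: (@le_trans _ _ (1 * ((z * `|s - u|) * 1))).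
    by rewrite ler_pM ?mulr_ge0// ler_pM// expR_lip.
  by rewrite mul1r mulr1 ler_wpM2r// lerDl.
- move=> e s x r; rewrite /exp_solution.
  have xn0 : xi != 0 by rewrite gt_eqF.
  have lE : lambda = lambda * 1 by rewrite mulr1.
  have zE' : z = lambda * (xi + xi^-1) / 2 - lambda by rewrite zE addrK.
  case: e; rewrite ?expr0 ?expr1; apply: is_derive_eq;
    rewrite /GRing.scale/= zE' thE; field; exact: xn0.
Qed.

End exponential_solution.

(** The equation is quadratic in [xi] with product of roots 1; the smaller root is taken. *)
Lemma laplace_root {R : rcfType} (lambda z : R) : 0 < lambda -> 0 < z ->
  exists2 xi, 0 < xi < 1 & lambda * (xi + xi^-1) / 2 = z + lambda.
Proof.
move=> l0 z0; pose w := z + lambda; pose q := Num.sqrt (w ^+ 2 - lambda ^+ 2).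
have w0 : 0 < w by rewrite addr_gt0.
have lw : lambda < w by rewrite ltrDr.
have q2 : q ^+ 2 = w ^+ 2 - lambda ^+ 2.
  by rewrite sqr_sqrtr// subr_ge0 lerXn2r ?nnegrE ?ltW.
have q0 : 0 <= q by exact: sqrtr_ge0.
have qw : q < w.
  rewrite -(ltr_pXn2r (n := 2)) ?nnegrE ?(ltW w0)// q2.
  by rewrite ltrBlDr ltrDl exprn_gt0.
have wq : w - lambda < q.
  rewrite -(ltr_pXn2r (n := 2)) ?nnegrE// ?subr_ge0 ?(ltW lw)// q2 -subr_gt0.
  have -> : w ^+ 2 - lambda ^+ 2 - (w - lambda) ^+ 2 = 2 * lambda * (w - lambda) by ring.
  by rewrite !mulr_gt0// subr_gt0.
have wq0 : 0 < w - q by rewrite subr_gt0.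
exists ((w - q) / lambda).
  by rewrite divr_gt0//= ltr_pdivrMr// mul1r ltrBlDr -ltrBlDl.
have -> : ((w - q) / lambda)^-1 = (w + q) / lambda.
  apply: (mulfI (_ : (w - q) / lambda != 0)).
    by rewrite mulf_neq0 ?invr_eq0 ?gt_eqF.
  rewrite divff ?mulf_neq0 ?invr_eq0 ?gt_eqF//.
  have -> : (w - q) / lambda * ((w + q) / lambda) = (w ^+ 2 - q ^+ 2) / lambda ^+ 2.
    by field; rewrite gt_eqF.
  by rewrite q2 opprB addrC subrK divff// expf_neq0 ?gt_eqF.
by rewrite -/w; field; rewrite gt_eqF.
Qed.

(** * The survival probability in closed form *)

Section survival_law.
Context {R : realType} d (T : measurableType d) (P : probability T R).
Notation mu := (@lebesgue_measure R).
Variables (lambda : R) (N : R -> T -> nat).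
Hypothesis lambda0 : 0 < lambda.
Hypothesis HN : poisson_process P lambda N.

Let N_meas := poisson_measurable HN.
Let N_mono := poisson_nondecreasing HN.

Definition survival_formula (s : R) : R :=
  expR (- (lambda * s)) * (bessel 0 (lambda * s) + bessel 1 (lambda * s)).

Lemma continuous_survival_formula : continuous survival_formula.
Proof.
have cb n : continuous (fun s : R => bessel n (lambda * s)).
  move=> s; apply: (@continuous_comp _ _ _ (fun s => lambda * s) (bessel n)).
    by apply: cvgMl_tmp; exact: cvg_id.
  exact: continuous_bessel.
have ce : continuous (fun s : R => expR (- (lambda * s))) by by_derivative.
by move=> s; apply: cvgM (ce s) _; exact: cvgD (cb 0%N s) (cb 1%N s).
Qed.

Lemma survival_le1 s : 0 <= s -> `|survival P N s| <= 1.
Proof.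
move=> s0; rewrite ger0_norm ?fine_ge0// /survival -lee_fin fineK ?probability_le1//.
  exact: measurable_alive.
by rewrite fin_num_measure//; exact: measurable_alive.
Qed.

Lemma survival_nonincreasing s u : 0 <= s -> s <= u -> survival P N u <= survival P N s.
Proof.
move=> s0 su; have mu_ := measurable_alive N_meas N_mono (le_trans s0 su).
have ms := measurable_alive N_meas N_mono s0.
rewrite /survival fine_le ?fin_num_measure//; apply: le_measure; rewrite ?inE//.
by move=> w; exact: alive_le.
Qed.

Lemma measurable_survival (t : R) : 0 < t -> measurable_fun `[0, t] (survival P N).
Proof.
move=> t0.
have d1 (x : R) : is_derive x 1 id (1 : R) by exact: is_derive_id.
have [m _] := expectation_death_time P N_meas N_mono t0 d1 (fun x => cvg_cst _).
by apply: eq_measurable_fun m => s _; rewrite mul1r.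
Qed.

Lemma measurable_limit_reward_split t phi L M : 0 < t -> 0 <= L ->
  backward_solution lambda t phi L M -> continuous (fun s => phi true s 0) ->
  let h := (fun w => phi (odd (N t w)) t (displacement (N ^~ w) t) - phi true t 0) \_
     [set w | alive (N ^~ w) t] in
  measurable_fun setT h /\ phi false 0 0 = \int[P]_w h w + \int[P]_w phi true (death_time (N ^~ w) t) 0.
Proof.
move=> t0 L0 phiP cphi h.
have [mL E] := dynkin lambda0 HN t0 L0 phiP.
have mD : measurable_fun setT (fun w => phi true (death_time (N ^~ w) t) 0).
  apply: (measurableT_comp (continuous_measurable_fun cphi)).
  exact: measurable_death_time (ltW t0).
have hE : h = fun w => limit_reward (N ^~ w) t phi - phi true (death_time (N ^~ w) t) 0.
  by apply/funext => w; rewrite (limit_reward_split HN _ _ (ltW t0)) addrK.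
have mh : measurable_fun setT h by rewrite hE; exact: measurable_funB.
split => //; rewrite -E.
have PT : (P setT < +oo)%E by rewrite ltey_eq fin_num_measure.
have tt : 0 <= t <= t by rewrite ltW/=.
have D_itv w := death_time_itv (N ^~ w) (ltW t0).
rewrite -RintegralD//.
- by apply: eq_Rintegral => w _; rewrite (limit_reward_split HN _ _ (ltW t0)).
- apply: (@integrable_bounded _ _ _ _ _ _ (M + M)) => // w _.
  rewrite /h /patch; case: ifPn => [|_].
    rewrite inE/= => aw; apply: le_trans (ler_normB _ _) _.
    rewrite lerD ?(bs_bounded phiP)//; apply: aw; exact: tt.
  rewrite normr0 addr_ge0//; exact: le_trans (normr_ge0 _) (bs_bounded phiP true tt (lexx 0)).
- apply: (@integrable_bounded _ _ _ _ _ _ M) => // w _.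
  by rewrite (bs_bounded phiP).
Qed.

(** The initial value of the solution is [xi], and the expectation of e^(-zD) is 1 - z times the
    integral. The difference times [z] is thus the term of the surviving paths, where the integrand
    lies between - e^(-zt) and 0. *)
Lemma laplace_survival (t z xi : R) : 0 < t -> 1 <= z -> 0 < xi < 1 ->
  lambda * (xi + xi^-1) / 2 = z + lambda ->
  `|\int[mu]_(s in `[0, t]) (expR (- (z * s)) * survival P N s) - (1 - xi) / z| <=
  expR (- (z * t)).
Proof.
move=> t0 z1 /andP[xi0 xi1] zE.
have z0 : 0 < z by exact: lt_le_trans z1.
pose theta := lambda * (xi^-1 - xi) / 2.
have theta0 : 0 <= theta.
  rewrite divr_ge0// mulr_ge0 ?(ltW lambda0)// subr_ge0.
  by rewrite (le_trans (ltW xi1))// invf_ge1 ?ltW.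
have phiP := @exp_solutionP R lambda z theta xi t (ltW z0) theta0 _ zE erefl.
have xi01 : 0 < xi <= 1 by rewrite xi0 ltW.
have zt0 : 0 <= z + theta by rewrite addr_ge0// ltW.
have phi_true s : exp_solution z theta xi true s 0 = expR (- (z * s)).
  by rewrite /exp_solution mulr0 oppr0 expR0 mul1r mulr1.
have cphi : continuous (fun s => exp_solution z theta xi true s 0).
  rewrite (_ : (fun s : R => _) = fun s => expR (- (z * s))); first by by_derivative.
  by apply/funext => s; exact: phi_true.
have [mh] := measurable_limit_reward_split t0 zt0 (phiP xi01) cphi.
set h := _ \_ _ in mh *.
rewrite {1}/exp_solution !mulr0 oppr0 expR0 !mulr1.
have dg (x : R) : is_derive x 1 (fun s => expR (- (z * s))) (- z * expR (- (z * x))).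
  by apply: is_derive_eq; rewrite /GRing.scale/=; ring.
have cg : continuous (fun x => - z * expR (- (z * x))) by by_derivative.
have [_ ED] := expectation_death_time P N_meas N_mono t0 dg cg.
under [X in _ + X]eq_Rintegral do rewrite phi_true.
rewrite ED mulr0 oppr0 expR0 => xiE.
have hb : `|\int[P]_w h w| <= expR (- (z * t)).
  rewrite -[leRHS]mulr1 -[X in _ * X](_ : fine (P setT) = 1); last by rewrite probability_setT.
  apply: normr_Rintegral_le => //; first by rewrite ltey_eq fin_num_measure.
  move=> w _; rewrite /h /patch; case: ifPn => [|_]; last by rewrite normr0 expR_ge0.
  rewrite inE/= => aw.
  have Y0 : 0 <= displacement (N ^~ w) t by apply: aw; rewrite lexx ltW.
  rewrite phi_true /exp_solution.
  have et := expR_ge0 (- (z * t)).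
  have eY : 0 <= expR (- (theta * displacement (N ^~ w) t)) <= 1.
    by rewrite expR_ge0 -expR0 ler_expR oppr_le0 mulr_ge0.
  have k01 : 0 <= (if odd (N t w) then 1 else xi) <= 1.
    by case: odd; rewrite ?ler01 ?lexx// !ltW.
  move: eY k01; move: (expR (- (theta * _))) (if _ then _ else _) => u k /andP[u0 u1] /andP[k0 k1].
  have -> : k * (expR (- (z * t)) * u) - expR (- (z * t)) = - ((1 - k * u) * expR (- (z * t))) by ring.
  have ku : 0 <= k * u <= 1 by rewrite mulr_ge0//= mulr_ile1.
  case/andP: ku => ku0 ku1.
  by rewrite normrN normrM (ger0_norm et) ger0_norm ?subr_ge0// ler_piMl// gerBl.
have int_s : mu.-integrable `[0, t] (EFin \o (fun s => expR (- (z * s)) * survival P N s)).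
  apply: (@integrable_bounded _ _ _ _ _ _ 1) => //; first exact: lebesgue_itv_lty.
    apply: measurable_funM; last exact: measurable_survival.
    by apply: measurable_funTS; apply: continuous_measurable_fun; by_derivative.
  move=> s; rewrite /= in_itv/= => /andP[s0 _].
  rewrite normrM mulr_ile1//; last exact: survival_le1.
  by rewrite ger0_norm ?expR_ge0// -expR0 ler_expR oppr_le0 mulr_ge0// ltW.
have : \int[mu]_(s in `[0, t]) (- z * expR (- (z * s)) * survival P N s) =
   - z * \int[mu]_(s in `[0, t]) (expR (- (z * s)) * survival P N s).
  by rewrite -RintegralZl//; apply: eq_Rintegral => s _; rewrite mulrA.
move: xiE => /[swap] ->; set J := \int[mu]_(s in _) _ => xiE.
have -> : J - (1 - xi) / z = \int[P]_w h w / z.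
  by rewrite xiE; field; rewrite gt_eqF.
rewrite normrM (ger0_norm (_ : 0 <= z^-1)) ?invr_ge0 ?(ltW z0)//.
rewrite -[leRHS]mulr1 ler_pM// ?invr_ge0 ?(ltW z0)//.
by rewrite invf_le1.
Qed.

Theorem survivalE s : 0 < s -> survival P N s = survival_formula s.
Proof.
(* Any horizon beyond [s] would do: uniqueness holds strictly inside the horizon. *)
move=> s0; pose t := s + 1.
have t0 : 0 < t by rewrite addr_gt0.
have st : 0 < s < t by rewrite s0 ltrDl ltr01.
have ms := measurable_survival t0.
have mf : measurable_fun `[0, t] survival_formula.
  by apply: measurable_funTS; apply: continuous_measurable_fun; exact: continuous_survival_formula.
have [M fM] : exists M, forall s, 0 <= s <= t -> `|survival_formula s| <= M.
  have [c _ cmax] := EVT_max (ltW t0) (continuous_subspaceT (fun x => cvg_norm (continuous_survival_formula (x:=x)))).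
  by exists `|survival_formula c| => u ut; apply: cmax; rewrite in_itv.
have bnd u : `[0, t]%classic u -> `|survival P N u - survival_formula u| <= 1 + M.
  rewrite /= in_itv/= => ut; apply: le_trans (ler_normB _ _) _; rewrite lerD ?fM//.
  by apply: survival_le1; case/andP: ut.
have mdiff : measurable_fun `[0, t] (fun s => survival P N s - survival_formula s).
  exact: measurable_funB.
have int_diff : mu.-integrable `[0, t] (EFin \o (fun s => survival P N s - survival_formula s)).
  exact: integrable_bounded (lebesgue_itv_lty 0 t) mdiff bnd.
apply: (integral0_nonincreasing _ continuous_survival_formula int_diff _ st).
  by move=> a b a0 ab _; exact: survival_nonincreasing.
(* The constant adds 1 from [laplace_survival] to 3 + 2 lambda from [bessel_laplace]. *)
apply: (laplace_unique (C := 4 + 2 * lambda) mdiff bnd) => n n0.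
have z1 : 1 <= n%:R :> R by rewrite ler1n.
have [xi xi01 xiE] := laplace_root lambda0 (lt_le_trans ltr01 z1).
have H1 := laplace_survival t0 z1 xi01 xiE.
have H2 : `|\int[mu]_(s in `[0, t]) (expR (- (n%:R * s)) * survival_formula s) - (1 - xi) / n%:R| <=
    (3 + 2 * lambda) * expR (- (n%:R * t)) := bessel_laplace lambda0 xi01 z1 xiE t0.
have ce : continuous (fun u : R => expR (- (n%:R * u))) by by_derivative.
have me : measurable_fun `[0, t] (fun u : R => expR (- (n%:R * u))).
  by apply: measurable_funTS; apply: continuous_measurable_fun.
have eb u : `[0, t]%classic u -> `|expR (- (n%:R * u))| <= 1 :> R.
  rewrite /= in_itv/= => /andP[u0 _].
  by rewrite ger0_norm ?expR_ge0// -expR0 ler_expR oppr_le0 mulr_ge0.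
have -> : \int[mu]_(u in `[0, t]) (expR (- (n%:R * u)) * (survival P N u - survival_formula u)) =
  \int[mu]_(u in `[0, t]) (expR (- (n%:R * u)) * survival P N u) -
  \int[mu]_(u in `[0, t]) (expR (- (n%:R * u)) * survival_formula u).
  rewrite -RintegralB//.
  - by apply: eq_Rintegral => u _; rewrite mulrBr.
  - apply: (@integrable_bounded _ _ _ _ _ _ (1 * 1)) => //; first exact: lebesgue_itv_lty.
      exact: measurable_funM.
    move=> u ut; rewrite normrM ler_pM ?eb// survival_le1//.
    by move: ut; rewrite /= in_itv/= => /andP[].
  - apply: (@integrable_bounded _ _ _ _ _ _ (1 * M)) => //; first exact: lebesgue_itv_lty.
      exact: measurable_funM.
    by move=> u ut; rewrite normrM ler_pM ?eb// fM//; move: ut; rewrite /= in_itv.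
move: H1 H2.
set J1 := \int[mu]_(u in `[0, t]) (expR (- (n%:R * u)) * survival P N u).
set J2 := \int[mu]_(u in `[0, t]) (expR (- (n%:R * u)) * survival_formula u).
move=> H1 H2; have -> : J1 - J2 = (J1 - (1 - xi) / n%:R) - (J2 - (1 - xi) / n%:R) by ring.
apply: le_trans (ler_normB _ _) _; apply: le_trans (lerD H1 H2) _.
by rewrite le_eqVlt; apply/orP; left; apply/eqP; ring.
Qed.

End survival_law.

(** * Trigonometric solutions of the backward equations *)

Lemma is_derive_sinh {R : realType} (x : R) : is_derive x 1 sinh (cosh x).
Proof.
rewrite /sinh; apply: is_derive_eq; rewrite /GRing.scale/= /cosh; by field.
Qed.

Lemma is_derive_cosh {R : realType} (x : R) : is_derive x 1 cosh (sinh x).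
Proof.
rewrite /cosh; apply: is_derive_eq; rewrite /GRing.scale/= /sinh; by field.
Qed.

Lemma sinh0 {R : realType} : sinh (0 : R) = 0.
Proof. by rewrite /sinh oppr0 subrr mul0r. Qed.

Lemma cosh0 {R : realType} : cosh (0 : R) = 1.
Proof. by rewrite /cosh oppr0 expR0 divff. Qed.

Lemma C1_bounded_lip {R : realType} (f f' : R -> R) (t : R) : 0 <= t ->
  (forall x : R, is_derive x 1 f (f' x)) -> continuous f' ->
  exists K, [/\ 0 <= K, forall s, 0 <= s <= t -> `|f s| <= K &
    forall s u, 0 <= s <= t -> 0 <= u <= t -> `|f s - f u| <= K * `|s - u|].
Proof.
move=> t0 df cf'.
have cf := is_derive_continuous df.
have [c _ cmax] := EVT_max t0 (continuous_subspaceT (fun x => cvg_norm (cf x))).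
have [c' _ cmax'] := EVT_max t0 (continuous_subspaceT (fun x => cvg_norm (cf' x))).
exists (`|f c| + `|f' c'|); split; first by rewrite addr_ge0.
  by move=> s st; rewrite (le_trans (cmax s _)) ?in_itv// lerDl.
have lip s u : 0 <= s -> s <= u -> u <= t -> `|f u - f s| <= (`|f c| + `|f' c'|) * (u - s).
  move=> s0 su ut; apply: (lipschitz_derive su df) => x /andP[sx xu].
  rewrite (le_trans (cmax' x _)) ?lerDr// in_itv/=.
  by rewrite (le_trans s0 sx) (le_trans xu ut).
move=> s u /andP[s0 st] /andP[u0 ut]; have [su|/ltW us] := leP s u.
  by rewrite distrC [`|s - u|]distrC [X in _ * X]ger0_norm ?subr_ge0//; exact: lip.
by rewrite [X in _ * X]ger0_norm ?subr_ge0//; exact: lip.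
Qed.

Section trig_solution.
Context {R : realType}.
Variables (lambda g r t theta : R).
Hypotheses (lambda0 : 0 < lambda) (r0 : 0 < r) (t0 : 0 < t).
Hypothesis rE : r ^+ 2 = lambda ^+ 2 - g ^+ 2.

(* Real and imaginary part of exp (- lambda (t - s)) times
   cosh (r (t - s)) + (lambda + i g) / r sinh (r (t - s)). *)
Definition trig_re (s : R) : R := expR (- (lambda * (t - s))) *
  (cosh (r * (t - s)) + lambda / r * sinh (r * (t - s))).
Definition trig_im (s : R) : R := expR (- (lambda * (t - s))) *
  (g / r * sinh (r * (t - s))).

(** The backward equations amount to [trig_re' = g * trig_im] and [trig_im' = 2 * lambda * trig_im -
    g * trig_re], taken pointwise. *)
Definition trig_re' (s : R) : R := expR (- (lambda * (t - s))) *
  (g ^+ 2 / r * sinh (r * (t - s))).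
Definition trig_im' (s : R) : R := expR (- (lambda * (t - s))) *
  (lambda * g / r * sinh (r * (t - s)) - g * cosh (r * (t - s))).

Let rn0 : r != 0. Proof. by rewrite gt_eqF. Qed.

Let dE (s : R) : is_derive s 1 (fun s => expR (- (lambda * (t - s)))) (lambda * expR (- (lambda * (t - s)))).
Proof. by apply: is_derive_eq; rewrite /GRing.scale/=; ring. Qed.

Let dlin (s : R) : is_derive s 1 (fun s => r * (t - s)) (- r).
Proof. by apply: is_derive_eq; rewrite /GRing.scale/=; ring. Qed.

Let dsh (s : R) : is_derive s 1 (fun s => sinh (r * (t - s))) (cosh (r * (t - s)) * - r).
Proof. exact: is_derive1_comp (is_derive_sinh _) (dlin s). Qed.

Let dch (s : R) : is_derive s 1 (fun s => cosh (r * (t - s))) (sinh (r * (t - s)) * - r).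
Proof. exact: is_derive1_comp (is_derive_cosh _) (dlin s). Qed.

Lemma is_derive_trig_re (s : R) : is_derive s 1 trig_re (trig_re' s).
Proof.
have H := is_deriveM (dE s) (is_deriveD (dch s) (is_deriveZ (lambda / r) (dsh s))).
apply: is_derive_eq H _; rewrite /trig_re' /GRing.scale/= ?fctE/= /GRing.scale/=.
move: (expR _) (sinh _) (cosh _) => e sh ch.
have -> : g ^+ 2 = lambda ^+ 2 - r ^+ 2 by rewrite rE; ring.
by field.
Qed.

Lemma is_derive_trig_im (s : R) : is_derive s 1 trig_im (trig_im' s).
Proof.
have H := is_deriveM (dE s) (is_deriveZ (g / r) (dsh s)).
apply: is_derive_eq H _; rewrite /trig_im' /GRing.scale/= ?fctE/= /GRing.scale/=.
by move: (expR _) (sinh _) (cosh _) => e sh ch; field.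
Qed.

Let csh : continuous (fun s => sinh (r * (t - s))).
Proof. exact: is_derive_continuous dsh. Qed.
Let cch : continuous (fun s => cosh (r * (t - s))).
Proof. exact: is_derive_continuous dch. Qed.
Let cE : continuous (fun s => expR (- (lambda * (t - s)))).
Proof. exact: is_derive_continuous dE. Qed.

Lemma continuous_trig_re' : continuous trig_re'.
Proof.
have c : continuous (fun s => g ^+ 2 / r * sinh (r * (t - s))).
  by move=> s; apply: cvgMl_tmp; exact: csh.
by move=> s; exact: (continuousM (@cE s) (c s)).
Qed.

Lemma continuous_trig_im' : continuous trig_im'.
Proof.
have c : continuous (fun s => lambda * g / r * sinh (r * (t - s)) - g * cosh (r * (t - s))).
  by move=> s; apply: cvgB; apply: cvgMl_tmp; [exact: csh|exact: cch].
by move=> s; exact: (continuousM (@cE s) (c s)).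
Qed.

(* [theta = 0] and [theta = - pi / 2] give the real and imaginary part of the
   solution with terminal value exp (i g x). *)
Definition trig_solution (e : bool) (s x : R) : R :=
  trig_re s * cos (g * x + theta) - (-1) ^+ e * trig_im s * sin (g * x + theta).

Lemma trig_solutionP : exists L M, 0 <= L /\ backward_solution lambda t trig_solution L M.
Proof.
have [K1 [K10 K1b K1l]] := C1_bounded_lip (ltW t0) is_derive_trig_re continuous_trig_re'.
have [K2 [K20 K2b K2l]] := C1_bounded_lip (ltW t0) is_derive_trig_im continuous_trig_im'.
have cos1 (x : R) : `|cos x| <= 1 by rewrite ler_norml cos_geN1 cos_le1.
have sin1 (x : R) : `|sin x| <= 1 by rewrite ler_norml sin_geN1 sin_le1.
have lip_trig (f f' : R -> R) : (forall x : R, is_derive x 1 f (f' x)) -> (forall x, `|f' x| <= 1) ->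
    forall x y, `|f (g * x + theta) - f (g * y + theta)| <= `|g| * `|x - y|.
  move=> df f'1.
  have lip (x y : R) : x <= y -> `|f y - f x| <= `|y - x|.
    move=> xy; rewrite [leRHS]ger0_norm ?subr_ge0// -[leRHS]mul1r.
    by apply: (lipschitz_derive xy df) => u _; exact: f'1.
  move=> x y; rewrite -normrM (_ : g * (x - y) = g * x + theta - (g * y + theta)); last by ring.
  have [xy|/ltW yx] := leP (g * y + theta) (g * x + theta); first exact: lip.
  by rewrite distrC [leRHS]distrC; exact: lip.
have lip_cos := lip_trig cos (fun x => - sin x) (fun x => is_derive_cos x)
  (fun x => eq_ind_r (fun y => y <= 1) (sin1 x) (normrN (sin x))).
have lip_sin := lip_trig sin cos (fun x => is_derive_sin x) cos1.
have sgn (e : bool) : `|(-1) ^+ e : R| = 1 by rewrite normrX normrN1 expr1n.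
exists ((K1 + K2) * (1 + `|g|)), (K1 + K2); split.
  by rewrite mulr_ge0 ?addr_ge0.
have le_sum (e : bool) (a b c d A B C D' : R) : `|a| <= A -> `|b| <= B -> `|c| <= C -> `|d| <= D' ->
    `|a * b - (-1) ^+ e * c * d| <= A * B + C * D'.
  move=> aA bB cC dD; apply: le_trans (ler_normB _ _) _.
  by rewrite !normrM sgn mul1r lerD// ler_pM.
split.
- move=> e s x st x0; rewrite /trig_solution -[K1]mulr1 -[K2]mulr1.
  by apply: le_sum; [exact: K1b|exact: cos1|exact: K2b|exact: sin1].
- move=> e s x y st x0 y0; rewrite /trig_solution.
  have -> : trig_re s * cos (g * x + theta) - (-1) ^+ e * trig_im s * sin (g * x + theta) -
     (trig_re s * cos (g * y + theta) - (-1) ^+ e * trig_im s * sin (g * y + theta)) =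
    trig_re s * (cos (g * x + theta) - cos (g * y + theta)) -
    (-1) ^+ e * trig_im s * (sin (g * x + theta) - sin (g * y + theta)) by ring.
  have H := le_sum e _ _ _ _ _ _ _ _ (K1b s st) (lip_cos x y) (K2b s st) (lip_sin x y).
  apply: le_trans H _.
  have -> : (K1 + K2) * (1 + `|g|) * `|x - y| =
    (K1 * (`|g| * `|x - y|) + K2 * (`|g| * `|x - y|)) + (K1 + K2) * `|x - y| by ring.
  by rewrite lerDl mulr_ge0// addr_ge0.
- move=> e s u x st ut x0; rewrite /trig_solution.
  have -> : trig_re s * cos (g * x + theta) - (-1) ^+ e * trig_im s * sin (g * x + theta) -
     (trig_re u * cos (g * x + theta) - (-1) ^+ e * trig_im u * sin (g * x + theta)) =
    (trig_re s - trig_re u) * cos (g * x + theta) -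
    (-1) ^+ e * (trig_im s - trig_im u) * sin (g * x + theta) by ring.
  have H := le_sum e _ _ _ _ _ _ _ _ (K1l s u st ut) (cos1 (g * x + theta)) (K2l s u st ut) (sin1 (g * x + theta)).
  apply: le_trans H _; rewrite !mulr1.
  have -> : (K1 + K2) * (1 + `|g|) * `|s - u| =
    (K1 * `|s - u| + K2 * `|s - u|) + (K1 + K2) * `|g| * `|s - u| by ring.
  by rewrite lerDl !mulr_ge0// addr_ge0.
- move=> e s x h.
  have ds : is_derive h 1 (fun h => s + h) 1.
    by apply: is_derive_eq; rewrite add0r mul1r.
  have dx : is_derive h 1 (fun h => g * (x + (-1) ^+ e * h) + theta) (g * (-1) ^+ e).
    by apply: is_derive_eq; rewrite /GRing.scale/=; ring.
  have d1 := is_deriveM (is_derive1_comp (is_derive_trig_re (s + h)) ds) (is_derive1_comp (is_derive_cos _) dx).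
  have d2 := is_deriveM (is_deriveZ ((-1) ^+ e) (is_derive1_comp (is_derive_trig_im (s + h)) ds))
    (is_derive1_comp (is_derive_sin _) dx).
  apply: is_derive_eq (is_deriveB d1 d2) _.
  rewrite /trig_solution /GRing.scale/= ?fctE/= /GRing.scale/= /trig_re' /trig_im' /trig_re /trig_im.
  move: (cos _) (sin _) (expR _) (sinh _) (cosh _) => C S E sh ch.
  have es : (-1) ^+ e * (-1) ^+ e = 1 :> R by rewrite -expr2 sqrr_sign.
  by case: e {dx d1 d2} es => _; rewrite ?expr0 ?expr1; field.
Qed.

End trig_solution.

(** * Convolutions with the Bessel functions of order 0 and 1 *)

Section bessel_convolution.
Context {R : realType}.
Notation mu := (@lebesgue_measure R).
Variables (lambda t : R).
Hypothesis t0 : 0 < t.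

Let dB0 (s : R) : is_derive s 1 (fun s => bessel 0 (lambda * s)) (lambda * bessel 1 (lambda * s)).
Proof.
have dl : is_derive s 1 (fun s => lambda * s) lambda.
  by apply: is_derive_eq; rewrite /GRing.scale/=; ring.
by rewrite mulrC; exact: is_derive1_comp (is_derive_bessel0 _) dl.
Qed.

Let cB n : continuous (fun s : R => bessel n (lambda * s)).
Proof.
move=> s; apply: (@continuous_comp _ _ _ (fun s => lambda * s) (bessel n)).
  by apply: cvgMl_tmp; exact: cvg_id.
exact: continuous_bessel.
Qed.

Let crev (f : R -> R) : continuous f -> continuous (fun s => f (t - s)).
Proof.
move=> cf s; apply: (@continuous_comp _ _ _ (fun s => t - s) f); last exact: cf.
by apply: cvgB; [exact: cvg_cst|exact: cvg_id].
Qed.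

Lemma convolution_bessel0 (f : R -> R) : continuous f ->
  \int[mu]_(s in `[0, t]) (f (t - s) * bessel 0 (lambda * s)) =
  \int[mu]_(s in `[0, t]) (f s * bessel 0 (lambda * (t - s))).
Proof.
move=> cf; rewrite -(reverse_integral (f := fun s => f s * bessel 0 (lambda * (t - s))) (ltW t0)).
  by apply: eq_Rintegral => s _; rewrite subKr.
move=> s; apply: cvgM; first exact: cf.
exact: (crev (@cB 0)).
Qed.

Lemma convolution_bessel1 (f f' : R -> R) : (forall x : R, is_derive x 1 f (f' x)) ->
  continuous f' ->
  lambda * \int[mu]_(s in `[0, t]) (f (t - s) * bessel 1 (lambda * s)) =
  f 0 * bessel 0 (lambda * t) - f t + \int[mu]_(s in `[0, t]) (f' s * bessel 0 (lambda * (t - s))).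
Proof.
move=> df cf'; have cf := is_derive_continuous df.
rewrite -convolution_bessel0// -RintegralZl//; last first.
  by apply: continuous_integrable => s; apply: cvgM; [exact: crev|exact: cB].
have dr (s : R) : is_derive s 1 (fun s => f (t - s)) (- f' (t - s)).
  have dl : is_derive s 1 (fun s => t - s) (- 1 : R).
    by apply: is_derive_eq; rewrite /GRing.scale/=; ring.
  by have := @is_derive1_comp _ f (fun s => t - s) s _ _ (df (t - s)) dl; rewrite mulrN1.
have cr : continuous (fun s => - f' (t - s)).
  by move=> s; apply: cvgN; exact: crev.
have cl : continuous (fun s => lambda * bessel 1 (lambda * s)).
  by move=> s; apply: cvgMl_tmp; exact: cB.
have := parts_integral (ltW t0) dr cr dB0 cl.
rewrite subrr subr0 mulr0 bessel_at0 mulr1.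
rewrite (_ : \int[mu]_(s in `[0, t]) (- f' (t - s) * bessel 0 (lambda * s)) =
  - \int[mu]_(s in `[0, t]) (f' (t - s) * bessel 0 (lambda * s))).
  rewrite opprK => <-; apply: eq_Rintegral => s _; ring.
rewrite -mulN1r -RintegralZl//.
  by apply: eq_Rintegral => s _; ring.
by apply: continuous_integrable => s; apply: cvgM; [exact: crev|exact: cB].
Qed.

End bessel_convolution.

(** * Trigonometric moments of the surviving path *)

Section trig_expectation.
Context {R : realType} d (T : measurableType d) (P : probability T R).
Notation mu := (@lebesgue_measure R).
Variables (lambda : R) (N : R -> T -> nat).
Hypothesis lambda0 : 0 < lambda.
Hypothesis HN : poisson_process P lambda N.
Variables (g r t : R).
Hypotheses (r0 : 0 < r) (t0 : 0 < t).
Hypothesis rE : r ^+ 2 = lambda ^+ 2 - g ^+ 2.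

Let N_meas := poisson_measurable HN.
Let N_mono := poisson_nondecreasing HN.
Let Y w := displacement (N ^~ w) t.

Lemma trig_re_t : trig_re lambda r t t = 1.
Proof. by rewrite /trig_re subrr !mulr0 oppr0 expR0 cosh0 sinh0 mulr0 addr0 mulr1. Qed.

Lemma trig_im_t : trig_im lambda g r t t = 0.
Proof. by rewrite /trig_im subrr !mulr0 sinh0 !mulr0. Qed.

Lemma survival_closed s : 0 <= s -> survival P N s = survival_formula lambda s.
Proof.
rewrite le_eqVlt => /predU1P[<-|]; last exact: survivalE.
rewrite /survival_formula !mulr0 oppr0 expR0 mul1r !bessel_at0 addr0.
rewrite /survival (_ : [set w | _] = setT) ?probability_setT//.
by apply/seteqP; split => // w _; exact: alive0.
Qed.

(** The term with factor 2 is the difference of the two components at (0, 0): Dynkin's formula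
    starts with positive velocity, while the expectation over the death time starts from the
    component of negative velocity. *)
Lemma alive_cos_survival theta :
  \int[P]_(w in [set w | alive (N ^~ w) t]) cos (g * Y w + theta) =
  cos theta * survival_formula lambda t
  - 2 * trig_im lambda g r t 0 * sin theta
  - \int[mu]_(s in `[0, t]) ((trig_re' lambda g r t s * cos theta +
       trig_im' lambda g r t s * sin theta) * survival_formula lambda s).
Proof.
have [L [M [L0 phiP]]] := trig_solutionP theta r0 t0 rE.
pose G s := trig_re lambda r t s * cos theta + trig_im lambda g r t s * sin theta.
have GE s : trig_solution lambda g r t theta true s 0 = G s.
  by rewrite /trig_solution /G mulr0 add0r expr1; ring.
pose G' s := trig_re' lambda g r t s * cos theta + trig_im' lambda g r t s * sin theta.
have dG (s : R) : is_derive s 1 G (G' s).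
  have H := is_deriveD (is_deriveZ (cos theta) (is_derive_trig_re t r0 rE s))
    (is_deriveZ (sin theta) (is_derive_trig_im lambda g t r0 s)).
  have -> : G = (cos theta \*: trig_re lambda r t) + (sin theta \*: trig_im lambda g r t).
    by apply/funext => u; rewrite /G mulrC [X in _ + X]mulrC.
  by apply: is_derive_eq H _; rewrite /GRing.scale/= /G'; ring.
have cG' : continuous G'.
  move=> s; apply: cvgD; apply: cvgMr_tmp.
    exact: continuous_trig_re'.
  exact: continuous_trig_im'.
have cphi : continuous (fun s => trig_solution lambda g r t theta true s 0).
  by rewrite (_ : (fun s => _) = G); [exact: is_derive_continuous dG|apply/funext].
have [_] := measurable_limit_reward_split lambda0 HN t0 L0 phiP cphi.
under [X in _ + X]eq_Rintegral do rewrite GE.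
have [_ ->] := expectation_death_time P N_meas N_mono t0 dG cG'.
have -> : \int[mu]_(s in `[0, t]) (G' s * survival P N s) =
    \int[mu]_(s in `[0, t]) (G' s * survival_formula lambda s).
  apply: eq_Rintegral => s; rewrite inE/= in_itv/= => /andP[s0 _].
  by rewrite survival_closed.
rewrite -Rintegral_mkcond.
have mal : measurable [set w | alive (N ^~ w) t] by exact: measurable_alive (ltW t0).
have alfin : (P [set w | alive (N ^~ w) t] < +oo)%E by rewrite ltey_eq fin_num_measure.
have mY : measurable_fun setT Y by exact: measurable_displacement (ltW t0).
have mcos : measurable_fun setT (fun w => cos (g * Y w + theta)).
  have ccos : continuous (fun y : R => cos (g * y + theta)) by by_derivative.
  exact: (measurableT_comp (continuous_measurable_fun ccos)).
rewrite (@eq_Rintegral _ _ _ P _ (fun w => cos (g * Y w + theta) - cos theta)); last first.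
  move=> w _; rewrite GE /G /trig_solution trig_re_t trig_im_t.
  by rewrite mulr0 !mul0r !mul1r subr0 addr0.
rewrite RintegralB//; last 2 first.
- apply: (@integrable_bounded _ _ _ _ _ _ 1) => //; first exact: measurable_funTS.
  by move=> w _; rewrite ler_norml cos_geN1 cos_le1.
- by apply: (@integrable_bounded _ _ _ _ _ _ `|cos theta|).
rewrite Rintegral_cst// -/(survival P N t) (survivalE lambda0 HN t0) /G.
rewrite /trig_solution mulr0 add0r expr0.
move=> H; apply/eqP; rewrite -subr_eq0; apply/eqP; move: H.
set I := \int[P]_(w in _) _; set J := \int[mu]_(s in _) _.
move=> H; rewrite -/J.
have -> : I = trig_re lambda r t 0 * cos theta - 1 * trig_im lambda g r t 0 * sin theta
  + cos theta * survival_formula lambda t - (trig_re lambda r t 0 * cos theta + trig_im lambda g r t 0 * sin theta + J).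
  by rewrite H; ring.
by ring.
Qed.

Local Notation I0 := (bessel 0).
Let Jsh := \int[mu]_(s in `[0, t]) (sinh (r * s) * I0 (lambda * (t - s))).
Let Jch := \int[mu]_(s in `[0, t]) (cosh (r * s) * I0 (lambda * (t - s))).

Let dsh (s : R) : is_derive s 1 (fun s => sinh (r * s)) (r * cosh (r * s)).
Proof.
have dl : is_derive s 1 (fun s => r * s) r.
  by apply: is_derive_eq; rewrite /GRing.scale/=; ring.
by rewrite mulrC; exact: is_derive1_comp (is_derive_sinh _) dl.
Qed.

Let dch (s : R) : is_derive s 1 (fun s => cosh (r * s)) (r * sinh (r * s)).
Proof.
have dl : is_derive s 1 (fun s => r * s) r.
  by apply: is_derive_eq; rewrite /GRing.scale/=; ring.
by rewrite mulrC; exact: is_derive1_comp (is_derive_cosh _) dl.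
Qed.

Let csh := is_derive_continuous dsh.
Let cch := is_derive_continuous dch.
Let crch : continuous (fun s => r * cosh (r * s)).
Proof. by move=> s; apply: cvgMl_tmp; exact: cch. Qed.
Let crsh : continuous (fun s => r * sinh (r * s)).
Proof. by move=> s; apply: cvgMl_tmp; exact: csh. Qed.

Lemma alive_cos theta :
  \int[P]_(w in [set w | alive (N ^~ w) t]) cos (g * Y w + theta) =
  expR (- (lambda * t)) *
  (cos theta * (I0 (lambda * t) + bessel 1 (lambda * t))
   - 2 * (g / r) * sinh (r * t) * sin theta
   - (cos theta * (g ^+ 2 / r) + sin theta * (lambda * g / r)) *
       (Jsh + (r * Jch - sinh (r * t)) / lambda)
   + sin theta * g * (Jch + (I0 (lambda * t) - cosh (r * t) + r * Jsh) / lambda)).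
Proof.
rewrite alive_cos_survival.
pose f k s := k (r * (t - s)) * (I0 (lambda * s) + bessel 1 (lambda * s)) : R.
have cf k : continuous (fun s => k (r * (t - s)) : R) -> continuous (f k).
  move=> ck s; apply: cvgM; first exact: ck.
  apply: cvgD; apply: (@continuous_comp _ _ _ (fun s => lambda * s) (bessel _)).
  - by apply: cvgMl_tmp; exact: cvg_id.
  - exact: continuous_bessel.
  - by apply: cvgMl_tmp; exact: cvg_id.
  - exact: continuous_bessel.
have rev (k : R -> R) : continuous k -> continuous (fun s => k (t - s)).
  move=> ck s; apply: (@continuous_comp _ _ _ (fun s => t - s) k); last exact: ck.
  by apply: cvgB; [exact: cvg_cst|exact: cvg_id].
have cfsh : continuous (f sinh) by apply: cf; exact: (rev (fun s => sinh (r * s))).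
have cfch : continuous (f cosh) by apply: cf; exact: (rev (fun s => cosh (r * s))).
pose A := cos theta * (g ^+ 2 / r) + sin theta * (lambda * g / r).
pose B := - (sin theta * g).
have -> : \int[mu]_(s in `[0, t]) ((trig_re' lambda g r t s * cos theta +
       trig_im' lambda g r t s * sin theta) * survival_formula lambda s) =
  expR (- (lambda * t)) * (A * \int[mu]_(s in `[0, t]) f sinh s + B * \int[mu]_(s in `[0, t]) f cosh s).
  have cA : continuous (fun s => A * f sinh s) by move=> s; apply: cvgMl_tmp; exact: cfsh.
  have cB : continuous (fun s => B * f cosh s) by move=> s; apply: cvgMl_tmp; exact: cfch.
  have cAB : continuous (fun s => A * f sinh s + B * f cosh s).
    by move=> s; apply: cvgD; [exact: cA|exact: cB].
  rewrite -RintegralZl//; last exact: continuous_integrable.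
  rewrite -RintegralZl//; last exact: continuous_integrable.
  rewrite -RintegralD//; try exact: continuous_integrable.
  rewrite -RintegralZl//; last exact: continuous_integrable.
  apply: eq_Rintegral => s _.
  (* The damping of the solution and that of the survival probability multiply to a constant, which
     leaves a pure convolution. *)
  have -> : expR (- (lambda * t)) = expR (- (lambda * (t - s))) * expR (- (lambda * s)).
    by rewrite -expRD; congr expR; ring.
  rewrite /trig_re' /trig_im' /survival_formula /f /A /B.
  move: (expR _) (expR _) (sinh _) (cosh _) (bessel 0 _) (bessel 1 _) (cos _) (sin _) => e1 e2 sh ch b0 b1 C S.
  ring.
(* The part with I_0 is reversed in time and the part with I_1 integrated by parts, so that only I_0
   remains under the integrals. *)
have split_f (k k' : R -> R) : (forall s : R, is_derive s 1 (fun s => k (r * s)) (k' s)) -> continuous k' ->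
    \int[mu]_(s in `[0, t]) f k s = \int[mu]_(s in `[0, t]) (k (r * s) * I0 (lambda * (t - s))) +
     (k 0 * I0 (lambda * t) - k (r * t) + \int[mu]_(s in `[0, t]) (k' s * I0 (lambda * (t - s)))) / lambda.
  move=> dk ck'.
  have ck := is_derive_continuous dk.
  have := convolution_bessel1 lambda t0 dk ck'; rewrite mulr0 => <-.
  rewrite -(convolution_bessel0 lambda t0 ck) [lambda * _]mulrC mulfK ?gt_eqF//.
  have cb n : continuous (fun s : R => bessel n (lambda * s)).
    move=> s; apply: (@continuous_comp _ _ _ (fun s => lambda * s) (bessel n)).
      by apply: cvgMl_tmp; exact: cvg_id.
    exact: continuous_bessel.
  rewrite -RintegralD//.
  - by apply: eq_Rintegral => s _; rewrite /f mulrDr.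
  - by apply: continuous_integrable => s; apply: cvgM; [exact: (rev _ ck)|exact: cb].
  - by apply: continuous_integrable => s; apply: cvgM; [exact: (rev _ ck)|exact: cb].
have cI : continuous (fun s => I0 (lambda * (t - s))).
  apply: (rev (fun s => I0 (lambda * s))) => s; apply: (@continuous_comp _ _ _ (fun s => lambda * s) (bessel 0)).
    by apply: cvgMl_tmp; exact: cvg_id.
  exact: continuous_bessel.
have pull (k : R -> R) : continuous k ->
    \int[mu]_(s in `[0, t]) (r * k s * I0 (lambda * (t - s))) = r * \int[mu]_(s in `[0, t]) (k s * I0 (lambda * (t - s))).
  move=> ck; rewrite -RintegralZl//.
    by apply: eq_Rintegral => s _; rewrite mulrA.
  by apply: continuous_integrable => s; apply: cvgM; [exact: ck|exact: cI].
rewrite (split_f _ _ dsh crch) (split_f _ _ dch crsh) (pull _ csh) (pull _ cch) -/Jsh -/Jch.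
rewrite sinh0 cosh0 mul0r mul1r sub0r /survival_formula /trig_im subr0 /A /B.
by field; rewrite !gt_eqF.
Qed.

End trig_expectation.

(** * From the telegraph process to the meander *)

(** Free of any probability, so that it also applies to the sigma-algebra generated by [N]. *)
Lemma measurable_alive_preimage {R : realType} d (T : measurableType d) (N : R -> T -> nat) (t c : R)
    (B : set R) : (forall s, 0 <= s -> measurable_fun setT (N s)) ->
  (forall w s u, 0 <= s -> s <= u -> (N s w <= N u w)%N) ->
  0 <= t -> measurable B ->
  measurable [set w | B (c * displacement (N ^~ w) t) /\ alive (N ^~ w) t].
Proof.
move=> N_meas N_mono t0 mB.
have m : measurable_fun setT (fun w => c * displacement (N ^~ w) t).
  by apply: measurable_funM => //; exact: measurable_displacement.
rewrite (_ : [set w | _] = (setT `&` (fun w => c * displacement (N ^~ w) t) @^-1` B) `&`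
  [set w | alive (N ^~ w) t]).
  by apply: measurableI; [exact: m|exact: measurable_alive].
by apply/seteqP; split => w /= [] => [|[_]].
Qed.

Section transfer.
Context {R : realType} d (T : measurableType d) (P : probability T R).
Variables (lambda c t : R) (N : R -> T -> nat) (V0 : {RV P >-> R}).
Hypotheses (lambda0 : 0 < lambda) (c0 : 0 < c) (t0 : 0 < t).
Hypothesis HN : poisson_process P lambda N.
Hypothesis V0_uniform : uniform_on_pm c V0.
Hypothesis V0_indep : independent_of_process V0 N.

Let N_meas := poisson_measurable HN.
Let N_mono := poisson_nondecreasing HN.
Let Y w := displacement (N ^~ w) t.
Let alive_t := [set w | alive (N ^~ w) t].
Let mY : measurable_fun setT Y.
Proof. exact: measurable_displacement (ltW t0). Qed.
Let malive : measurable alive_t.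
Proof. exact: measurable_alive (ltW t0). Qed.
Let mV0 : measurable_fun setT V0. Proof. exact: measurable_funP. Qed.

Definition alive_preimage (B : set R) := [set w | B (c * Y w) /\ alive_t w].

Lemma measurable_alive_preimage_t B : measurable B -> measurable (alive_preimage B).
Proof. by move=> mB; apply: measurable_alive_preimage => //; exact: ltW. Qed.

Lemma telegraphE s w : 0 <= s -> telegraph N V0 s w = V0 w * displacement (N ^~ w) s.
Proof.
move=> s0; rewrite /telegraph /velocity RintegralZl//.
exact: (integrable_parity (N_mono w)).
Qed.

Lemma nonneg_minE w : nonneg_min t (telegraph N V0) w <->
  forall s, 0 <= s <= t -> 0 <= V0 w * displacement (N ^~ w) s.
Proof.
rewrite /nonneg_min/=; set S := [set _ | _ in _].
have Sne : S !=set0.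
  by exists (telegraph N V0 0 w); exists 0 => //=; rewrite in_itv/= lexx ltW.
have Slb : has_lbound S.
  exists (- (`|V0 w| * t)) => _ [s /= st <-]; move: st; rewrite in_itv/= => /andP[s0 st].
  rewrite telegraphE// lerNl; apply: le_trans (ler_norm _) _.
  rewrite normrN normrM ler_wpM2l//.
  have := displacement_lip (N_mono w) (lexx 0) s0; rewrite displacement0 !subr0.
  by move=> /le_trans; apply.
split=> [H s st|H].
  apply: le_trans H _; apply: ge_inf => //.
  by exists s; [rewrite /= in_itv|case/andP: st => s0 _; rewrite telegraphE].
apply: lb_le_inf => // _ [s /= + <-]; rewrite in_itv/= => st.
by rewrite telegraphE ?H//; case/andP: st.
Qed.

(** By right continuity [N] stays 0 on an initial interval, where the displacement at [s] is [s].
    This rules out a negative initial velocity for nonnegative paths. *)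
Lemma displacement_early w : exists2 s, 0 < s <= t & 0 < displacement (N ^~ w) s.
Proof.
have [e /= e0 H] := poisson_right_continuous HN w (lexx 0).
pose s := Num.min (e / 2) t.
have s0 : 0 < s by rewrite /s lt_min t0 divr_gt0.
have se : s < e by rewrite /s gt_min; apply/orP; left; lra.
exists s; first by rewrite s0 /s ge_min lexx orbT.
have Ns : N s w = N 0 w.
  by apply: H => //=; rewrite sub0r normrN gtr0_norm.
have := displacement_cst (N_mono w) (lexx 0) (ltW s0).
rewrite Ns subrr mulr0 displacement0 !subr0 normr_le0 subr_eq0 (poisson_start HN) expr0 mulr1.
by move=> /eqP ->.
Qed.

(** Pointwise [V0] may take any real value, as only its law is prescribed; the value 0, which
    freezes the path, is part of the null event of [V0_null]. *)
Lemma nonneg_min_alive w : nonneg_min t (telegraph N V0) w <->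
  (0 < V0 w /\ alive_t w) \/ V0 w = 0.
Proof.
rewrite nonneg_minE; split; last first.
  move=> [[v0 aw]|->] s st; last by rewrite mul0r.
  by rewrite mulr_ge0 ?(ltW v0)//; exact: aw.
move=> H; have [v0|v0|] := ltrgtP 0 (V0 w); last by right.
  by left; split => // s /H; rewrite pmulr_rge0.
have [s /andP[s0 st] Ys] := displacement_early w.
have := H s; rewrite (ltW s0) st => /(_ isT).
by rewrite nmulr_rge0// leNgt Ys.
Qed.

Lemma V0_atom : P (V0 @^-1` [set c]) = (2^-1)%:E.
Proof.
have := V0_uniform (measurable_set1 c); rewrite /distribution/pushforward => ->.
rewrite !diracE (_ : (- c \in [set c]) = false); last first.
  by apply/negbTE; rewrite notin_setE/= => cE; move: c0; lra.
by rewrite mem_set//= add0e mule1.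
Qed.

Lemma V0_null : P (V0 @^-1` [set x | 0 <= x /\ x != c]) = 0%E.
Proof.
have m : measurable [set x : R | 0 <= x /\ x != c].
  rewrite (_ : [set x | _] = `[0, +oo[ `\ c); first exact: measurableD.
  apply/seteqP; split => x /=; rewrite in_itv/= andbT.
    by move=> [x0 /eqP].
  by move=> [x0 /eqP].
have := V0_uniform m; rewrite /distribution/pushforward => ->.
rewrite !diracE !memNset ?adde0 ?mule0//=.
  by move=> [_]; rewrite eqxx.
by move=> [+ _]; rewrite oppr_ge0 leNgt c0.
Qed.

(** Independence of [V0] is stated for this sigma-algebra; the measurability argument is replayed
    with it as the measurable space. *)
Lemma generated_alive_preimage B : measurable B ->
  generated_sigma_algebra [set s : R | 0 <= s] N (alive_preimage B).
Proof.
move=> mB.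
pose G := [set A | exists i (B : set nat), [/\ [set s : R | 0 <= s] i, measurable B & A = N i @^-1` B]].
have mN (s : R) : 0 <= s -> measurable_fun setT (N s : g_sigma_algebraType G -> nat).
  move=> s0 _ U mU; rewrite setTI; apply: sub_sigma_algebra.
  by exists s, U.
exact: (@measurable_alive_preimage R _ (g_sigma_algebraType G) N t c B mN N_mono (ltW t0) mB).
Qed.

(** Up to a null set nonnegativity forces [V0 = c], an independent event of probability 1/2; this
    factor cancels in the conditional probability. *)
Lemma P_telegraph_nonneg B : measurable B ->
  P ([set w | B (telegraph N V0 t w)] `&` nonneg_min t (telegraph N V0)) =
  ((2^-1)%:E * P (alive_preimage B))%E.
Proof.
move=> mB; set F := _ `&` _; set K := V0 @^-1` [set c].
have mK : measurable K by rewrite -[K]setTI; exact: mV0.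
have mF : measurable F.
  rewrite (_ : F = (setT `&` (fun w => V0 w * Y w) @^-1` B) `&`
    (((setT `&` V0 @^-1` `]0, +oo[) `&` alive_t) `|` (setT `&` V0 @^-1` [set 0]))).
    apply: measurableI.
      suff m : measurable_fun setT (fun w => V0 w * Y w) by exact: m.
      exact: measurable_funM.
    apply: measurableU; last exact: mV0.
    by apply: measurableI => //; exact: mV0.
  apply/seteqP; split => w.
    move=> [Bw /nonneg_min_alive H]; split.
      by split => //; move: Bw; rewrite /= telegraphE// ltW.
    by case: H => [[v0 aw]|v0]; [left|right]; rewrite /= ?in_itv/= ?andbT.
  move=> [[_ Bw] H]; split; first by rewrite /= telegraphE// ltW.
  apply/nonneg_min_alive; case: H => [[[_ v0] aw]|[_ v0]]; [left|right] => //.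
  by split => //; move: v0; rewrite /= in_itv/= andbT.
rewrite (measureDI P mF mK).
have FK0 : P (F `\` K) = 0%E.
  apply/eqP; rewrite eq_le measure_ge0 andbT -V0_null; apply: le_measure; rewrite ?inE.
  - exact: measurableD.
  - rewrite -[X in measurable X]setTI; apply: mV0 => //.
    rewrite (_ : [set x | _] = `[0, +oo[ `\ c); first exact: measurableD.
    apply/seteqP; split => x /=; rewrite in_itv/= andbT; first by move=> [x0 /eqP].
    by move=> [x0 /eqP].
  - move=> w [[_ /nonneg_min_alive H] /= nK]; split; last exact/eqP.
    by case: H => [[/ltW]|->].
rewrite [X in (X + _)%E]FK0 add0e -V0_atom -V0_indep.
- congr (P _); apply/seteqP; split => w.
    move=> [[/= Bw /nonneg_min_alive H] Kw]; split => //; rewrite /K/= in Kw; split.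
      by move: Bw; rewrite telegraphE ?(ltW t0)// Kw.
    by case: H => [[]//|v0]; exfalso; move: c0; rewrite -Kw v0 ltxx.
  move=> [/= Kw [Bw aw]]; split => //; split; first by rewrite /= telegraphE ?(ltW t0)// Kw.
  by apply/nonneg_min_alive; left; rewrite Kw.
- by exists [set c].
- exact: generated_alive_preimage.
Qed.

Lemma survival_gt0 : 0 < survival P N t.
Proof.
rewrite (survivalE lambda0 HN t0) /survival_formula mulr_gt0 ?expR_gt0//.
have lt0 : 0 <= lambda * t by rewrite mulr_ge0// ltW.
by rewrite ltr_wpDr ?bessel_ge0 ?bessel0_gt0.
Qed.

Lemma conditional_telegraph B : measurable B ->
  conditional_probability P (nonneg_min t (telegraph N V0)) [set w | B (telegraph N V0 t w)] =
  fine (P (alive_preimage B)) / survival P N t.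
Proof.
move=> mB; rewrite /conditional_probability P_telegraph_nonneg//.
have := P_telegraph_nonneg measurableT.
rewrite (_ : [set w | setT _] = setT) ?setTI; last by apply/seteqP.
move=> ->; rewrite (_ : alive_preimage setT = alive_t); last first.
  by apply/seteqP; split => w // [].
have mQ := measurable_alive_preimage_t mB.
rewrite !fineM ?fin_num_measure// /= -/(survival P N t) invfM.
by rewrite mulrACA mulfV// mul1r.
Qed.

Context d' (T' : measurableType d') (P' : probability T' R).
Variable Tp : R -> T' -> R.
Hypothesis Tp_meander : telegraph_meander P N V0 t P' Tp.

Let mTp : measurable_fun setT (Tp t).
Proof. by apply: (meander_measurable Tp_meander); rewrite in_itv/= lexx ltW. Qed.

Lemma meander_marginal B : measurable B ->
  P' (Tp t @^-1` B) = (fine (P (alive_preimage B)) / survival P N t)%:E.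
Proof.
move=> mB; rewrite -conditional_telegraph//.
have := meander_law Tp_meander (A := [set f | B (f t)]); apply.
apply: sub_sigma_algebra; exists t, B; split => //.
by rewrite /= in_itv/= lexx ltW.
Qed.

(** The value -1 marks dead paths: on [0, +oo[ the image of [P] under this variable is the law of
    [c * Y] restricted to survival, and integrals transfer as push-forwards. *)
Let alive_end w := if `[< alive_t w >] then c * Y w else -1.

Let malive_end : measurable_fun setT alive_end.
Proof.
rewrite (_ : alive_end = fun w => (c * Y w + 1) * \1_alive_t w - 1).
  apply: measurable_funB => //; apply: measurable_funM; last exact: measurable_indic.
  by apply: measurable_funD => //; exact: measurable_funM.
apply/funext => w; rewrite /alive_end indicE; case: asboolP => aw.
  by rewrite mem_set// mulr1 addrK.
by rewrite memNset// mulr0 sub0r.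
Qed.

Let alive_end_ge0 w : 0 <= alive_end w <-> alive_t w.
Proof.
rewrite /alive_end; case: asboolP => aw; split => //.
  by move=> _; rewrite mulr_ge0 ?(ltW c0)//; apply: (aw t); rewrite lexx andbT; exact: ltW.
by rewrite ler0N1.
Qed.

Let D : set R := [set` `[0, +oo[].

Let alive_endD : alive_end @^-1` D = alive_t.
Proof.
by apply/seteqP; split => w; rewrite /D/= in_itv/= andbT => /alive_end_ge0.
Qed.

Lemma meander_integral_ge0 (f : R -> R) M : measurable_fun setT f ->
  (forall x, 0 <= f x <= M) ->
  survival P N t * \int[P']_w f (Tp t w) = \int[P]_(w in alive_t) f (c * Y w).
Proof.
move=> mf fM.
have s0 := survival_gt0.
have mD : measurable D by exact: measurable_itv.
pose k : {nonneg R} := NngNum (ltW s0).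
have f0 x : 0 <= f x by case/andP: (fM x).
have fMn x : `|f x| <= M by rewrite ger0_norm//; case/andP: (fM x).
have mfe : measurable_fun setT (EFin \o f) by exact/measurable_EFinP.
have E1 : (\int[pushforward P alive_end]_(x in D) (f x)%:E = \int[P]_(w in alive_t) (f (c * Y w))%:E)%E.
  rewrite ge0_integral_pushforward//; last 2 first.
  - exact: measurable_funTS.
  - by move=> x _; rewrite lee_fin.
  rewrite alive_endD; apply: eq_integral => w; rewrite inE => aw.
  by rewrite /= /alive_end asboolT.
have mTD : measurable (Tp t @^-1` D) by rewrite -[X in measurable X]setTI; exact: mTp.
have mfT : measurable_fun setT (fun w => f (Tp t w)) by exact: measurableT_comp.
have E2 : (\int[pushforward (mscale k P') (Tp t)]_(x in D) (f x)%:E =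
    (survival P N t)%:E * \int[P']_(w in Tp t @^-1` D) (f (Tp t w))%:E)%E.
  rewrite ge0_integral_pushforward//; last 2 first.
  - exact: measurable_funTS.
  - by move=> x _; rewrite lee_fin.
  apply: (@ge0_integral_mscale _ _ _ P' (Tp t @^-1` D) mTD k (fun w => (f (Tp t w))%:E)).
  - exact/measurable_EFinP/measurable_funTS.
  - by move=> x _; rewrite lee_fin.
(* The marginal law of the meander, scaled by the survival probability, agrees with the image of [P]
   on every measurable subset of [0, +oo[. *)
have E3 : (\int[pushforward P alive_end]_(x in D) (f x)%:E =
    \int[pushforward (mscale k P') (Tp t)]_(x in D) (f x)%:E)%E.
  apply: eq_measure_integral => B mB BD.
  transitivity ((survival P N t)%:E * P' (Tp t @^-1` B))%E; last by [].
  rewrite meander_marginal// -EFinM mulrC divfK ?gt_eqF//.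
  have mQ := measurable_alive_preimage_t mB.
  rewrite fineK ?fin_num_measure//; congr (P _); apply/seteqP; split => w.
    move=> /= Bw; have aw : alive_t w.
      by apply/alive_end_ge0; have := BD _ Bw; rewrite /D/= in_itv/= andbT.
    by split => //; move: Bw; rewrite /alive_end asboolT.
  by move=> [Bw aw] /=; rewrite /alive_end asboolT.
have TD1 : P' (~` (Tp t @^-1` D)) = 0%E.
  rewrite -[~` _]/(Tp t @^-1` (~` D)) meander_marginal; last exact: measurableC.
  rewrite (_ : alive_preimage (~` D) = set0) ?measure0 ?mul0r//.
  apply/seteqP; split => w //= [nD aw]; apply: nD; rewrite /D/= in_itv/= andbT.
  by have := (alive_end_ge0 w).2 aw; rewrite /alive_end asboolT.
have P'fin (A : set T') : measurable A -> (P' A < +oo)%E.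
  by move=> mA; rewrite ltey_eq fin_num_measure.
have split_int : \int[P']_w f (Tp t w) = \int[P']_(w in Tp t @^-1` D) f (Tp t w).
  rewrite -[in LHS](setUv (Tp t @^-1` D)) Rintegral_setU//; last 3 first.
  - exact: measurableC.
  - rewrite setUv; apply: (@integrable_bounded _ _ _ _ _ _ M) => //; exact: P'fin.
  - by apply/disj_setPS => w [].
  have : `|\int[P']_(w in ~` (Tp t @^-1` D)) f (Tp t w)| <= M * fine (P' (~` (Tp t @^-1` D))).
    apply: normr_Rintegral_le => //; [exact: measurableC|exact/P'fin/measurableC|exact: measurable_funTS].
  by rewrite TD1 mulr0 normr_le0 => /eqP ->; rewrite addr0.
rewrite split_int /Rintegral -E1 E3 E2 fineM//.
apply: integrable_fin_num => //.
by apply: (@integrable_bounded _ _ _ _ _ _ M) => //; [exact: P'fin|exact: measurable_funTS].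
Qed.

Lemma meander_integral (f : R -> R) : measurable_fun setT f ->
  (forall x, `|f x| <= 1) ->
  \int[P']_w f (Tp t w) = (\int[P]_(w in alive_t) f (c * Y w)) / survival P N t.
Proof.
move=> mf f1; have s0 := survival_gt0.
apply: (mulfI (lt0r_neq0 s0)); rewrite mulrC [RHS]mulrC divfK ?gt_eqF// mulrC.
(* Shifting by 1 makes the integrand nonnegative; the integrals of the constant cancel
   afterwards. *)
have mf1 : measurable_fun setT (fun x => f x + 1) by exact: measurable_funD.
have H := meander_integral_ge0 (M := 2) mf1 _.
have P'1 : (P' setT < +oo)%E by rewrite ltey_eq fin_num_measure.
have Pa : (P alive_t < +oo)%E by rewrite ltey_eq fin_num_measure.
have {H} : survival P N t * \int[P']_w (f (Tp t w) + 1) = \int[P]_(w in alive_t) (f (c * Y w) + 1).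
  by apply: H => x; have := f1 x; rewrite ler_norml => /andP[h1 h2]; apply/andP; split; lra.
rewrite RintegralD//; last 2 first.
- by apply: (@integrable_bounded _ _ _ _ _ _ 1) => //; exact: measurableT_comp.
- by apply: (@integrable_bounded _ _ _ _ _ _ 1) => // x _; rewrite normr1.
rewrite RintegralD//; last 2 first.
- apply: (@integrable_bounded _ _ _ _ _ _ 1) => //; apply: measurable_funTS.
  by apply: measurableT_comp => //; exact: measurable_funM.
- by apply: (@integrable_bounded _ _ _ _ _ _ 1) => // x _; rewrite normr1.
rewrite Rintegral_cst// Rintegral_cst// [X in _ * fine X]probability_setT.
by rewrite -/(survival P N t) mulrDr !mulr1 mul1r => /addIr.
Qed.

End transfer.

(** * The characteristic function of the endpoint *)

Local Open Scope complex_scope.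

Lemma cexp_imaginary {R : realType} (g x : R) :
  cexp ((0 +i* 1) * g%:C * x%:C) = cos (g * x) +i* sin (g * x).
Proof.
have -> : (0 +i* 1) * g%:C * x%:C = 0 +i* (g * x) :> R[i].
  by simpc; rewrite ?(mul0r, mul1r, mulr0, addr0, subr0, sub0r, oppr0).
by rewrite /cexp /= expR0; simpc; rewrite ?(mul1r, mul0r, subr0, addr0).
Qed.

Theorem theorem3p1 (R : realType) (lambda c t gamma : R)
    (d : measure_display) (T : measurableType d) (P : probability T R)
    (N : R -> T -> nat) (V0 : {RV P >-> R})
    (d' : measure_display) (T' : measurableType d') (P' : probability T' R)
    (Tp : R -> T' -> R)
    (lambda_gt0 : 0 < lambda) (c_gt0 : 0 < c) (t_gt0 : 0 < t)
    (N_poisson : poisson_process P lambda N)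
    (V0_uniform : uniform_on_pm c V0)
    (V0_indep : independent_of_process V0 N)
    (Tp_meander : telegraph_meander P N V0 t P' Tp)
    (gamma_small : `|gamma| < lambda / c) :
  let r : R := Num.sqrt (lambda ^+ 2 - c ^+ 2 * gamma ^+ 2) in
  let I0 : R -> R := besselI 0 in
  let I1 : R -> R := besselI 1 in
  let i : R[i] := 0 +i* 1 in
  let icg : R[i] := i * (c * gamma)%:C in
  cexpectation P' (fun w => cexp (i * gamma%:C * (Tp t w)%:C)) =
  1 + (c * gamma)%:C * ((c * gamma)%:C + i * lambda%:C) *
      (((sinh (t * r))%:C +
        icg * (\int[lebesgue_measure]_(s in `[0, t])
                 (sinh (s * r) * I0 (lambda * (t - s))))%:C) /
       (lambda * r * (I0 (lambda * t) + I1 (lambda * t)))%:C)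
    + icg *
      (((cosh (t * r))%:C - (I0 (lambda * t))%:C +
        icg * (\int[lebesgue_measure]_(s in `[0, t])
                 (cosh (s * r) * I0 (lambda * (t - s))))%:C) /
       (lambda * (I0 (lambda * t) + I1 (lambda * t)))%:C).
Proof.
move=> r I0 I1 i icg.
pose g := c * gamma.
have g2 : g ^+ 2 < lambda ^+ 2.
  rewrite -[ltLHS]real_normK ?num_real// ltrXn2r// /g normrM gtr0_norm// mulrC.
  by rewrite -ltr_pdivlMr.
have rE : r ^+ 2 = lambda ^+ 2 - g ^+ 2.
  by rewrite /r sqr_sqrtr /g ?exprMn// subr_ge0 -exprMn ltW.
have r_gt0 : 0 < r by rewrite sqrtr_gt0 -exprMn subr_gt0.
have marginal theta : \int[P']_w cos (gamma * Tp t w + theta) =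
    (\int[P]_(w in [set w | alive (N ^~ w) t]) cos (g * displacement (N ^~ w) t + theta))
      / survival P N t.
  have cf : continuous (fun x : R => cos (gamma * x + theta)) by by_derivative.
  have H := meander_integral lambda_gt0 c_gt0 t_gt0 N_poisson V0_uniform V0_indep Tp_meander
    (continuous_measurable_fun cf).
  rewrite H; last by move=> x; rewrite ler_norml cos_geN1 cos_le1.
  by congr (_ / _); apply: eq_Rintegral => w _; rewrite mulrA [gamma * c]mulrC.
have lt0 : 0 <= lambda * t by rewrite mulr_ge0// ltW.
have I0E x : 0 <= x -> I0 x = bessel 0 x by move=> x0; rewrite /I0 -(besselIE 0 x0).
have I1E x : 0 <= x -> I1 x = bessel 1 x by move=> x0; rewrite /I1 -(besselIE 1 x0).
rewrite !(I0E _ lt0) (I1E _ lt0).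
(* [besselI] agrees with the power series at nonnegative arguments, and [lambda * (t - s)] is one
   for [s] in [0, t]. *)
have convE (k : R -> R) : \int[lebesgue_measure]_(s in `[0, t]) (k (s * r) * I0 (lambda * (t - s))) =
    \int[lebesgue_measure]_(s in `[0, t]) (k (r * s) * bessel 0 (lambda * (t - s))).
  apply: eq_Rintegral => s; rewrite inE/= in_itv/= => /andP[_ st].
  by rewrite I0E ?[s * r]mulrC// mulr_ge0 ?subr_ge0// ltW.
rewrite !convE.
have W0 : 0 < bessel 0 (lambda * t) + bessel 1 (lambda * t).
  by rewrite ltr_wpDr ?bessel_ge0 ?bessel0_gt0.
have e0 : 0 < expR (- (lambda * t)) by exact: expR_gt0.
(* The phases 0 and - pi / 2 give the expectations of the cosine and the sine. *)
have := marginal 0; have := marginal (- (pi / 2)).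
rewrite !(alive_cos lambda_gt0 N_poisson r_gt0 t_gt0 rE) (survivalE lambda_gt0 N_poisson t_gt0).
rewrite /survival_formula cosN sinN cos_pihalf sin_pihalf cos0 sin0.
rewrite [t * r]mulrC.
move: W0; move: (bessel 0 (lambda * t)) (bessel 1 (lambda * t)) => b0 b1 W0.
move: (sinh (r * t)) (cosh (r * t)) => sh ch.
set Jsh := \int[lebesgue_measure]_(s in _) (sinh _ * _).
set Jch := \int[lebesgue_measure]_(s in _) (cosh _ * _).
move=> HIm HRe.
have -> : cexpectation P' (fun w => cexp (i * gamma%:C * (Tp t w)%:C)) =
    \int[P']_w cos (gamma * Tp t w + 0) +i* \int[P']_w cos (gamma * Tp t w - pi / 2).
  rewrite /cexpectation unlock /Rintegral; congr (fine _ +i* fine _); apply: eq_integral => w _.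
    by rewrite cexp_imaginary addr0.
  by rewrite cexp_imaginary cosB cos_pihalf sin_pihalf mulr0 add0r mulr1.
rewrite HIm HRe -!fmorphV.
have rn0 := lt0r_neq0 r_gt0; have ln0 := lt0r_neq0 lambda_gt0.
have en0 := lt0r_neq0 e0; have Wn0 := lt0r_neq0 W0.
rewrite /icg /i -/g; simpc.
(* In the imaginary part [Jsh] comes with the factor g (lambda / r - r / lambda), where the
   statement has g^3 / (lambda r), both over the same Bessel sum. *)
have gg : g * g = lambda ^+ 2 - r ^+ 2 by rewrite rE; ring.
congr (_ +i* _); last rewrite gg.
  by field; rewrite ?en0 ?Wn0 ?rn0 ?ln0.
by field; rewrite ?en0 ?Wn0 ?rn0 ?ln0.
Qed.
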